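(* Let $P$ be a polynomial on $\mathbb{R}^d$, $1\le p\le\infty$, and $f\in\mathcal{S}(\mathbb{R}^d)$. Then, in the extended positive real numbers, $$\lim_{n\to\infty}\|P(\partial)^n f\|_p^{1/n}=R(P,\mathcal{F}f).$$
   Context: $\mathcal{S}(\mathbb{R}^d)$ is the Schwartz space; the extended positive real numbers are $[0,\infty]$, and $\|\cdot\|_p$ is the $L^p(\mathbb{R}^d)$-norm. Polynomials have complex coefficients. For a polynomial $P$ on $\mathbb{R}^d$, $P(\partial)$ is the corresponding constant coefficient differential operator, so that $P(\partial)e^{i\lambda\cdot x}=P(i\lambda)e^{i\lambda\cdot x}$. The Fourier transform is $\mathcal{F}f(\lambda)=(2\pi)^{-d/2}\int_{\mathbb{R}^d}f(x)e^{-i\lambda\cdot x}\,dx$. For a distribution $T$ on $\mathbb{R}^d$, $R(P,T)=\sup\{|P(i\lambda)|:\lambda\in\operatorname{supp}T\}\in[0,\infty]$, with $R(P,T)=0$ if $T=0$. *)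

(* Defs.v *)
(* MathComp-Analysis, over an arbitrary [R : realType].  [mpoly] is required
   without being imported because its notations clash with MathComp-Analysis. *)
From HB Require Import structures.
From mathcomp Require Import all_boot all_order all_algebra.
From mathcomp Require Import all_classical all_reals all_analysis.
From mathcomp Require Export complex.
From mathcomp Require mpoly.

Set Implicit Arguments.
Unset Strict Implicit.
Unset Printing Implicit Defensive.

Import Order.TTheory GRing.Theory Num.Theory.
Import numFieldNormedType.Exports.

Local Open Scope classical_set_scope.
Local Open Scope ring_scope.
Local Open Scope complex_scope.

Notation cRe := (@complex.Re _).
Notation cIm := (@complex.Im _).
Notation cabs := (@ComplexField.Normc.normc _).

(* [{mpoly A[n]}] and ['X_{1..n}] of multinomials *)
Notation mpolynomial A n := (mpoly.mpoly n A).
Notation multiindex n := (mpoly.multinom n).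

(* R^d carries the sigma-algebra generated by the coordinates, i.e. its Borel
   sigma-algebra. *)
Section measurable_rV.
Variables (R : realType) (d : nat).

Definition rV_coord (i : 'I_d) (x : 'rV[R]_d) : measurableTypeR R := x 0 i.

Let rV_set0 : g_sigma_preimage rV_coord set0.
Proof. exact: sigma_algebra0. Qed.

Let rV_setC A : g_sigma_preimage rV_coord A -> g_sigma_preimage rV_coord (~` A).
Proof. exact: sigma_algebraC. Qed.

Let rV_bigcup (F : (set 'rV[R]_d)^nat) :
  (forall i, g_sigma_preimage rV_coord (F i)) ->
  g_sigma_preimage rV_coord (\bigcup_i (F i)).
Proof. exact: sigma_algebra_bigcup. Qed.

Definition measure_rV_display : measure_display.
Proof. by constructor. Qed.

HB.instance Definition _ := @isMeasurable.Build measure_rV_display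
  'rV[R]_d (g_sigma_preimage rV_coord) rV_set0 rV_setC rV_bigcup.

End measurable_rV.

Section lebesgue_rV.
Variable R : realType.
Local Notation M := (measurableTypeR R).

Definition push_measure d1 d2 (T1 : measurableType d1) (T2 : measurableType d2)
    (g : T1 -> T2) (mg : measurable_fun setT g)
    (mu : {measure set T1 -> \bar R}) : {measure set T2 -> \bar R} :=
  measure_function_pushforward__canonical__measure_function_Measure mu mg.

Definition tuple_cons d (z : d.-tuple M * M) : d.+1.-tuple M :=
  [the d.+1.-tuple M of z.2 :: z.1].

Lemma measurable_tuple_cons d : measurable_fun setT (@tuple_cons d).
Proof. exact: measurable_cons. Qed.

Fixpoint lebesgue_tuple d : {measure set (d.-tuple M) -> \bar R} :=
  if d is d'.+1 then
    push_measure (@measurable_tuple_cons d')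
      [the {measure set (d'.-tuple M * M) -> \bar R} of
        (lebesgue_tuple d' \x @lebesgue_measure R)%E]
  else [the {measure set (0.-tuple M) -> \bar R} of \d_ [tuple]].

Definition rV_of_tuple d (t : d.-tuple M) : 'rV[R]_d := \row_i tnth t i.

Lemma measurable_rV_of_tuple d : measurable_fun setT (@rV_of_tuple d).
Proof.
move=> _ A mA; rewrite setTI.
suff -> : measurable = preimage_set_system setT (@rV_of_tuple d) measurable.
  by exists A => //; rewrite setTI.
rewrite /measurable/= -g_sigma_preimage_comp; congr (g_sigma_preimage _).
by apply/funext => i; apply/funext => t; rewrite /= /rV_coord mxE.
Qed.

(* The d-fold product of the one-dimensional Lebesgue measure. *)
Definition lebesgue_rV d : {measure set 'rV[R]_d -> \bar R} :=
  push_measure (@measurable_rV_of_tuple d) (lebesgue_tuple d).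

Lemma lebesgue_tuple_box d (A : 'I_d -> set M) :
  (forall i, measurable (A i)) ->
  lebesgue_tuple d [set t | forall i, A i (tnth t i)] =
  (\prod_(i < d) lebesgue_measure (A i))%E.
Proof.
elim: d A => [A _|d IH A mA].
  rewrite big_ord0 /= diracE mem_set //; by move=> [].
rewrite big_ord_recl /= /pushforward /=.
rewrite (_ : _ @^-1` _ =
    [set t : d.-tuple _ | forall i, A (lift ord0 i) (tnth t i)] `*` A ord0); last first.
  apply/seteqP; split => -[t x] /=.
    move=> H; split; last by have := H ord0.
    by move=> i; have := H (lift ord0 i); rewrite tnthS.
  move=> [H1 H2] i; case: (unliftP ord0 i) => [j ->|->] //; rewrite tnthS; exact: H1.
rewrite product_measure1E //.
  by rewrite (IH (fun i => A (lift ord0 i)))// muleC.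
rewrite (_ : [set _ | _] = \bigcap_(i in [set: 'I_d])
    ((fun t : d.-tuple M => tnth t i) @^-1` A (lift ord0 i))); last first.
  by apply/seteqP; split => t /= H i; [move=>_|]; apply: H.
apply: fin_bigcap_measurable => // i _.
by rewrite -[X in measurable X]setTI; apply: measurable_tnth.
Qed.

Lemma lebesgue_rV_box d (A : 'I_d -> set M) :
  (forall i, measurable (A i)) ->
  lebesgue_rV d [set t | forall i, A i (t 0 i)] =
  (\prod_(i < d) lebesgue_measure (A i))%E.
Proof.
move=> mA; rewrite -lebesgue_tuple_box// /= /pushforward.
congr (lebesgue_tuple _ _).
by apply/seteqP; split => t /= H i; move: (H i); rewrite mxE.
Qed.

End lebesgue_rV.

Section complex_functions.
Variables (R : realType) (d : nat).
Implicit Types (f g : 'rV[R]_d -> R[i]) (x y : 'rV[R]_d).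

Definition dotp x y : R := \sum_(i < d) x 0 i * y 0 i.

Definition expi (t : R) : R[i] := cos t +i* sin t.

Definition cintegral f : R[i] :=
  (\int[lebesgue_rV R d]_x cRe (f x)) +i* (\int[lebesgue_rV R d]_x cIm (f x)).

Definition cLnorm (p : \bar R) f : \bar R :=
  Lnorm (lebesgue_rV R d) p (fun x => (cabs (f x))%:E).

Definition basis_vector (i : 'I_d) : 'rV[R]_d := delta_mx 0 i.

(* MathComp-Analysis derives along real directions only in real normed modules,
   so the real and imaginary parts are derived separately. *)
Definition cderivable f x (i : 'I_d) : Prop :=
  derivable (cRe \o f) x (basis_vector i) /\
  derivable (cIm \o f) x (basis_vector i).

Definition partial (i : 'I_d) f : 'rV[R]_d -> R[i] := fun x =>
  ('D_(basis_vector i) (cRe \o f) x) +i* ('D_(basis_vector i) (cIm \o f) x).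

Definition partials (s : seq 'I_d) f := foldr partial f s.

Definition smooth f : Prop := forall s : seq 'I_d,
  [/\ continuous (cRe \o partials s f), continuous (cIm \o partials s f) &
      forall x i, cderivable (partials s f) x i].

Definition mpartial (m : multiindex d) f :=
  foldr (fun i => iter (mpoly.fun_of_multinom m i) (partial i)) f (enum 'I_d).

Definition monomial (m : multiindex d) x : R :=
  \prod_(i < d) x 0 i ^+ mpoly.fun_of_multinom m i.

Definition schwartz f : Prop :=
  smooth f /\
  forall a b : multiindex d, exists C : R,
    forall x, cabs ((monomial a x)%:C * mpartial b f x) <= C.

Definition diffop (P : mpolynomial R[i] d) f : 'rV[R]_d -> R[i] :=
  fun x => \sum_(m <- mpoly.msupp P) mpoly.mcoeff m P * mpartial m f x.

Definition eval_i (P : mpolynomial R[i] d) (l : 'rV[R]_d) : R[i] :=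
  mpoly.meval (fun j => 'i%C * (l 0 j)%:C) P.

Definition fourier f : 'rV[R]_d -> R[i] := fun l =>
  ((2 * pi) `^ (- (d%:R / 2)))%:C * cintegral (fun x => f x * expi (- dotp l x)).

Definition fun_supp f : set 'rV[R]_d := closure [set x | f x != 0].

Definition test_function f : Prop := smooth f /\ compact (fun_supp f).

(* A distribution is a functional on test functions; the definitions below make
   sense for arbitrary functionals. *)
Implicit Type T : ('rV[R]_d -> R[i]) -> R[i].

Definition distribution_of g : ('rV[R]_d -> R[i]) -> R[i] :=
  fun phi => cintegral (fun x => g x * phi x).

Definition vanishes_on (U : set 'rV[R]_d) T : Prop :=
  forall phi, test_function phi -> fun_supp phi `<=` U -> T phi = 0.

Definition supp T : set 'rV[R]_d :=
  ~` \bigcup_(U in [set U | open U /\ vanishes_on U T]) U.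

Definition supp_radius (P : mpolynomial R[i] d) T : \bar R :=
  if `[< forall phi, test_function phi -> T phi = 0 >] then 0%E
  else ereal_sup [set (cabs (eval_i P l))%:E | l in supp T].

End complex_functions.

(* Main.v *)
(** Upper bound: fix [r > R(P, F f)] and let [V] be the open set where
    [|P(i l)| > r].  The Schwartz functions [h] with [F h = 0] on [V] are stable
    under multiplication by coordinates (by duality with test functions
    supported in [V]), under [D = P(d)], and under its commutators with the
    coordinates.  Bounding [D^n h] by the integral of [|F (D^n h)|] gives
    [|D^n h| <= C r^n] for each of them, and
    [x_j D^n h = D^n (x_j h) - n D^(n-1) [D, x_j] h] then gives the same bound,
    up to a power of [n], for all [x^a D^n f]; hence the growth of
    [||D^n f||_p] is at most [r^n] for every [p] at once.

    Lower bound: if [0 < r < R(P, F f)], some test function [phi] supported in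
    the set where [|P(i l)| > r] has [int F f . phi <> 0].  Since
    [int F f . phi = int D^n f . F (phi / P^n)], and [F (phi / P^n)] is at most
    [C s^(-n) prod_j 1 / (1 + x_j^2)] for every [s < r] by the same
    commutation argument, [||D^n f||_p] grows at least like [s^n].

    The bound of [h] by the [L^1]-norm of [F h] replaces Fourier inversion: it
    follows from pairing [h] with the Poisson kernel, the Fourier transform of
    [exp(-a (|l_1| + ... + |l_d|))], as [a -> 0]. *)
From HB Require Import structures.
Require Import Defs.
From mathcomp Require Import all_boot all_order all_algebra.
From mathcomp Require Import all_classical all_reals all_analysis.
From mathcomp Require Import measurable_realfun ess_sup_inf ring lra.
Set Implicit Arguments.
Unset Strict Implicit.
Unset Printing Implicit Defensive.
Import Order.TTheory GRing.Theory Num.Theory.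
Import numFieldNormedType.Exports.
Local Open Scope classical_set_scope.
Local Open Scope ring_scope.
Local Open Scope complex_scope.

(** All estimates are phrased with the weight [prod_j 1 / (1 + x_j^2)], which is integrable and at
    most 1: a bound by a multiple of it controls the [L^p] norm for every p, and an integral against
    it is in turn controlled by that norm, with constants independent of p. An [L^1] bound on a
    Fourier transform only yields a sup bound, so decay has to come from sup bounds on monomial
    multiples. The obstacle is that [x_j] does not commute with [D^n]. Since [[D, x_j]] commutes
    with D, each coordinate costs a single factor n; the weight involves a fixed number of
    coordinates, hence a polynomial in n, absorbed by a slightly larger ratio. The dual sequence
    [F (phi / P^n)] obeys the same recursion, with [P^-1] in the role of D, so one abstract growth
    statement, [weight_growth], serves both halves. Multiplicative constants, such as those caused
    by splitting into real and imaginary parts, disappear in the n-th root and are not optimised.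
    The radii 0 and infinity fit the same scheme: the upper bound concerns finite t above the
    radius, the lower bound positive t below it. *)

(** * The complex modulus *)

Section complex_modulus.
Variable R : realType.
Implicit Types z w : R[i].

Lemma complex_ext z w : cRe z = cRe w -> cIm z = cIm w -> z = w.
Proof. by case: z w => a b [a' b'] /= -> ->. Qed.

Lemma cabs_ge0 z : 0 <= cabs z.
Proof. by case: z => ? ?; exact: sqrtr_ge0. Qed.

Lemma cabsD z w : cabs (z + w) <= cabs z + cabs w.
Proof. exact: le_normcD z w. Qed.

Lemma cabsM z w : cabs (z * w) = cabs z * cabs w.
Proof. exact: ComplexField.Normc.normcM. Qed.

Lemma cabsN z : cabs (- z) = cabs z.
Proof. exact: normcN z. Qed.

Lemma cabsV z : cabs z^-1 = (cabs z)^-1.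
Proof. exact: ComplexField.Normc.normcV. Qed.

Lemma cabs0 : cabs (0 : R[i]) = 0.
Proof. exact: ComplexField.Normc.normc0. Qed.

Lemma cabs1 : cabs (1 : R[i]) = 1.
Proof. exact: ComplexField.Normc.normc1. Qed.

Lemma cabsX z n : cabs (z ^+ n) = cabs z ^+ n.
Proof. by elim: n => [|n IH]; rewrite ?expr0 ?cabs1// !exprS cabsM IH. Qed.

Lemma cabs_eq0 z : (cabs z == 0) = (z == 0).
Proof.
apply/eqP/eqP => [|->]; last exact: cabs0.
exact: ComplexField.Normc.eq0_normc.
Qed.

Lemma cabs_gt0 z : (0 < cabs z) = (z != 0).
Proof. by rewrite lt_def cabs_ge0 andbT cabs_eq0. Qed.

Lemma cabs_real (r : R) : cabs r%:C = `|r|.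
Proof. by rewrite /= expr0n/= addr0 sqrtr_sqr. Qed.

Lemma cabs_Re z : `|cRe z| <= cabs z.
Proof. by case: z => a b /=; rewrite -sqrtr_sqr ler_wsqrtr// lerDl sqr_ge0. Qed.

Lemma cabs_Im z : `|cIm z| <= cabs z.
Proof. by case: z => a b /=; rewrite -sqrtr_sqr ler_wsqrtr// lerDr sqr_ge0. Qed.

Lemma cabs_ReIm z : cabs z <= `|cRe z| + `|cIm z|.
Proof.
have -> : z = (cRe z)%:C + 'i%C * (cIm z)%:C by rewrite -complexE.
rewrite (le_trans (cabsD _ _))// cabsM !cabs_real.
rewrite (_ : cabs 'i%C = 1) ?mul1r; last by rewrite /= expr0n expr1n add0r sqrtr1.
by case: z => a b /=; rewrite !(mul0r, mul1r, mulr0, addr0, add0r, subr0).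
Qed.

End complex_modulus.

(** * Symmetry of second derivatives *)

Section mixed_partials.
Variables (R : realType) (V : normedModType R).
Implicit Types (u : V -> R) (v w x : V).

(** The difference quotients of [u] along [v] and of its restriction to the line are literally the
    same functions; this brings the one-variable mean value theorem and chain rule to directional
    derivatives. *)
Lemma is_derive_line u v x (t : R) : derivable u (x + t *: v) v ->
  is_derive t 1 (fun s : R => u (x + s *: v)) ('D_v u (x + t *: v)).
Proof.
move=> du.
have E : (fun h : R => h^-1 *: (((fun s : R => u (x + s *: v)) \o shift t) (h *: 1) - u (x + t *: v)))
   = (fun h : R => h^-1 *: ((u \o shift (x + t *: v)) (h *: v) - u (x + t *: v))).
  apply/funext => h /=; congr (_ *: (u _ - _)).
  by rewrite [h%:A]mulr1 scalerDl addrCA.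
split; last by rewrite /derive E.
by move: du; rewrite /derivable E.
Qed.

Lemma line_mean_value u (uv : V -> R) v x (h : R) :
  (forall y, is_derive y v u (uv y)) -> 0 < h ->
  exists2 c : R, 0 < c < h & u (x + h *: v) - u x = h * uv (x + c *: v).
Proof.
move=> du h0.
have dl (t : R) : is_derive t 1 (fun s : R => u (x + s *: v)) (uv (x + t *: v)).
  have /is_derive_line := @ex_derive _ _ _ _ _ _ _ (du (x + t *: v)).
  by rewrite (@derive_val _ _ _ _ _ _ _ (du _)).
have [|c] := @MVT R (fun s => u (x + s *: v)) (fun s => uv (x + s *: v)) 0 h h0
  (fun t _ => dl t).
  apply: derivable_within_continuous => t _; exact: (@ex_derive _ _ _ _ _ _ _ (dl t)).
rewrite in_itv/= => ch; rewrite scale0r addr0 subr0 mulrC => ->.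
by exists c.
Qed.

(** Two applications of the mean value theorem: along [v] to the increment [u (y + h w) - u y], then
    along [w] to [uv]. The left-hand side is symmetric in [v] and [w], which is what the next lemma
    exploits. *)
Lemma second_difference u (uv uvw : V -> R) v w x (h : R) :
  (forall y, is_derive y v u (uv y)) -> (forall y, is_derive y w uv (uvw y)) -> 0 < h ->
  exists c e : R, [/\ 0 < c < h, 0 < e < h &
    u (x + h *: v + h *: w) - u (x + h *: v) - u (x + h *: w) + u x =
    h * (h * uvw (x + c *: v + e *: w))].
Proof.
move=> dv dvw h0.
pose U y := u (y + h *: w) - u y.
have shE y : is_derive y v (fun z => u (z + h *: w)) (uv (y + h *: w)).
  have E : (fun k : R => k^-1 *: (((fun z => u (z + h *: w)) \o shift y) (k *: v) - u (y + h *: w)))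
   = (fun k : R => k^-1 *: ((u \o shift (y + h *: w)) (k *: v) - u (y + h *: w))).
    by apply/funext => k /=; rewrite addrA.
  have [d1 d2] := dv (y + h *: w).
  split; last by rewrite /derive E.
  by move: d1; rewrite /derivable E.
have dU y : is_derive y v U (uv (y + h *: w) - uv y) by exact: is_deriveB.
have [c ch] := line_mean_value x dU h0.
have [e eh ->] := line_mean_value (x + c *: v) dvw h0.
rewrite /U => E; exists c, e; split => //; rewrite -E; ring.
Qed.

(** Both second differences are the same number, so [uvw] and [uwv] take a common value at two
    points that approach [x] with the step; continuity at [x] concludes. *)
Lemma mixed_partials_eq u (uv uw uvw uwv : V -> R) v w x :
  (forall y, is_derive y v u (uv y)) -> (forall y, is_derive y w u (uw y)) ->
  (forall y, is_derive y w uv (uvw y)) -> (forall y, is_derive y v uw (uwv y)) ->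
  {for x, continuous uvw} -> {for x, continuous uwv} -> uvw x = uwv x.
Proof.
move=> dv dw dvw dwv cvw cwv.
apply/eqP; rewrite -subr_eq0 -normr_le0; apply/ler_addgt0Pr => e e0; rewrite add0r.
have e20 : 0 < e / 2 by rewrite divr_gt0.
have /(@nbhs_ballP _ V)[r1/= r10 H1] : \forall y \near x, `|uvw x - uvw y| < e / 2.
  by have /cvgrPdist_lt/(_ _ e20) := cvw.
have /(@nbhs_ballP _ V)[r2/= r20 H2] : \forall y \near x, `|uwv x - uwv y| < e / 2.
  by have /cvgrPdist_lt/(_ _ e20) := cwv.
(* The step [h] is chosen with [h (|v| + |w|)] below both radii, so that all mean value points lie
   in both balls; the summand 1 keeps [M] positive when [v = w = 0]. *)
pose M := `|v| + `|w| + 1.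
have M0 : 0 < M by rewrite ltr_wpDl// addr_ge0.
pose h := Num.min r1 r2 / M.
have h0 : 0 < h by rewrite divr_gt0// lt_min r10.
have inball (r c k : R) :
    Num.min r1 r2 <= r -> 0 < c < h -> 0 < k < h -> ball x r (x + c *: v + k *: w).
  move=> rr /andP[c0 ch] /andP[k0 kh]; rewrite -ball_normE/= -addrA opprD addNKr normrN.
  apply: (le_lt_trans (ler_normD _ _)); rewrite !normrZ !gtr0_norm//.
  apply: (@le_lt_trans _ _ (h * (`|v| + `|w|))).
    by rewrite mulrDr lerD// ler_wpM2r// ltW.
  apply: lt_le_trans rr; rewrite -[ltRHS](@divfK _ M) ?gt_eqF// ltr_pM2l//.
  by rewrite ltrDl.
have [c [k [ch kh E1]]] := second_difference x dv dvw h0.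
have [c' [k' [ch' kh' E2]]] := second_difference x dw dwv h0.
have E : uvw (x + c *: v + k *: w) = uwv (x + c' *: w + k' *: v).
  have hn : h != 0 by rewrite gt_eqF.
  apply: (mulfI hn); apply: (mulfI hn); rewrite -E1 -E2.
  by rewrite (addrAC x (h *: w)); congr (_ + _); exact: addrAC.
have B1 : `|uvw x - uvw (x + c *: v + k *: w)| < e / 2.
  by apply: H1; apply: inball => //; rewrite ge_min lexx.
have B2 : `|uwv x - uwv (x + c' *: w + k' *: v)| < e / 2.
  by apply: H2; rewrite addrAC; apply: inball => //; rewrite ge_min lexx orbT.
rewrite -E in B2.
rewrite (_ : _ - _ = (uvw x - uvw (x + c *: v + k *: w)) -
  (uwv x - uvw (x + c *: v + k *: w))); last by ring.
by rewrite (le_trans (ler_normB _ _))// [leRHS]splitr lerD// ltW.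
Qed.

End mixed_partials.

(** * Partial derivatives and continuity of complex-valued functions *)

Section complex_calculus.
Variables (R : realType) (d : nat).
Implicit Types (f g : 'rV[R]_d -> R[i]) (x y : 'rV[R]_d) (i j : 'I_d) (z w : R[i]).

(** Relational form of [partial]: it carries derivability together with the value, so that the rules
    of calculus chain without side conditions. *)
Definition has_partial f x i z :=
  is_derive x (basis_vector R i) (cRe \o f) (cRe z) /\
  is_derive x (basis_vector R i) (cIm \o f) (cIm z).

Lemma has_partialP f x i : cderivable f x i -> has_partial f x i (partial i f x).
Proof. by move=> [df dg]; split; exact/derivableP. Qed.

Lemma has_partial_derivable f x i z : has_partial f x i z -> cderivable f x i.
Proof. by move=> [df dg]; split; exact: ex_derive. Qed.

Lemma has_partialE f x i z : has_partial f x i z -> partial i f x = z.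
Proof.
move=> [df dg]; rewrite /partial (@derive_val _ _ _ _ _ _ _ df).
by rewrite (@derive_val _ _ _ _ _ _ _ dg); case: z {df dg}.
Qed.

Lemma has_partial_eq f x i z w : has_partial f x i z -> z = w -> has_partial f x i w.
Proof. by move=> + <-. Qed.

Lemma near_eq_has_partial f g x i z : {near x, f =1 g} ->
  has_partial f x i z -> has_partial g x i z.
Proof.
have ei0 : basis_vector R i != 0.
  by apply/eqP => /matrixP/(_ 0 i)/eqP; rewrite !mxE !eqxx oner_eq0.
move=> fg [df dg].
by split; [apply: near_eq_is_derive df|apply: near_eq_is_derive dg] => //;
   apply: filterS fg => y /= ->.
Qed.

Lemma has_partial_cst x i z : has_partial (fun=> z) x i 0.
Proof. by split; exact: is_derive_cst. Qed.

Lemma has_partialD f g x i z w : has_partial f x i z -> has_partial g x i w ->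
  has_partial (fun y => f y + g y) x i (z + w).
Proof.
move=> [f1 f2] [g1 g2]; split.
  rewrite (_ : _ \o _ = (cRe \o f) \+ (cRe \o g)); last first.
    by apply/funext => y /=; case: (f y) => ? ?; case: (g y).
  by apply: is_derive_eq; case: z w {f1 f2 g1 g2} => ? ? [].
rewrite (_ : _ \o _ = (cIm \o f) \+ (cIm \o g)); last first.
  by apply/funext => y /=; case: (f y) => ? ?; case: (g y).
by apply: is_derive_eq; case: z w {f1 f2 g1 g2} => ? ? [].
Qed.

Lemma has_partialM f g x i z w : has_partial f x i z -> has_partial g x i w ->
  has_partial (fun y => f y * g y) x i (z * g x + f x * w).
Proof.
move=> [f1 f2] [g1 g2]; split.
  rewrite (_ : _ \o _ = (cRe \o f) * (cRe \o g) - (cIm \o f) * (cIm \o g)); last first.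
    by apply/funext => y /=; rewrite !fctE; case: (f y) => ? ?; case: (g y).
  apply: (is_derive_eq (is_deriveB (is_deriveM f1 g1) (is_deriveM f2 g2))).
  rewrite /= /GRing.scale/=.
  by case: z {f1 f2} w {g1 g2} => a b [a' b'] /=; case: (f x) (g x) => ? ? [? ?] /=; ring.
rewrite (_ : _ \o _ = (cRe \o f) * (cIm \o g) + (cIm \o f) * (cRe \o g)); last first.
  by apply/funext => y /=; rewrite !fctE; case: (f y) => ? ?; case: (g y).
apply: (is_derive_eq (is_deriveD (is_deriveM f1 g2) (is_deriveM f2 g1))).
rewrite /= /GRing.scale/=.
by case: z {f1 f2} w {g1 g2} => a b [a' b'] /=; case: (f x) (g x) => ? ? [? ?] /=; ring.
Qed.

(** Computed on real and imaginary parts from [1 / g = conj g / n], where [n] is the squared modulus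
    of [g] and [n'] its derivative. *)
Lemma has_partialV g x i w : g x != 0 -> has_partial g x i w ->
  has_partial (fun y => (g y)^-1) x i (- w / (g x) ^+ 2).
Proof.
move=> gx0 [g1 g2].
pose n : 'rV[R]_d -> R := (cRe \o g) * (cRe \o g) + (cIm \o g) * (cIm \o g).
have n0 : n x != 0.
  rewrite /n !fctE -!expr2 paddr_eq0 ?sqr_ge0// !sqrf_eq0.
  by move: gx0; rewrite eq_complex.
pose n' := (cRe (g x) * cRe w + cIm (g x) * cIm w) *+ 2.
have dn : is_derive x (basis_vector R i) n n'.
  apply: (is_derive_eq (is_deriveD (is_deriveM g1 g1) (is_deriveM g2 g2))).
  by rewrite /= /n' /GRing.scale/=; ring.
have dV : is_derive x (basis_vector R i) (fun y => (n y)^-1) (- (n x) ^- 2 *: n').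
  have dd := @ex_derive _ _ _ _ _ _ _ dn.
  split; first exact: derivableV.
  by rewrite deriveV// (@derive_val _ _ _ _ _ _ _ dn).
have gE : g x = cRe (g x) +i* cIm (g x) by case: (g x).
have nE : n x = cRe (g x) ^+ 2 + cIm (g x) ^+ 2 by rewrite /n !fctE -!expr2.
(* This is [conj (g x) ^ 2 / (n x) ^ 2] in coordinates. *)
have E : (g x) ^- 2 = ((cRe (g x) ^+ 2 - cIm (g x) ^+ 2) / (n x) ^+ 2) +i*
      (- (cRe (g x) * cIm (g x) *+ 2) / (n x) ^+ 2).
  have g20 : (g x) ^+ 2 != 0 by rewrite sqrf_eq0.
  apply: (mulfI g20); rewrite divff//.
  move: n0; rewrite nE; move: gE {dn dV n'}; case: (g x) => a b /= _ n0.
  by apply/eqP; rewrite eq_complex /=; apply/andP; split; apply/eqP => /=; field.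
split.
  rewrite (_ : _ \o _ = (cRe \o g) * (fun y => (n y)^-1)); last first.
    by apply/funext => y; rewrite /n !fctE /= -!expr2; case: (g y).
  apply: (is_derive_eq (is_deriveM g1 dV)); rewrite E /GRing.scale /=.
  by move: n0; rewrite nE /n'; case: w {g1 g2 dn dV n'} => ? ? /= n0; field.
rewrite (_ : _ \o _ = - (cIm \o g) * (fun y => (n y)^-1)); last first.
  by apply/funext => y; rewrite /n !fctE /= -!expr2 mulNr; case: (g y).
apply: (is_derive_eq (is_deriveM (is_deriveN g2) dV)).
rewrite E /GRing.scale /= opprfctE /=.
by move: n0; rewrite nE /n'; case: w {g1 g2 dn dV n'} => ? ? /= n0; field.
Qed.

Lemma has_partial_coord x i j :
  has_partial (fun y => (y 0 j)%:C) x i (j == i)%:R.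
Proof.
have H : is_derive x (basis_vector R i) (fun y : 'rV[R]_d => y 0 j) (j == i)%:R.
  have dc := @differentiable_coord R 1 d x 0 j.
  split; first exact/diff_derivable.
  rewrite /derive; apply/cvg_lim => //; apply: cvg_near_cst.
  near=> h; rewrite /= !mxE addrK eqxx /= /GRing.scale /= mulrA mulVf ?mul1r//.
  near: h; exact: nbhs_dnbhs_neq.
split.
  rewrite (_ : _ \o _ = (fun y : 'rV[R]_d => y 0 j))//.
  by apply: is_derive_eq; rewrite -(rmorph_nat (real_complex R)).
rewrite (_ : _ \o _ = cst 0)//.
by apply: is_derive_eq; rewrite -(rmorph_nat (real_complex R)).
Unshelve. all: by end_near. Qed.

Definition ccontinuous f x :=
  {for x, continuous (cRe \o f)} /\ {for x, continuous (cIm \o f)}.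

Lemma near_eq_ccontinuous f g x : {near x, f =1 g} -> ccontinuous f x -> ccontinuous g x.
Proof.
move=> fg [c1 c2]; have fgx := nbhs_singleton fg.
split; rewrite /prop_for /continuous_at /= -fgx.
  apply: cvg_trans c1; apply: (@near_eq_cvg _ _ (nbhs x) _ (cRe \o f) (cRe \o g)).
  by apply: filterS fg => y /= ->.
apply: cvg_trans c2; apply: (@near_eq_cvg _ _ (nbhs x) _ (cIm \o f) (cIm \o g)).
by apply: filterS fg => y /= ->.
Qed.

Lemma ccontinuous_cst x z : ccontinuous (fun=> z) x.
Proof. by split; apply: cst_continuous. Qed.

Lemma ccontinuousD f g x : ccontinuous f x -> ccontinuous g x ->
  ccontinuous (fun y => f y + g y) x.
Proof.
move=> [f1 f2] [g1 g2]; split.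
  rewrite (_ : _ \o _ = (cRe \o f) \+ (cRe \o g)); last first.
    by apply/funext => y /=; case: (f y) => ? ?; case: (g y).
  exact: continuousD.
rewrite (_ : _ \o _ = (cIm \o f) \+ (cIm \o g)); last first.
  by apply/funext => y /=; case: (f y) => ? ?; case: (g y).
exact: continuousD.
Qed.

Lemma ccontinuousM f g x : ccontinuous f x -> ccontinuous g x ->
  ccontinuous (fun y => f y * g y) x.
Proof.
move=> [f1 f2] [g1 g2]; split.
  rewrite (_ : _ \o _ = (cRe \o f) \* (cRe \o g) \- (cIm \o f) \* (cIm \o g)); last first.
    by apply/funext => y /=; case: (f y) => ? ?; case: (g y).
  by apply: continuousB; exact: continuousM.
rewrite (_ : _ \o _ = (cRe \o f) \* (cIm \o g) \+ (cIm \o f) \* (cRe \o g)); last first.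
  by apply/funext => y /=; case: (f y) => ? ?; case: (g y).
by apply: continuousD; exact: continuousM.
Qed.

Lemma ccontinuousV g x : g x != 0 -> ccontinuous g x -> ccontinuous (fun y => (g y)^-1) x.
Proof.
move=> gx0 [g1 g2].
pose n : 'rV[R]_d -> R := (cRe \o g) \* (cRe \o g) \+ (cIm \o g) \* (cIm \o g).
have n0 : n x != 0.
  rewrite /n /= -!expr2 paddr_eq0 ?sqr_ge0// !sqrf_eq0.
  by move: gx0; rewrite eq_complex.
have cn : {for x, continuous n} by apply: continuousD; exact: continuousM.
have cV : {for x, continuous (fun y => (n y)^-1)} by exact: continuousV.
split.
  rewrite (_ : _ \o _ = (cRe \o g) \* (fun y => (n y)^-1)); last first.
    by apply/funext => y /=; rewrite /n/=; case: (g y).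
  exact: continuousM.
rewrite (_ : _ \o _ = (fun y => - (((cIm \o g) \* (fun y => (n y)^-1)) y))); last first.
  by apply/funext => y /=; rewrite /n/=; case: (g y).
by apply: continuousN; exact: continuousM.
Qed.

Lemma ccontinuous_real (u : 'rV[R]_d -> R) x : {for x, continuous u} ->
  ccontinuous (fun y => (u y)%:C) x.
Proof. by move=> cu; split => //; apply: cst_continuous. Qed.

Lemma ccontinuous_coord x j : ccontinuous (fun y => (y 0 j)%:C) x.
Proof. exact/ccontinuous_real/coord_continuous. Qed.

End complex_calculus.

(** * The Schwartz class *)

Section rapidly_decreasing.
Variables (R : realType) (d : nat).
Implicit Types (f g h : 'rV[R]_d -> R[i]) (x y : 'rV[R]_d) (i j : 'I_d) (z w : R[i]).
Implicit Types (J s : seq 'I_d).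

Definition pos j f : 'rV[R]_d -> R[i] := fun x => (x 0 j)%:C * f x.

Definition poss J f := foldr pos f J.

Definition regular f := (forall x, ccontinuous f x) /\ (forall x i, cderivable f x i).

Definition rapid f := forall J, exists C : R, forall x, cabs (poss J f x) <= C.

(* The Schwartz class, with lists of indices instead of multi-indices: this form
   is stable by coinduction under [partial i] and [pos j]. *)
Definition rd f := smooth f /\ forall s, rapid (partials s f).

Lemma possE J f x : poss J f x = (\prod_(j <- J) x 0 j)%:C * f x.
Proof.
elim: J => [|j J IH]; first by rewrite big_nil mul1r.
by rewrite big_cons /= /pos IH rmorphM mulrA.
Qed.

Lemma smoothP f : smooth f <-> forall s, regular (partials s f).
Proof.
split=> H s; have := H s.
  by move=> [H1 H2 H3]; split=> // x; split; [exact: H1|exact: H2].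
by move=> [H1 H2]; split=> // x; have [] := H1 x.
Qed.

(** Smoothness is the largest class of regular functions stable under partial derivatives, so it is
    proved by exhibiting a stable class; [rd_coind] does the same for rapid decrease. *)
Lemma smooth_coind (S : ('rV[R]_d -> R[i]) -> Prop) :
  (forall f, S f -> regular f) -> (forall f i, S f -> S (partial i f)) ->
  forall f, S f -> smooth f.
Proof.
move=> S1 S2 f Sf; apply/smoothP => s; apply: S1.
by elim: s => //= i s; exact: S2.
Qed.

Lemma rd_coind (S : ('rV[R]_d -> R[i]) -> Prop) :
  (forall f, S f -> regular f) -> (forall f, S f -> rapid f) ->
  (forall f i, S f -> S (partial i f)) -> forall f, S f -> rd f.
Proof.
move=> S1 S2 S3 f Sf; split; first exact: smooth_coind Sf.
by move=> s; apply: S2; elim: s => //= i s; exact: S3.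
Qed.

Lemma smooth_regular f : smooth f -> regular f.
Proof. by move=> /smoothP/(_ [::]). Qed.

Lemma smooth_partial i f : smooth f -> smooth (partial i f).
Proof.
by move=> /smoothP H; apply/smoothP => s; have := H (rcons s i); rewrite /partials foldr_rcons.
Qed.

Lemma rd_partial i f : rd f -> rd (partial i f).
Proof.
move=> [H1 H2]; split; first exact: smooth_partial.
by move=> s; have := H2 (rcons s i); rewrite /partials foldr_rcons.
Qed.

Lemma rd_smooth f : rd f -> smooth f. Proof. by case. Qed.

Lemma rd_regular f : rd f -> regular f. Proof. by move=> [/smooth_regular]. Qed.

Lemma rd_rapid f : rd f -> rapid f. Proof. by move=> [_ /(_ [::])]. Qed.

Lemma regular_has_partial f x i : regular f -> has_partial f x i (partial i f x).
Proof. by move=> [_ H]; exact/has_partialP. Qed.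

Lemma partialD f g i : regular f -> regular g ->
  partial i (fun x => f x + g x) = fun x => partial i f x + partial i g x.
Proof.
move=> rf rg; apply/funext => x; apply: has_partialE.
by apply: has_partialD; exact: regular_has_partial.
Qed.

Lemma partialZ z f i : regular f ->
  partial i (fun x => z * f x) = fun x => z * partial i f x.
Proof.
move=> rf; apply/funext => x; apply: has_partialE.
apply: (has_partial_eq (has_partialM (has_partial_cst x i z) (regular_has_partial x i rf))).
by rewrite mul0r add0r.
Qed.

Lemma partial_pos f i j : regular f ->
  partial i (pos j f) = fun x => pos j (partial i f) x + (j == i)%:R * f x.
Proof.
move=> rf; apply/funext => x; apply: has_partialE.
apply: (has_partial_eq (has_partialM (has_partial_coord x i j) (regular_has_partial x i rf))).
by rewrite addrC.
Qed.

Lemma regularD f g : regular f -> regular g -> regular (fun x => f x + g x).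
Proof.
move=> [f1 f2] [g1 g2]; split; first by move=> x; exact: ccontinuousD.
by move=> x i; apply/has_partial_derivable/has_partialD; exact/has_partialP.
Qed.

Lemma regularZ z f : regular f -> regular (fun x => z * f x).
Proof.
move=> [f1 f2]; split.
  by move=> x; apply: ccontinuousM => //; exact: ccontinuous_cst.
move=> x i; apply/has_partial_derivable/has_partialM; first exact: has_partial_cst.
exact/has_partialP.
Qed.

Lemma regular_pos j f : regular f -> regular (pos j f).
Proof.
move=> [f1 f2]; split.
  by move=> x; apply: ccontinuousM => //; exact: ccontinuous_coord.
move=> x i; apply/has_partial_derivable/has_partialM; first exact: has_partial_coord.
exact/has_partialP.
Qed.

Lemma rapidD f g : rapid f -> rapid g -> rapid (fun x => f x + g x).
Proof.
move=> rf rg J; have [C HC] := rf J; have [D HD] := rg J.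
exists (C + D) => x; rewrite possE mulrDr -!possE.
by rewrite (le_trans (cabsD _ _))// lerD.
Qed.

Lemma rapidZ z f : rapid f -> rapid (fun x => z * f x).
Proof.
move=> rf J; have [C HC] := rf J; exists (cabs z * C) => x.
rewrite possE mulrCA cabsM -possE ler_wpM2l//.
exact: cabs_ge0.
Qed.

Lemma rapid_pos j f : rapid f -> rapid (pos j f).
Proof.
move=> rf J; have [C HC] := rf (rcons J j); exists C => x.
by have := HC x; rewrite /poss foldr_rcons.
Qed.

Lemma rdD f g : rd f -> rd g -> rd (fun x => f x + g x).
Proof.
move=> rf rg.
apply: (@rd_coind (fun h => exists f1 g1, [/\ rd f1, rd g1 & h = fun x => f1 x + g1 x])).
- by move=> _ [a [b [ra rb ->]]]; apply: regularD; exact: rd_regular.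
- by move=> _ [a [b [ra rb ->]]]; apply: rapidD; exact: rd_rapid.
- move=> _ i [a [b [ra rb ->]]]; exists (partial i a), (partial i b).
  by rewrite partialD; [split => //; exact: rd_partial|exact: rd_regular|exact: rd_regular].
- by exists f, g.
Qed.

Lemma rdZ z f : rd f -> rd (fun x => z * f x).
Proof.
move=> rf.
apply: (@rd_coind (fun h => exists2 f1, rd f1 & h = fun x => z * f1 x)).
- by move=> _ [a ra ->]; apply/regularZ/rd_regular.
- by move=> _ [a ra ->]; apply/rapidZ/rd_rapid.
- move=> _ i [a ra ->]; exists (partial i a); first exact: rd_partial.
  exact/partialZ/rd_regular.
- by exists f.
Qed.

(** Differentiating [pos j f] leaves an extra multiple of [f], so the stable class consists of the
    sums [pos j a + b]. *)
Lemma rd_pos j f : rd f -> rd (pos j f).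
Proof.
move=> rf.
apply: (@rd_coind (fun h => exists f1 g1, [/\ rd f1, rd g1 & h = fun x => pos j f1 x + g1 x])).
- move=> _ [a [b [ra rb ->]]]; apply: regularD; last exact: rd_regular.
  exact/regular_pos/rd_regular.
- move=> _ [a [b [ra rb ->]]]; apply: rapidD; last exact: rd_rapid.
  exact/rapid_pos/rd_rapid.
- move=> _ i [a [b [ra rb ->]]].
  exists (partial i a), (fun x => (j == i)%:R * a x + partial i b x); split.
  + exact: rd_partial.
  + by apply: rdD; [exact: rdZ|exact: rd_partial].
  + rewrite partialD; [|exact/regular_pos/rd_regular|exact: rd_regular].
    rewrite partial_pos; last exact: rd_regular.
    by apply/funext => x; rewrite addrA.
- exists f, (fun x => 0 * f x); split => //; first exact: rdZ.
  by apply/funext => x; rewrite mul0r addr0.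
Qed.

Lemma partialC i j f : smooth f -> partial i (partial j f) = partial j (partial i f).
Proof.
move=> sf.
have r0 := smooth_regular sf.
have ri k := smooth_regular (smooth_partial k sf).
have rij k l := smooth_regular (smooth_partial k (smooth_partial l sf)).
apply/funext => x.
have E1 : cRe (partial i (partial j f) x) = cRe (partial j (partial i f) x).
  apply: (@mixed_partials_eq _ _ (cRe \o f) (cRe \o partial j f) (cRe \o partial i f)
     (cRe \o partial i (partial j f)) (cRe \o partial j (partial i f))).
  - by move=> y; exact: (regular_has_partial y j r0).1.
  - by move=> y; exact: (regular_has_partial y i r0).1.
  - by move=> y; exact: (regular_has_partial y i (ri j)).1.
  - by move=> y; exact: (regular_has_partial y j (ri i)).1.
  - exact: ((rij i j).1 x).1.
  - exact: ((rij j i).1 x).1.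
have E2 : cIm (partial i (partial j f) x) = cIm (partial j (partial i f) x).
  apply: (@mixed_partials_eq _ _ (cIm \o f) (cIm \o partial j f) (cIm \o partial i f)
     (cIm \o partial i (partial j f)) (cIm \o partial j (partial i f))).
  - by move=> y; exact: (regular_has_partial y j r0).2.
  - by move=> y; exact: (regular_has_partial y i r0).2.
  - by move=> y; exact: (regular_has_partial y i (ri j)).2.
  - by move=> y; exact: (regular_has_partial y j (ri i)).2.
  - exact: ((rij i j).1 x).2.
  - exact: ((rij j i).1 x).2.
exact: complex_ext.
Qed.

Lemma smooth_partials s f : smooth f -> smooth (partials s f).
Proof. by move=> sf; elim: s => [|i s IH]; [exact: sf|exact: smooth_partial]. Qed.

Lemma rd_partials s f : rd f -> rd (partials s f).
Proof. by move=> sf; elim: s => [|i s IH]; [exact: sf|exact: rd_partial]. Qed.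

Lemma partials_perm s t f : smooth f -> perm_eq s t -> partials s f = partials t f.
Proof.
move=> sf; elim: s t => [|i s IH] t.
  by move=> /perm_size/esym/size0nil ->.
move=> st; have it : i \in t by rewrite -(perm_mem st) mem_head.
case/splitPr: it st => t1 t2; rewrite perm_sym -cat1s perm_catCA perm_cons perm_sym => st.
rewrite /= (IH _ st) {IH st}; elim: t1 => //= k t1 <-.
by apply: partialC; exact: smooth_partials.
Qed.

Lemma mpartialE (m : multiindex d) f :
  mpartial m f = partials (flatten [seq nseq (mpoly.fun_of_multinom m i) i | i <- enum 'I_d]) f.
Proof.
rewrite /mpartial /partials; elim: (enum _) => //= i l ->.
by rewrite foldr_cat; elim: (mpoly.fun_of_multinom m i) => //= n ->.
Qed.

(** A list of indices is traded for the multi-index of its occurrence counts; the order of the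
    derivatives is immaterial by [partials_perm]. *)
Lemma schwartz_rd f : schwartz f -> rd f.
Proof.
move=> [sf H]; split=> // s J.
pose mi (l : seq 'I_d) : multiindex d := mpoly.Multinom [tuple count_mem i l | i < d].
have miE l i : mpoly.fun_of_multinom (mi l) i = count_mem i l.
  by rewrite /mpoly.fun_of_multinom /= tnth_mktuple.
have [C HC] := H (mi J) (mi s); exists C => x; have := HC x.
rewrite possE; congr (cabs (_%:C * _ x) <= C).
  transitivity (\prod_(i < d) x 0 i ^+ count_mem i J).
    by apply: eq_bigr => i _; rewrite miE.
  elim: J {H HC} => [|j J IH]; first by rewrite big_nil big1.
  rewrite big_cons -IH (bigD1 j)//= [in RHS](bigD1 j)//= mulrA.
  rewrite eqxx add1n exprS; congr (_ * _); apply: eq_bigr => i ij.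
  by rewrite eq_sym (negPf ij).
rewrite mpartialE; apply: partials_perm => //.
apply/allP => i _; apply/eqP.
rewrite count_flatten -map_comp sumnE big_map big_enum.
rewrite (bigD1 i)//= big1; first by rewrite addn0 count_nseq /= eqxx mul1n miE.
by move=> k ki; rewrite count_nseq /= (negPf ki).
Qed.

End rapidly_decreasing.

(** * Constant coefficient operators and their commutators with coordinates *)

Section constant_coefficient_operators.
Variables (R : realType) (d : nat).
Implicit Types (f g h : 'rV[R]_d -> R[i]) (x : 'rV[R]_d) (i j : 'I_d) (z : R[i]).
Implicit Types (E : ('rV[R]_d -> R[i]) -> ('rV[R]_d -> R[i])).

Lemma partial0 i : partial i (fun _ : 'rV[R]_d => 0 : R[i]) = fun=> 0.
Proof. by apply/funext => x; apply: has_partialE; exact: has_partial_cst. Qed.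

Lemma rd0 : rd (fun _ : 'rV[R]_d => 0 : R[i]).
Proof.
apply: (@rd_coind _ _ (fun h => h = fun=> 0)) => //.
- move=> _ ->; split; first by move=> x; exact: ccontinuous_cst.
  by move=> x i; apply/has_partial_derivable/has_partial_cst.
- by move=> _ -> J; exists 0 => x; rewrite possE mulr0 cabs0.
- by move=> _ i ->; exact: partial0.
Qed.

Lemma rd_sum (T : Type) (l : seq T) (c : T -> R[i]) (F : T -> 'rV[R]_d -> R[i]) :
  (forall m, rd (F m)) -> rd (fun x => \sum_(m <- l) c m * F m x).
Proof.
move=> rF; elim: l => [|m l IH].
  by under eq_fun do rewrite big_nil; exact: rd0.
by under eq_fun do rewrite big_cons; apply: rdD => //; exact: rdZ.
Qed.

Lemma rd_mpartial (m : multiindex d) f : rd f -> rd (mpartial m f).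
Proof. by move=> rf; rewrite mpartialE; exact: rd_partials. Qed.

Lemma rd_diffop (P : mpolynomial R[i] d) f : rd f -> rd (diffop P f).
Proof. by move=> rf; apply: rd_sum => m; exact: rd_mpartial. Qed.

Lemma rd_iter_diffop (P : mpolynomial R[i] d) n f : rd f -> rd (iter n (diffop P) f).
Proof. by move=> rf; elim: n => [//|n IH]; exact: rd_diffop. Qed.

(* Such operators commute with every constant coefficient operator and are
   stable under commutators with the coordinates, so [[P(d), x_j]] need not be
   computed. *)
Definition invariant_op E :=
  [/\ forall h, rd h -> rd (E h),
      forall g h, rd g -> rd h -> E (fun x => g x + h x) = (fun x => E g x + E h x),
      forall z h, rd h -> E (fun x => z * h x) = (fun x => z * E h x) &
      forall i h, rd h -> E (partial i h) = partial i (E h)].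

Lemma invariant_op_partial i : invariant_op (partial i).
Proof.
split; first by move=> h; exact: rd_partial.
- by move=> g h rg rh; rewrite partialD//; exact: rd_regular.
- by move=> z h rh; rewrite partialZ//; exact: rd_regular.
- by move=> j h rh; rewrite partialC//; exact: rd_smooth.
Qed.

Lemma invariant_op0 E : invariant_op E -> E (fun=> 0) = fun=> 0.
Proof.
move=> [_ _ EZ _]; have := EZ 0 _ rd0.
under eq_fun do rewrite mul0r.
by move=> ->; apply/funext => x; rewrite mul0r.
Qed.

Lemma invariant_op_sum E (T : Type) (l : seq T) (c : T -> R[i]) (F : T -> 'rV[R]_d -> R[i]) :
  invariant_op E -> (forall m, rd (F m)) ->
  E (fun x => \sum_(m <- l) c m * F m x) = fun x => \sum_(m <- l) c m * E (F m) x.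
Proof.
move=> iE rF; have [E1 E2 E3 E4] := iE; elim: l => [|m l IH].
  under eq_fun do rewrite big_nil.
  by rewrite invariant_op0//; apply/funext => x; rewrite big_nil.
under eq_fun do rewrite big_cons.
rewrite E2; [|exact: rdZ|exact: rd_sum].
by rewrite E3// IH; apply/funext => x; rewrite big_cons.
Qed.

Lemma invariant_op_partials E s f : invariant_op E -> rd f ->
  E (partials s f) = partials s (E f).
Proof.
move=> [E1 E2 E3 E4] rf; elim: s => [//|i s IH].
by rewrite [partials _ _]/= E4 ?IH//; exact: rd_partials.
Qed.

Lemma invariant_op_diffopC E (P : mpolynomial R[i] d) f : invariant_op E -> rd f ->
  E (diffop P f) = diffop P (E f).
Proof.
move=> iE rf; rewrite invariant_op_sum//; last by move=> m; exact: rd_mpartial.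
by apply/funext => x; apply: eq_bigr => m _; rewrite !mpartialE invariant_op_partials.
Qed.

Lemma invariant_op_diffop (P : mpolynomial R[i] d) : invariant_op (diffop P).
Proof.
split.
- by move=> h; exact: rd_diffop.
- move=> g h rg rh; apply/funext => x; rewrite -big_split; apply: eq_bigr => m _.
  rewrite [RHS]/= -mulrDr; congr (_ * _); rewrite !mpartialE.
  elim: (flatten _) x => [//|i s IH] x.
  rewrite [partials _ _]/= (_ : partials s (fun x => g x + h x) = fun x => partials s g x + partials s h x).
    by rewrite partialD//; apply/rd_regular/rd_partials.
  exact/funext.
- move=> z h rh; apply/funext => x; rewrite big_distrr; apply: eq_bigr => m _.
  rewrite [RHS]mulrCA; congr (_ * _); rewrite !mpartialE.
  elim: (flatten _) x => [//|i s IH] x.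
  rewrite [partials _ _]/= (_ : partials s (fun x => z * h x) = fun x => z * partials s h x).
    by rewrite partialZ//; apply/rd_regular/rd_partials.
  exact/funext.
- by move=> i h rh; exact: esym (invariant_op_diffopC P (invariant_op_partial i) rh).
Qed.

(** The commutator [[E, x_j]]. The difference is spelled [+ -1 *] to match the closure rules for
    sums and scalar multiples. *)
Definition pos_comm j E h : 'rV[R]_d -> R[i] := fun x => E (pos j h) x + -1 * pos j (E h) x.

Lemma pos_commE j E h : pos j (E h) = fun x => E (pos j h) x + -1 * pos_comm j E h x.
Proof. by apply/funext => x; rewrite /pos_comm; ring. Qed.

Lemma posD j g h : pos j (fun x => g x + h x) = fun x => pos j g x + pos j h x.
Proof. by apply/funext => x; rewrite /pos mulrDr. Qed.

Lemma posZ j z h : pos j (fun x => z * h x) = fun x => z * pos j h x.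
Proof. by apply/funext => x; rewrite /pos mulrCA. Qed.

(** The point is commutation with [partial i]: exchanging [partial i] and [x_j] produces a scalar
    multiple of [E h] in each of the two terms of the commutator, and these cancel. *)
Lemma invariant_op_pos_comm j E : invariant_op E -> invariant_op (pos_comm j E).
Proof.
move=> [E1 E2 E3 E4]; split.
- move=> h rh; apply: rdD; first exact/E1/rd_pos.
  by apply: rdZ; apply/rd_pos/E1.
- move=> g h rg rh; rewrite /pos_comm posD E2 ?posD; [|exact: rd_pos|exact: rd_pos].
  by rewrite E2// posD; apply/funext => x; ring.
- move=> z h rh; rewrite /pos_comm posZ E3; last exact: rd_pos.
  by rewrite E3// posZ; apply/funext => x; ring.
- move=> i h rh; rewrite /pos_comm.
  rewrite [in RHS]partialD; last 2 first.
  + exact/rd_regular/E1/rd_pos.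
  + exact/rd_regular/rdZ/rd_pos/E1.
  rewrite [in RHS]partialZ; last exact/rd_regular/rd_pos/E1.
  rewrite partial_pos; last exact/rd_regular/E1.
  rewrite -E4; last exact: rd_pos.
  rewrite partial_pos; last exact: rd_regular.
  rewrite E2; [|exact/rd_pos/rd_partial|exact: rdZ].
  by rewrite E3// E4//; apply/funext => x; ring.
Qed.

(** Since [E] commutes with [[E, x_j]], moving [x_j] through [E^n] produces n equal terms. For
    [n = 0] the default value [n.-1 = 0] is killed by the factor n. *)
Lemma pos_iter_op j E n h : invariant_op E -> rd h ->
  (forall g, rd g -> E (pos_comm j E g) = pos_comm j E (E g)) ->
  pos j (iter n E h) =
  fun x => iter n E (pos j h) x + - n%:R * iter n.-1 E (pos_comm j E h) x.
Proof.
move=> iE rh EC; have [E1 E2 E3 _] := iE; have [C1 _ _ _] := invariant_op_pos_comm j iE.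
have rit k g : rd g -> rd (iter k E g) by move=> rg; elim: k => [//|k IH]; exact: E1.
have EC' k g : rd g -> pos_comm j E (iter k E g) = iter k E (pos_comm j E g).
  by move=> rg; elim: k => [//|k IH]; rewrite !iterS -EC ?IH//; exact: rit.
elim: n => [|n IH]; first by apply/funext => x /=; rewrite oppr0 mul0r addr0.
rewrite iterS pos_commE IH E2; [|exact/rit/rd_pos|exact/rdZ/rit/C1].
rewrite E3 ?EC'//; last exact/rit/C1.
apply/funext => x; rewrite iterS -addrA; congr (_ + _).
case: n {IH} => [|n]; first by rewrite oppr0 mul0r add0r.
by rewrite -iterS /= -[n.+2%:R]natr1; ring.
Qed.

(** The commutator is itself an [invariant_op], hence commutes with [diffop P], whatever its
    explicit form. *)
Lemma pos_iter_diffop j (P : mpolynomial R[i] d) n h : rd h ->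
  pos j (iter n (diffop P) h) =
  fun x => iter n (diffop P) (pos j h) x +
    - n%:R * iter n.-1 (diffop P) (pos_comm j (diffop P) h) x.
Proof.
move=> rh; have iD := invariant_op_diffop P.
apply: pos_iter_op => // g rg.
by rewrite -invariant_op_diffopC//; exact: invariant_op_pos_comm.
Qed.

End constant_coefficient_operators.

(** * Borel sets of R^d and uniqueness of its Lebesgue measure *)

Section measurable_rV_theory.
Variables (R : realType) (d : nat).
Local Notation V := 'rV[R]_d.

Lemma measurable_rV_coord (i : 'I_d) : measurable_fun setT (fun x : V => x 0 i : R).
Proof.
move=> _ A mA; rewrite setTI; apply: sub_sigma_algebra.
rewrite (bigD1 i)//=; left; exists A => //; by rewrite setTI.
Qed.

Lemma measurable_rV_box (A : 'I_d -> set R) : (forall i, measurable (A i)) ->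
  measurable [set x : V | forall i, A i (x 0 i)].
Proof.
move=> mA.
rewrite (_ : [set _ | _] = \bigcap_(i in [set: 'I_d]) ((fun x : V => x 0 i : R) @^-1` A i)).
  apply: fin_bigcap_measurable => // i _.
  by rewrite -[X in measurable X]setTI; exact: measurable_rV_coord.
by apply/seteqP; split => x /= H i; [move=> _|]; apply: H.
Qed.

Lemma rV_norm_lt (x : V) (e : R) : 0 < e -> (forall i, `|x 0 i| < e) -> `|x| < e.
Proof.
move=> e0 H; rewrite [`|x|]mx_normrE; apply/bigmax_ltP; split => //= -[i j] _ /=.
by rewrite (ord1 i); exact: H.
Qed.

Lemma rV_coord_norm_le (x : V) i : `|x 0 i| <= `|x|.
Proof. by rewrite [`|x|]mx_normrE; apply: le_bigmax (0, i). Qed.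

(** An open set is the union of the boxes with rational centre and radius [1 / (k + 1)] that it
    contains, and there are countably many of them. *)
Lemma open_rV_measurable (A : set V) : open A -> measurable A.
Proof.
move=> oA.
pose box (c : 'rV[rat]_d) (k : nat) := [set x : V | forall i, ball (ratr (c 0 i) : R) k.+1%:R^-1 (x 0 i)].
(* Boxes that stick out of [A] are replaced by the empty set, so that the union runs over a whole
   countable type. *)
pose F (ck : 'rV[rat]_d * nat) : set V := if `[< box ck.1 ck.2 `<=` A >] then box ck.1 ck.2 else set0.
have -> : A = \bigcup_ck F ck.
  apply/seteqP; split => [x Ax|x [[c k] _]]; last by rewrite /F; case: asboolP => // H /H.
  have /(@nbhs_ballP _ V)[e/= e0 He] : nbhs x A by exact: open_nbhs_nbhs.
  have [k ke] : exists k, k.+1%:R^-1 < e / 2.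
    have [k _ Hk] := @near_infty_natSinv_lt R (PosNum (divr_gt0 e0 (ltr0n R 2))).
    by exists k; exact: (Hk k (leqnn k)).
  have k0 : 0 < k.+1%:R^-1 :> R by rewrite invr_gt0.
  have cx i : {q : rat | ball (x 0 i) k.+1%:R^-1 (ratr q)}.
    have lt : x 0 i - k.+1%:R^-1 < x 0 i + k.+1%:R^-1.
      by rewrite ltrBlDr -addrA ltrDl addr_gt0.
    have /cid[q /= qq] := rat_in_itvoo lt.
    by exists q; rewrite -ball_normE /= distrC ltr_distl; move: qq; rewrite in_itv.
  pose c : 'rV[rat]_d := \row_i sval (cx i).
  have bc : box c k x.
    by move=> i; rewrite /c mxE; apply: ball_sym; exact: svalP (cx i).
  exists (c, k) => //; rewrite /F /=; case: asboolP => // /(_ _)[]//.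
  move=> y yb; apply: He; rewrite -ball_normE /=.
  apply: rV_norm_lt => // i; rewrite !mxE.
  rewrite -[x 0 i - y 0 i](subrKA (ratr (c 0 i))).
  rewrite (le_lt_trans (ler_normD _ _))// [ltRHS]splitr ltrD//.
    by have := bc i; rewrite -ball_normE/= distrC => /lt_trans; apply.
  by have := yb i; rewrite -ball_normE/= => /lt_trans; apply.
apply: countable_bigcupT_measurable => //.
move=> [c k]; rewrite /F; case: asboolP => // _.
apply: (measurable_rV_box (A := fun i => ball (ratr (c 0 i) : R) k.+1%:R^-1)) => i.
exact: measurable_ball.
Qed.

Lemma continuous_rV_measurable (u : V -> R) : continuous u -> measurable_fun setT u.
Proof.
move=> /continuousP cu; apply: (measurability _ (RGenOpens.measurableE R)).
move=> _ [_ [a [b ->] <-]]; rewrite setTI; apply: open_rV_measurable.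
exact/cu/interval_open.
Qed.

Definition rV_boxes : set (set V) :=
  [set B | exists2 A : 'I_d -> set R, forall i, measurable (A i) &
    B = [set x : V | forall i, A i (x 0 i)]].

Lemma measurable_rV_boxes : @measurable _ V = <<s rV_boxes >>.
Proof.
apply/seteqP; split.
  apply: smallest_sub; first exact: smallest_sigma_algebra.
  elim/big_ind: _ => [//|A B HA HB x [/HA|/HB]//|i _ _ [A mA <-]].
  apply: sub_sigma_algebra; exists (fun j => if j == i then A else setT).
    by move=> j; case: ifP.
  apply/seteqP; split => [x [_ Ax] j /=|x /(_ i)/=]; last by rewrite eqxx; split.
  by case: eqP => [->|].
apply: smallest_sub; first exact: sigma_algebra_measurable.
by move=> _ [A mA ->]; exact: measurable_rV_box.
Qed.

Lemma rV_boxes_setI : setI_closed rV_boxes.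
Proof.
move=> _ _ [A mA ->] [B mB ->]; exists (fun i => A i `&` B i).
  by move=> i; exact: measurableI.
by apply/seteqP; split => [x [/= H K] i|x /= H]; [split|split=> i; have [] := H i].
Qed.

Definition rV_cube (k : nat) : set V := [set x | forall i, `[- k%:R, k%:R]%classic (x 0 i)].

Lemma measurable_itvcc (k : nat) : measurable (`[- k%:R, k%:R]%classic : set R).
Proof. exact: measurable_itv. Qed.

Lemma rV_boxes_cube k : rV_boxes (rV_cube k).
Proof. by exists (fun=> `[- k%:R, k%:R]%classic) => // _; exact: measurable_itvcc. Qed.

Lemma measurable_rV_cube k : measurable (rV_cube k).
Proof.
by apply: (measurable_rV_box (A := fun=> `[- k%:R, k%:R]%classic)) => _; exact: measurable_itvcc.
Qed.

Lemma bigcup_rV_cube : \bigcup_k rV_cube k = setT.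
Proof.
apply/seteqP; split => // x _.
exists (Num.bound `|x|) => // i /=; rewrite in_itv/= -ler_norml.
by rewrite (le_trans (rV_coord_norm_le x i))// ltW// archi_boundP.
Qed.

Lemma lebesgue_rV_cube k : (lebesgue_rV R d (rV_cube k) < +oo)%E.
Proof.
have mk := measurable_itvcc k.
rewrite (@lebesgue_rV_box R d (fun=> `[- k%:R, k%:R]%classic) (fun=> mk)).
rewrite lebesgue_measure_itv /=.
rewrite lte_fin (_ : (if _ then _ else _) = (if (- k%:R < k%:R :> R) then k%:R - - k%:R else 0)%:E).
  by rewrite prodEFin ltry.
by case: ifP.
Qed.

(** Boxes are stable under intersection and generate the sigma-algebra, and the cubes exhaust the
    space with finite measure. *)
Lemma lebesgue_rV_unique (mu : {measure set V -> \bar R}) :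
  (forall A : 'I_d -> set R, (forall i, measurable (A i)) ->
    mu [set x : V | forall i, A i (x 0 i)] = (\prod_(i < d) lebesgue_measure (A i))%E) ->
  forall A, measurable A -> lebesgue_rV R d A = mu A.
Proof.
move=> H; apply: (@measure_unique _ _ _ rV_boxes rV_cube).
- exact: measurable_rV_boxes.
- exact: rV_boxes_setI.
- exact: rV_boxes_cube.
- exact: bigcup_rV_cube.
- by move=> _ [A mA ->]; rewrite lebesgue_rV_box// H.
- exact: lebesgue_rV_cube.
Qed.

Lemma sigma_finite_lebesgue_rV : sigma_finite setT (lebesgue_rV R d).
Proof.
exists rV_cube; first by rewrite bigcup_rV_cube.
move=> k; split; last exact: lebesgue_rV_cube.
exact: measurable_rV_cube.
Qed.

End measurable_rV_theory.

(** * Translation invariance of Lebesgue measure *)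

Lemma lebesgue_measure_shift (R : realType) (a : R) (A : set R) : measurable A ->
  lebesgue_measure ((fun x : measurableTypeR R => x + a) @^-1` A) = lebesgue_measure A.
Proof.
move=> mA.
have ms : measurable_fun setT (fun x : measurableTypeR R => x + a : measurableTypeR R).
  by apply: measurable_funD => //; exact: measurable_cst.
symmetry; apply: (lebesgue_measure_unique (mu := push_measure ms lebesgue_measure)) => //.
move=> _ [[b c] _ <-]; rewrite /= /pushforward.
rewrite (_ : _ @^-1` _ = [set` `]b - a, c - a]]); last first.
  by apply/seteqP; split => x /=; rewrite !in_itv/= ltrBlDr lerBrDr.
rewrite !lebesgue_measure_itv/= !lte_fin ltrD2r; case: ifP => // _.
by rewrite -!EFinB; congr (_%:E); ring.
Qed.

Section translation.
Variables (R : realType) (d : nat).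
Local Notation V := 'rV[R]_d.

Lemma measurable_rV_shift (a : V) : measurable_fun setT (fun x : V => x + a).
Proof.
move=> _ A mA; rewrite setTI.
suff H : <<s @rV_boxes R d >> `<=` [set A | measurable ((fun x : V => x + a) @^-1` A)].
  by apply: H; rewrite -measurable_rV_boxes.
apply: smallest_sub.
  split; first by rewrite /= preimage_set0; exact: measurable0.
  - by move=> B /= mB; rewrite setTD preimage_setC; exact: measurableC.
  - by move=> F mF /=; rewrite preimage_bigcup; exact: bigcupT_measurable.
move=> _ [B mB ->] /=.
suff : measurable [set x : V | forall i, ((fun y => y + a 0 i) @^-1` B i) (x 0 i)].
  by congr measurable; apply/seteqP; split => x /= H i; move: (H i); rewrite !mxE.
apply: (measurable_rV_box (A := fun i => (fun y => y + a 0 i) @^-1` B i)) => i.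
rewrite -[X in measurable X]setTI; by apply: (measurable_funD _ _ _) => //; exact: measurable_cst.
Qed.

(** The translated measure gives each box the same product of one-dimensional measures, so
    [lebesgue_rV_unique] applies. *)
Lemma lebesgue_rV_shift (a : V) A : measurable A ->
  lebesgue_rV R d ((fun x => x + a) @^-1` A) = lebesgue_rV R d A.
Proof.
move=> mA; symmetry.
apply: (lebesgue_rV_unique (mu := push_measure (measurable_rV_shift a) (lebesgue_rV R d))) => //.
move=> B mB.
rewrite -[LHS]/(lebesgue_rV R d ((fun x => x + a) @^-1` _)).
transitivity (lebesgue_rV R d
    [set x | forall i, ((fun y : measurableTypeR R => y + a 0 i) @^-1` B i) (x 0 i)]).
  by congr (lebesgue_rV R d _); apply/seteqP; split => x /= H i; move: (H i); rewrite !mxE.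
have := @lebesgue_rV_box R d (fun i => (fun y : measurableTypeR R => y + a 0 i) @^-1` B i).
move=> ->; first by apply: eq_bigr => i _; rewrite lebesgue_measure_shift.
move=> i; rewrite -[X in measurable X]setTI.
by apply: (measurable_funD _ _ _) => //; exact: measurable_cst.
Qed.

End translation.

(** * Integration of complex-valued functions *)

Section complex_integral.
Context d (T : measurableType d) (R : realType) (mu : {measure set T -> \bar R}).
Implicit Types (f g : T -> R[i]) (w : T -> R) (z : R[i]).

Definition cint f : R[i] := (\int[mu]_x cRe (f x)) +i* (\int[mu]_x cIm (f x)).

Definition cmeasurable f :=
  measurable_fun setT (fun x => cRe (f x)) /\ measurable_fun setT (fun x => cIm (f x)).

Definition cintegrable f :=
  mu.-integrable setT (fun x => (cRe (f x))%:E) /\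
  mu.-integrable setT (fun x => (cIm (f x))%:E).

Lemma cintegrable_measurable f : cintegrable f -> cmeasurable f.
Proof. by move=> [/measurable_int/measurable_EFinP f1 /measurable_int/measurable_EFinP f2]. Qed.

Lemma eq_cint f g : f =1 g -> cint f = cint g.
Proof. by move=> /funext ->. Qed.

Lemma cmeasurableM f g : cmeasurable f -> cmeasurable g -> cmeasurable (fun x => f x * g x).
Proof.
move=> [f1 f2] [g1 g2]; split.
  rewrite (_ : (fun x => _) = (fun x => cRe (f x) * cRe (g x) - cIm (f x) * cIm (g x))).
    by apply: measurable_funB; exact: measurable_funM.
  by apply/funext => x; case: (f x) (g x) => ? ? [].
rewrite (_ : (fun x => _) = (fun x => cRe (f x) * cIm (g x) + cIm (f x) * cRe (g x))).
  by apply: measurable_funD; exact: measurable_funM.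
by apply/funext => x; case: (f x) (g x) => ? ? [].
Qed.

Lemma cmeasurableD f g : cmeasurable f -> cmeasurable g -> cmeasurable (fun x => f x + g x).
Proof.
move=> [f1 f2] [g1 g2]; split.
  rewrite (_ : (fun x => _) = (fun x => cRe (f x) + cRe (g x))).
    exact: measurable_funD.
  by apply/funext => x; case: (f x) (g x) => ? ? [].
rewrite (_ : (fun x => _) = (fun x => cIm (f x) + cIm (g x))).
  exact: measurable_funD.
by apply/funext => x; case: (f x) (g x) => ? ? [].
Qed.

Lemma cmeasurable_cst z : cmeasurable (fun=> z).
Proof. by split; exact: measurable_cst. Qed.

Lemma cmeasurable_real w : measurable_fun setT w -> cmeasurable (fun x => (w x)%:C).
Proof. by split => //; exact: measurable_cst. Qed.

Lemma cmeasurable_cabs f : cmeasurable f -> measurable_fun setT (fun x => cabs (f x)).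
Proof.
move=> [f1 f2].
rewrite (_ : (fun x => _) = fun x => Num.sqrt (cRe (f x) ^+ 2 + cIm (f x) ^+ 2)).
  apply: (measurableT_comp (continuous_measurable_fun (@sqrt_continuous R))).
  by apply: measurable_funD; exact: measurable_funX.
by apply/funext => x; case: (f x).
Qed.

Lemma cintegrable_le f w : cmeasurable f -> mu.-integrable setT (EFin \o w) ->
  (forall x, cabs (f x) <= w x) -> cintegrable f.
Proof.
move=> [f1 f2] iw fw; split; apply: (le_integrable measurableT _ _ iw) => //=.
- exact/measurable_EFinP.
- by move=> x _; rewrite lee_fin (le_trans (cabs_Re _))// (le_trans (fw x))// ler_norm.
- exact/measurable_EFinP.
- by move=> x _; rewrite lee_fin (le_trans (cabs_Im _))// (le_trans (fw x))// ler_norm.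
Qed.

Lemma cintegrable_cabs f : cintegrable f -> mu.-integrable setT (fun x => (cabs (f x))%:E).
Proof.
move=> cf; have [f1 f2] := cf.
have h := integrableD measurableT (integrable_abse f1) (integrable_abse f2).
apply: (le_integrable measurableT _ _ h) => /=.
  exact/measurable_EFinP/cmeasurable_cabs/cintegrable_measurable.
move=> x _; rewrite lee_fin [leLHS]ger0_norm ?cabs_ge0// [leRHS]ger0_norm ?addr_ge0//.
exact: cabs_ReIm.
Qed.

(** The factor 2 comes from bounding the real and the imaginary part separately. *)
Lemma cabs_cint_le f w : cintegrable f -> mu.-integrable setT (EFin \o w) ->
  (forall x, cabs (f x) <= w x) -> cabs (cint f) <= 2 * \int[mu]_x w x.
Proof.
move=> [f1 f2] iw fw; rewrite (le_trans (cabs_ReIm _))// mulr_natl mulr2n lerD//=.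
  apply: le_trans (le_normr_Rintegral _ f1) _ => //.
  apply: le_Rintegral => //; first exact: integrable_abse f1.
  by move=> x _; rewrite (le_trans (cabs_Re _)).
apply: le_trans (le_normr_Rintegral _ f2) _ => //.
apply: le_Rintegral => //; first exact: integrable_abse f2.
by move=> x _; rewrite (le_trans (cabs_Im _)).
Qed.

Lemma cintegrableD f g : cintegrable f -> cintegrable g -> cintegrable (fun x => f x + g x).
Proof.
move=> [f1 f2] [g1 g2]; split.
  rewrite (_ : (fun x => _) = (fun x => (cRe (f x))%:E) \+ (fun x => (cRe (g x))%:E))%E.
    exact: integrableD.
  by apply/funext => x /=; case: (f x) (g x) => ? ? [].
rewrite (_ : (fun x => _) = (fun x => (cIm (f x))%:E) \+ (fun x => (cIm (g x))%:E))%E.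
  exact: integrableD.
by apply/funext => x /=; case: (f x) (g x) => ? ? [].
Qed.

Lemma cintD f g : cintegrable f -> cintegrable g ->
  cint (fun x => f x + g x) = cint f + cint g.
Proof.
move=> [f1 f2] [g1 g2]; apply: complex_ext => /=.
  rewrite -RintegralD//; apply: eq_Rintegral => x _.
  by case: (f x) (g x) => ? ? [].
rewrite -RintegralD//; apply: eq_Rintegral => x _.
by case: (f x) (g x) => ? ? [].
Qed.

Lemma cintegrableZ z f : cintegrable f -> cintegrable (fun x => z * f x).
Proof.
move=> [f1 f2]; case: z => a b; split.
  rewrite (_ : (fun x => _) = (fun x => a%:E * (cRe (f x))%:E) \- (fun x => b%:E * (cIm (f x))%:E))%E.
    by apply: integrableB => //; exact: integrableZl.
  by apply/funext => x /=; case: (f x).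
rewrite (_ : (fun x => _) = (fun x => a%:E * (cIm (f x))%:E) \+ (fun x => b%:E * (cRe (f x))%:E))%E.
  by apply: integrableD => //; exact: integrableZl.
by apply/funext => x /=; case: (f x).
Qed.

Lemma cintZ z f : cintegrable f -> cint (fun x => z * f x) = z * cint f.
Proof.
move=> [f1 f2]; case: z => a b; apply: complex_ext => /=.
  rewrite -!RintegralZl// -RintegralB//; last 2 first.
  - exact: (integrableZl measurableT a f1).
  - exact: (integrableZl measurableT b f2).
  by apply: eq_Rintegral => x _; case: (f x).
rewrite -!RintegralZl// -RintegralD//; last 2 first.
- exact: (integrableZl measurableT a f2).
- exact: (integrableZl measurableT b f1).
by apply: eq_Rintegral => x _; case: (f x).
Qed.

Lemma cint_real w : cint (fun x => (w x)%:C) = (\int[mu]_x w x)%:C.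
Proof.
by apply: complex_ext => //=; rewrite /Rintegral integral0_eq.
Qed.

End complex_integral.

Section complex_pushforward.
Context d1 d2 (T1 : measurableType d1) (T2 : measurableType d2) (R : realType).
Variables (mu : {measure set T1 -> \bar R}) (g : T1 -> T2) (mg : measurable_fun setT g).
Implicit Type f : T2 -> R[i].

Lemma Rintegral_push_measure (u : T2 -> R) : measurable_fun setT u ->
  mu.-integrable setT (EFin \o (u \o g)) ->
  \int[push_measure mg mu]_x u x = \int[mu]_x u (g x).
Proof.
move=> mu' iu; rewrite /Rintegral; congr fine.
have := @integral_pushforward _ _ _ _ _ g mg mu setT (EFin \o u).
move=> -> //; exact/measurable_EFinP.
Qed.

Lemma cintegrable_push_measure f : cmeasurable f ->
  cintegrable mu (f \o g) -> cintegrable (push_measure mg mu) f.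
Proof.
move=> [m1 m2] [f1 f2]; split; apply: (@integrable_pushforward _ _ _ _ _ g mg mu setT) => //;
  exact/measurable_EFinP.
Qed.

Lemma cint_push_measure f : cmeasurable f -> cintegrable mu (f \o g) ->
  cint (push_measure mg mu) f = cint mu (f \o g).
Proof. by move=> [m1 m2] [f1 f2]; apply: complex_ext => /=; apply: Rintegral_push_measure. Qed.

End complex_pushforward.

(** * Product measures and Fubini's theorem *)

Section complex_fubini.
Context d1 d2 (T1 : measurableType d1) (T2 : measurableType d2) (R : realType).
Variables (m1 : {sigma_finite_measure set T1 -> \bar R}).
Variables (m2 : {sigma_finite_measure set T2 -> \bar R}).

Lemma integrable_prodM (u : T1 -> R) (v : T2 -> R) :
  m1.-integrable setT (EFin \o u) -> m2.-integrable setT (EFin \o v) ->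
  (m1 \x m2)%E.-integrable setT (fun z => (u z.1 * v z.2)%:E).
Proof.
move=> iu iv.
have mu : measurable_fun setT u by move/measurable_int/measurable_EFinP : iu.
have mv : measurable_fun setT v by move/measurable_int/measurable_EFinP : iv.
apply/integrable12ltyP.
  apply/measurable_EFinP; apply: measurable_funM.
    by apply: measurableT_comp => //; exact: measurable_fst.
  by apply: measurableT_comp => //; exact: measurable_snd.
rewrite /=.
have [_ fu] := integrableP _ _ _ iu; have [_ fv] := integrableP _ _ _ iv.
under eq_integral => x _.
  under eq_integral do rewrite normrM EFinM.
  rewrite ge0_integralZl//; last first.
    by apply/measurable_EFinP; exact: measurableT_comp.
  over.
rewrite /= ge0_integralZr//; last 2 first.
- by apply/measurable_EFinP; exact: measurableT_comp.
- exact: integral_ge0.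
rewrite lte_mul_pinfty//; first exact: integral_ge0.
by rewrite ge0_fin_numE// ?integral_ge0.
Qed.

Lemma Rintegral_prodM (u : T1 -> R) (v : T2 -> R) :
  m1.-integrable setT (EFin \o u) -> m2.-integrable setT (EFin \o v) ->
  \int[(m1 \x m2)%E]_z (u z.1 * v z.2) = (\int[m1]_x u x) * (\int[m2]_y v y).
Proof.
move=> iu iv; rewrite /Rintegral -integral12_prod_meas1; last exact: integrable_prodM.
rewrite /fubini_F /=.
under eq_integral => x _.
  under eq_integral do rewrite EFinM.
  rewrite integralZl//.
  rewrite -[X in (_ * X)%E]fineK; last exact: integrable_fin_num.
  over.
by rewrite /= integralZr// fineM ?integrable_fin_num.
Qed.

Lemma cintegrable_prodM (f : T1 -> R[i]) (g : T2 -> R[i]) :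
  cintegrable m1 f -> cintegrable m2 g ->
  cintegrable (m1 \x m2)%E (fun z => f z.1 * g z.2).
Proof.
move=> [f1 f2] [g1 g2]; split.
  rewrite (_ : (fun z => _) = (fun z => (cRe (f z.1) * cRe (g z.2))%:E) \-
     (fun z => (cIm (f z.1) * cIm (g z.2))%:E))%E.
    apply: integrableB => //.
      exact: (integrable_prodM (u := fun x => cRe (f x)) (v := fun x => cRe (g x))).
    exact: (integrable_prodM (u := fun x => cIm (f x)) (v := fun x => cIm (g x))).
  by apply/funext => z /=; case: (f z.1) (g z.2) => ? ? [].
rewrite (_ : (fun z => _) = (fun z => (cRe (f z.1) * cIm (g z.2))%:E) \+
   (fun z => (cIm (f z.1) * cRe (g z.2))%:E))%E.
  apply: integrableD => //.
    exact: (integrable_prodM (u := fun x => cRe (f x)) (v := fun x => cIm (g x))).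
  exact: (integrable_prodM (u := fun x => cIm (f x)) (v := fun x => cRe (g x))).
by apply/funext => z /=; case: (f z.1) (g z.2) => ? ? [].
Qed.

Lemma cint_prodM (f : T1 -> R[i]) (g : T2 -> R[i]) :
  cintegrable m1 f -> cintegrable m2 g ->
  cint (m1 \x m2)%E (fun z => f z.1 * g z.2) = cint m1 f * cint m2 g.
Proof.
move=> [f1 f2] [g1 g2]; apply: complex_ext => /=.
  rewrite -(Rintegral_prodM f1 g1) -(Rintegral_prodM f2 g2).
  rewrite -RintegralB//; last 2 first.
  - exact: (integrable_prodM (u := fun x => cRe (f x)) (v := fun x => cRe (g x))).
  - exact: (integrable_prodM (u := fun x => cIm (f x)) (v := fun x => cIm (g x))).
  by apply: eq_Rintegral => z _; case: (f z.1) (g z.2) => ? ? [].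
rewrite -(Rintegral_prodM f1 g2) -(Rintegral_prodM f2 g1).
rewrite -RintegralD//; last 2 first.
- exact: (integrable_prodM (u := fun x => cRe (f x)) (v := fun x => cIm (g x))).
- exact: (integrable_prodM (u := fun x => cIm (f x)) (v := fun x => cRe (g x))).
by apply: eq_Rintegral => z _; case: (f z.1) (g z.2) => ? ? [].
Qed.

(** Every slice is assumed integrable, rather than almost every one, because [Rintegral] applies
    [fine] to each inner integral and its finiteness is used pointwise. *)
Lemma Rintegral_fubini (u : T1 * T2 -> R) :
  (m1 \x m2)%E.-integrable setT (EFin \o u) ->
  (forall x, m2.-integrable setT (fun y => (u (x, y))%:E)) ->
  (forall y, m1.-integrable setT (fun x => (u (x, y))%:E)) ->
  \int[m1]_x \int[m2]_y u (x, y) = \int[m2]_y \int[m1]_x u (x, y).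
Proof.
move=> iu i1 i2; rewrite /Rintegral; congr fine.
under eq_integral do rewrite fineK ?integrable_fin_num//.
under [RHS]eq_integral do rewrite fineK ?integrable_fin_num//.
exact: (Fubini iu).
Qed.

Lemma cint_fubini (F : T1 * T2 -> R[i]) :
  cintegrable (m1 \x m2)%E F ->
  (forall x, cintegrable m2 (fun y => F (x, y))) ->
  (forall y, cintegrable m1 (fun x => F (x, y))) ->
  cint m1 (fun x => cint m2 (fun y => F (x, y))) =
  cint m2 (fun y => cint m1 (fun x => F (x, y))).
Proof.
move=> [F1 F2] i1 i2; apply: complex_ext => /=.
  apply: (Rintegral_fubini (u := fun z => cRe (F z))) => // x; [exact: (i1 x).1|exact: (i2 x).1].
apply: (Rintegral_fubini (u := fun z => cIm (F z))) => // x; [exact: (i1 x).2|exact: (i2 x).2].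
Qed.

End complex_fubini.

(** * Integrals of products of one-variable functions *)

Section as_sigma_finite.
Context (R : realType) dT (T : measurableType dT) (mu : {measure set T -> \bar R}).
Hypothesis H : sigma_finite setT mu.

(* An alias that carries the sigma-finite structure needed by Fubini's theorem:
   [lebesgue_rV] is declared as a bare measure. *)
Definition as_sigma_finite of sigma_finite setT mu : set T -> \bar R := mu.

HB.instance Definition _ := Measure.copy (as_sigma_finite H) (Measure.sort mu).
HB.instance Definition _ := Measure_isSigmaFinite.Build _ _ _ (as_sigma_finite H) H.

End as_sigma_finite.

Section product_integrals.
Variables (R : realType).
Local Notation M := (measurableTypeR R).
Local Notation mu := (@lebesgue_measure R).

Lemma sigma_finite_lebesgue_tuple d : sigma_finite setT (lebesgue_tuple R d).
Proof.
pose B (k : nat) : set (d.-tuple M) := [set t | forall i, (`[- k%:R, k%:R]%classic : set M) (tnth t i)].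
exists B.
  apply/esym/seteqP; split => // t _.
  have [x E] : exists x : 'rV[R]_d, rV_of_tuple t = x by eexists.
  have : (\bigcup_k @rV_cube R d k) (rV_of_tuple t) by rewrite bigcup_rV_cube.
  by move=> [k _ H]; exists k => // i; have := H i; rewrite mxE.
move=> k; have EB : B k = @rV_of_tuple R d @^-1` rV_cube k.
  by apply/seteqP; split => t /= H i; have := H i; rewrite mxE.
split; last by rewrite EB; exact: lebesgue_rV_cube.
rewrite EB -[X in measurable X]setTI; apply: measurable_rV_of_tuple => //.
exact: measurable_rV_cube.
Qed.

Definition sf_lebesgue_tuple d : {sigma_finite_measure set (d.-tuple M) -> \bar R} :=
  [the {sigma_finite_measure set _ -> \bar R} of as_sigma_finite (@sigma_finite_lebesgue_tuple d)].

Lemma cmeasurable_prod (T : Type) d0 (X : measurableType d0) (s : seq T) (F : T -> X -> R[i]) :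
  (forall i, cmeasurable (F i)) -> cmeasurable (fun x => \prod_(i <- s) F i x).
Proof.
move=> mF; elim: s => [|i s IH].
  by under eq_fun do rewrite big_nil; exact: cmeasurable_cst.
by under eq_fun do rewrite big_cons; exact: cmeasurableM.
Qed.

(** Induction along the construction of [lebesgue_tuple]: the push-forward splits off the head
    coordinate and Fubini's theorem factors the integral. In dimension 0 the measure is a unit mass,
    in accordance with the empty product. *)
Lemma cint_tuple_prod d (h : 'I_d -> M -> R[i]) : (forall i, cintegrable mu (h i)) ->
  cintegrable (lebesgue_tuple R d) (fun t => \prod_(i < d) h i (tnth t i)) /\
  cint (lebesgue_tuple R d) (fun t => \prod_(i < d) h i (tnth t i)) =
    \prod_(i < d) cint mu (h i).
Proof.
elim: d h => [|d IH] h ih.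
  rewrite (_ : (fun t => _) = fun=> 1); last by apply/funext => t; rewrite big_ord0.
  rewrite big_ord0.
  have fin (r : R) : (lebesgue_tuple R 0).-integrable setT (fun=> r%:E).
    by apply: finite_measure_integrable_cst.
  split; first by split; exact: fin.
  have d1 : lebesgue_tuple R 0 setT = 1%E by rewrite /= diracE in_setT.
  apply: complex_ext.
    transitivity (1 * fine (lebesgue_tuple R 0 setT)); first exact: Rintegral_cst.
    by rewrite d1 mulr1.
  transitivity (0 * fine (lebesgue_tuple R 0 setT)); first exact: Rintegral_cst.
  by rewrite mul0r.
have [iH cH] := IH (fun i => h (lift ord0 i)) (fun i => ih _).
have mh d' (i : 'I_d') (g : M -> R[i]) : cmeasurable g -> cmeasurable (fun t : d'.-tuple M => g (tnth t i)).
  move=> [g1 g2]; split.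
    exact: (measurableT_comp g1 (measurable_tnth i)).
  exact: (measurableT_comp g2 (measurable_tnth i)).
have mP : cmeasurable (fun t : d.+1.-tuple M => \prod_(i < d.+1) h i (tnth t i)).
  by apply: cmeasurable_prod => i; apply/mh/cintegrable_measurable.
pose H t := \prod_(i < d) h (lift ord0 i) (tnth t i).
have E : (fun t : d.+1.-tuple M => \prod_(i < d.+1) h i (tnth t i)) \o @tuple_cons R d =
    (fun z => H z.1 * h ord0 z.2).
  apply/funext => -[t x] /=; rewrite big_ord_recl mulrC tnth0; congr (_ * _).
  by apply: eq_bigr => i _; rewrite tnthS.
have iE : cintegrable (lebesgue_tuple R d \x mu)%E ((fun t : d.+1.-tuple M => \prod_(i < d.+1) h i (tnth t i)) \o @tuple_cons R d).
  by rewrite E; exact: (@cintegrable_prodM _ _ _ _ _ (sf_lebesgue_tuple d) mu).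
split.
  exact: (cintegrable_push_measure (measurable_tuple_cons (d:=d)) mP iE).
rewrite (cint_push_measure (measurable_tuple_cons (d:=d)) mP iE) E.
apply: (etrans (@cint_prodM _ _ _ _ _ (sf_lebesgue_tuple d) mu H (h ord0) iH (ih ord0))).
by rewrite [in RHS]big_ord_recl mulrC -cH.
Qed.

Definition sf_lebesgue_rV d : {sigma_finite_measure set 'rV[R]_d -> \bar R} :=
  [the {sigma_finite_measure set _ -> \bar R} of as_sigma_finite (@sigma_finite_lebesgue_rV R d)].

Lemma cint_rV_prod d (h : 'I_d -> M -> R[i]) : (forall i, cintegrable mu (h i)) ->
  cintegrable (lebesgue_rV R d) (fun x => \prod_(i < d) h i (x 0 i)) /\
  cintegral (fun x => \prod_(i < d) h i (x 0 i)) = \prod_(i < d) cint mu (h i).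
Proof.
move=> ih; have [iT <-] := cint_tuple_prod ih.
have mP : cmeasurable (fun x : 'rV[R]_d => \prod_(i < d) h i (x 0 i)).
  apply: cmeasurable_prod => i; have [g1 g2] := cintegrable_measurable (ih i); split.
    exact: (measurableT_comp g1 (measurable_rV_coord i)).
  exact: (measurableT_comp g2 (measurable_rV_coord i)).
have E : (fun x : 'rV[R]_d => \prod_(i < d) h i (x 0 i)) \o @rV_of_tuple R d =
    fun t => \prod_(i < d) h i (tnth t i).
  by apply/funext => t; apply: eq_bigr => i _; rewrite mxE.
have iE := iT; rewrite -E in iE.
split; first exact: (cintegrable_push_measure (measurable_rV_of_tuple (d:=d)) mP iE).
by have := cint_push_measure (measurable_rV_of_tuple (d:=d)) mP iE; rewrite E.
Qed.

Lemma Rintegral_rV_prod d (h : 'I_d -> M -> R) :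
  (forall i, mu.-integrable setT (EFin \o h i)) ->
  (lebesgue_rV R d).-integrable setT (fun x => (\prod_(i < d) h i (x 0 i))%:E) /\
  \int[lebesgue_rV R d]_x (\prod_(i < d) h i (x 0 i)) = \prod_(i < d) \int[mu]_t h i t.
Proof.
move=> ih; have [|[i1 _]] := @cint_rV_prod d (fun i t => (h i t)%:C).
  by move=> i; split; [exact: ih|exact: integrable0].
have E : (fun x : 'rV[R]_d => \prod_(i < d) (h i (x 0 i))%:C) =
    fun x => (\prod_(i < d) h i (x 0 i))%:C.
  by apply/funext => x; rewrite rmorph_prod.
under eq_bigr do rewrite cint_real.
rewrite -rmorph_prod E.
move=> /(congr1 (@complex.Re R)) /= <-; split => //.
by move: i1; rewrite /= (_ : (fun x => _) = (fun x : 'rV[R]_d => (cRe (\prod_(i < d) h i (x 0 i))%:C)%:E))//; apply/funext => x; rewrite rmorph_prod.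
Qed.

End product_integrals.

(** * Translation invariance of integrals *)

Section invariance.
Variables (R : realType) (d : nat).
Local Notation V := 'rV[R]_d.
Local Notation mu := (lebesgue_rV R d).

Lemma eq_integral_shift (a : V) (f : V -> \bar R) :
  (\int[push_measure (measurable_rV_shift a) mu]_x f x = \int[mu]_x f x)%E.
Proof. by apply: eq_measure_integral => A mA _; exact: lebesgue_rV_shift. Qed.

Lemma integrable_shift (a : V) (f : V -> R) : mu.-integrable setT (EFin \o f) ->
  mu.-integrable setT (fun x => (f (x + a))%:E).
Proof.
move=> /integrableP[mf fi]; apply/integrableP; split.
  apply/measurable_EFinP.
  by apply: measurableT_comp (measurable_rV_shift a); exact/measurable_EFinP.
move: fi; rewrite -(eq_integral_shift a); apply: le_lt_trans.
have -> := @ge0_integral_pushforward _ _ _ _ _ _ (measurable_rV_shift a) mu setT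
  (fun x => `|(f x)%:E|%E) => //.
exact: measurableT_comp.
Qed.

Lemma Rintegral_shift (a : V) (f : V -> R) : mu.-integrable setT (EFin \o f) ->
  \int[mu]_x f (x + a) = \int[mu]_x f x.
Proof.
move=> fi; rewrite [in RHS]/Rintegral -(eq_integral_shift a).
rewrite -(@Rintegral_push_measure _ _ _ _ _ mu _ (measurable_rV_shift a))//.
  by move/measurable_int/measurable_EFinP : fi.
exact: (integrable_shift a fi).
Qed.

Lemma cintegrable_shift (a : V) (f : V -> R[i]) : cintegrable mu f ->
  cintegrable mu (fun x => f (x + a)).
Proof.
move=> [f1 f2]; split.
  exact: (integrable_shift a (f := fun x => cRe (f x))).
exact: (integrable_shift a (f := fun x => cIm (f x))).
Qed.

Lemma cintegral_shift (a : V) (f : V -> R[i]) : cintegrable mu f ->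
  cintegral (fun x => f (x + a)) = cintegral f.
Proof.
move=> [f1 f2]; apply: complex_ext => /=.
  exact: (Rintegral_shift a (f := fun x => cRe (f x))).
exact: (Rintegral_shift a (f := fun x => cIm (f x))).
Qed.

End invariance.

(** * The one-dimensional Poisson kernel as a Fourier transform *)

Section one_dimensional_integrals.
Variable R : realType.
Local Notation M := (measurableTypeR R).
Local Notation mu := (@lebesgue_measure R).
Implicit Types a e t y : R.

(** The Poisson kernel of the half-plane without its factor [1 / pi], so that its integral is [pi]
    for every width [e]. *)
Definition poisson (e t : R) : R := e / (e ^+ 2 + t ^+ 2).

Lemma poisson_ge0 e t : 0 < e -> 0 <= poisson e t.
Proof. by move=> e0; rewrite divr_ge0 ?addr_ge0 ?sqr_ge0// ltW. Qed.

Lemma poisson_den_gt0 (e t : R) : 0 < e -> 0 < e ^+ 2 + t ^+ 2.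
Proof. by move=> e0; rewrite ltr_pwDl ?sqr_ge0// exprn_gt0. Qed.

Lemma continuous_poisson e : 0 < e -> continuous (poisson e).
Proof.
move=> e0 t; apply: cvgM; first exact: cvg_cst.
apply: cvgV; first by rewrite gt_eqF// poisson_den_gt0.
by apply: cvgD; [exact: cvg_cst|exact: exprn_continuous].
Qed.

Lemma is_derive_poisson e t : 0 < e ->
  is_derive t 1 (fun s : R => atan (s / e)) (poisson e t).
Proof.
move=> e0; have en0 : e != 0 by rewrite gt_eqF.
have d1 : is_derive t 1 (fun s : R => s / e) e^-1.
  rewrite (_ : (fun s : R => s / e) = e^-1 \*: id).
    by apply: is_derive_eq; rewrite /GRing.scale/= mulr1.
  by apply/funext => s /=; rewrite /GRing.scale/= mulrC.
apply: (is_derive_eq (@is_derive1_comp _ atan (fun s => s / e) t _ _ (is_derive1_atan (t / e)) d1)).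
rewrite /poisson /GRing.scale/=.
have := poisson_den_gt0 t e0; move=> /gt_eqF/negbT h.
by field; rewrite en0 /= h.
Qed.

Lemma integral_poisson e : 0 < e -> (\int[mu]_t (poisson e t)%:E = pi%:E)%E.
Proof.
move=> e0; rewrite ge0_symfun_integralT; last 3 first.
- by move=> t; exact: poisson_ge0.
- exact: continuous_poisson.
- by move=> t /=; rewrite /poisson sqrrN.
rewrite (_ : [set x | _] = `[0, +oo[%classic); last first.
  by apply/seteqP; split => x /=; rewrite in_itv/= andbT.
rewrite (@ge0_continuous_FTC2y _ (poisson e) (fun s => atan (s / e)) 0 (pi / 2)).
- by rewrite mul0r atan0 sube0 -EFinM mulrC divfK.
- by move=> t _; exact: poisson_ge0.
- by apply: continuous_subspaceT; exact: continuous_poisson.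
- have : s / e @[s --> +oo] --> +oo.
    by apply: gt0_cvgMly; rewrite ?invr_gt0//; exact: cvg_id.
  by move=> h; apply: (cvg_comp _ _ h); exact: cvgy_atan.
- move=> t _; exact: (@ex_derive _ _ _ _ _ _ _ (is_derive_poisson t e0)).
- apply: cvg_at_right_filter; apply: differentiable_continuous; apply/derivable1_diffP.
  exact: (@ex_derive _ _ _ _ _ _ _ (is_derive_poisson 0 e0)).
- by move=> t _; rewrite derive1E (@derive_val _ _ _ _ _ _ _ (is_derive_poisson t e0)).
Qed.

Lemma integrable_poisson e : 0 < e -> mu.-integrable setT (fun t => (poisson e t)%:E).
Proof.
move=> e0; apply/integrableP; split.
  have m := continuous_measurable_fun (continuous_poisson e0).
  exact/measurable_EFinP.
under eq_integral do rewrite gee0_abs ?lee_fin ?poisson_ge0//.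
by rewrite integral_poisson// ltry.
Qed.

Lemma Rintegral_poisson e : 0 < e -> \int[mu]_t poisson e t = pi.
Proof. by move=> e0; rewrite /Rintegral integral_poisson. Qed.

Definition damp (a t : R) : R := expR (- (a * `|t|)).

Lemma continuous_damp a : continuous (damp a).
Proof.
move=> t; apply: continuous_comp; last exact: continuous_expR.
by apply: cvgN; apply: cvgM; [exact: cvg_cst|exact: norm_continuous].
Qed.

(** With [u = a |t|], [expR u >= (1 + u / 2) ^ 2 >= 1 + u ^ 2 / 4]; the constant is chosen so that
    [(1 + 4 / a ^ 2) (1 + a ^ 2 t ^ 2 / 4) >= 1 + t ^ 2]. *)
Lemma damp_le a t : 0 < a -> damp a t <= (1 + 4 / a ^+ 2) * poisson 1 t.
Proof.
move=> a0; rewrite /damp /poisson expr1n div1r.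
have an0 : a != 0 by rewrite gt_eqF.
have p1 : 0 < 1 + t ^+ 2 by rewrite ltr_pwDl ?sqr_ge0.
set u := a * `|t|; have u0 : 0 <= u by rewrite mulr_ge0// ltW.
have h : 1 + u ^+ 2 / 4 <= expR u.
  have -> : u = u / 2 + u / 2 by rewrite -splitr.
  rewrite expRD -expr2.
  apply: (@le_trans _ _ ((1 + u / 2) ^+ 2)).
    by rewrite -splitr -subr_ge0 (_ : _ - _ = u); [|field].
  rewrite ler_pXn2r// ?nnegrE ?addr_ge0 ?divr_ge0 ?expR_ge0//.
  exact: expR_ge1Dx.
have h0 : 0 < 1 + u ^+ 2 / 4 by rewrite ltr_pwDl// divr_ge0 ?sqr_ge0.
rewrite expRN ler_pdivlMr// mulrC ler_pdivrMr ?expR_gt0//.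
have c0 : 0 <= 1 + 4 / a ^+ 2 by rewrite addr_ge0// divr_ge0 ?sqr_ge0.
apply: le_trans (ler_wpM2l c0 h).
rewrite /u exprMn real_normK ?num_real// -subr_ge0.
rewrite (_ : _ - _ = 4 / a ^+ 2 + a ^+ 2 * t ^+ 2 / 4); last by field.
by rewrite addr_ge0// divr_ge0// ?sqr_ge0// mulr_ge0// sqr_ge0.
Qed.

Lemma integrable_damp a : 0 < a -> mu.-integrable setT (fun t => (damp a t)%:E).
Proof.
move=> a0; apply: (le_integrable measurableT _ _
   (integrableZl measurableT (1 + 4 / a ^+ 2) (integrable_poisson ltr01))).
  have m := continuous_measurable_fun (@continuous_damp a).
  exact/measurable_EFinP.
move=> t _; rewrite -EFinM lee_fin ger0_norm ?expR_ge0//.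
by rewrite (le_trans (damp_le t a0))// ler_norm.
Qed.

Lemma Rintegral_oppr (u : M -> R) : mu.-integrable setT (EFin \o u) ->
  \int[mu]_t u (- t) = \int[mu]_t u t.
Proof.
move=> iu; have mo : measurable_fun setT (-%R : M -> M) by exact: oppr_measurable.
have mu' : measurable_fun setT u by move/measurable_int/measurable_EFinP : iu.
have E (v : M -> \bar R) : (\int[push_measure mo mu]_t v t = \int[mu]_t v t)%E.
  by apply: eq_measure_integral => A mA _; exact: lebesgue_measureN.
rewrite -(@Rintegral_push_measure _ _ _ _ _ mu _ mo)//.
  by rewrite /Rintegral E.
apply/integrableP; split; first by apply/measurable_EFinP; exact: measurableT_comp.
have [_] := integrableP _ _ _ iu; rewrite -E; apply: le_lt_trans.
have -> := @ge0_integral_pushforward _ _ _ _ _ _ mo mu setT (fun x => `|(u x)%:E|%E) => //.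
by apply: measurableT_comp => //; exact/measurable_EFinP.
Qed.

(** The real part of [exp ((- a + i y) t) / (- a + i y)], a primitive of [exp (- a t) cos (t y)]. *)
Definition damp_cos_primitive (a y t : R) : R :=
  expR (- (a * t)) * (y * sin (t * y) - a * cos (t * y)) / (a ^+ 2 + y ^+ 2).

Lemma is_derive_damp_cos_primitive a y t : 0 < a ->
  is_derive t 1 (damp_cos_primitive a y) (expR (- (a * t)) * cos (t * y)).
Proof.
move=> a0; have h := poisson_den_gt0 y a0.
have d1 : is_derive t 1 (fun s : R => - (a * s)) (- a).
  by apply: is_derive_eq; rewrite /GRing.scale/= mulr1.
have d2 : is_derive t 1 (fun s : R => s * y) y.
  by apply: is_derive_eq; rewrite /GRing.scale/= mulr0 add0r mulr1.
have d3 := @is_derive1_comp _ expR (fun s => - (a * s)) t _ _ (is_derive_expR (- (a * t))) d1.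
have d4 := @is_derive1_comp _ sin (fun s => s * y) t _ _ (is_derive_sin (t * y)) d2.
have d5 := @is_derive1_comp _ cos (fun s => s * y) t _ _ (is_derive_cos (t * y)) d2.
rewrite (_ : damp_cos_primitive a y = ((expR \o (fun s : R => - (a * s))) *
  (y \*: (sin \o (fun s : R => s * y)) - a \*: (cos \o (fun s : R => s * y)))) *
   cst ((a ^+ 2 + y ^+ 2)^-1)); last by apply/funext => s.
apply: is_derive_eq; rewrite /GRing.scale !fctE /GRing.scale/=.
rewrite -![_ *: _]/(_ * _).
by move: h => /gt_eqF/negbT h; field.
Qed.

Lemma cvg_damp_cos_primitive a y : 0 < a -> damp_cos_primitive a y t @[t --> +oo] --> 0.
Proof.
move=> a0.
have h := poisson_den_gt0 y a0.
have ce : expR (- (a * t)) @[t --> +oo] --> (0 : R).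
  have ht : a * t @[t --> +oo] --> +oo by apply: gt0_cvgMry => //; exact: cvg_id.
  exact: (@cvg_comp _ _ _ (fun t => a * t) (fun s => expR (- s)) _ _ _ ht (@cvgr_expR R)).
pose C : R := (`|y| + a) / (a ^+ 2 + y ^+ 2).
apply/cvgr0Pnorm_le => e e0.
have C0 : 0 <= C by apply: divr_ge0; [rewrite addr_ge0// ltW|exact: ltW].
have /cvgr0Pnorm_le/(_ _ (divr_gt0 e0 (ltr_wpDl C0 ltr01))) := ce.
apply: filterS => t; rewrite ger0_norm ?expR_ge0// ler_pdivlMr ?ltr_wpDl//.
apply: le_trans; rewrite /damp_cos_primitive -mulrA normrM ger0_norm ?expR_ge0//.
rewrite ler_wpM2l ?expR_ge0// ler_wpDr// normrM normfV [X in _ / X]gtr0_norm//.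
rewrite /C ler_pM2r ?invr_gt0// (le_trans (ler_normB _ _))// lerD//.
  by rewrite normrM ler_piMr// ler_norml sin_geN1 sin_le1.
by rewrite normrM gtr0_norm// ler_piMr ?(ltW a0)// ler_norml cos_geN1 cos_le1.
Qed.

Lemma onem_cos_ge0 (b s : R) : `|b| <= 1 -> 0 <= 1 + b * cos s.
Proof.
move=> b1; have : `|b * cos s| <= 1.
  by rewrite normrM mulr_ile1// ler_norml cos_geN1 cos_le1.
by rewrite ler_norml => /andP[h _]; rewrite -lerBlDl sub0r.
Qed.

(** The summand 1 makes the integrand nonnegative, as required by the fundamental theorem of
    calculus used on the half-line and by the folding of even integrals. The integral of the cosine
    alone is the difference of the cases [b = 1] and [b = 0]. *)
Lemma integral0y_damp_cos a y (b : R) : 0 < a -> `|b| <= 1 ->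
  (\int[mu]_(t in `[0%R, +oo[) (expR (- (a * t)) * (1 + b * cos (t * y)))%:E =
  (a^-1 + b * (a / (a ^+ 2 + y ^+ 2)))%:E)%E.
Proof.
move=> a0 b1; have h := poisson_den_gt0 y a0.
pose F t := damp_cos_primitive a 0 t + b * damp_cos_primitive a y t.
have dF t : is_derive t 1 F (expR (- (a * t)) * (1 + b * cos (t * y))).
  have d0 := is_derive_damp_cos_primitive 0 t a0.
  have dy := is_derive_damp_cos_primitive y t a0.
  apply: (is_derive_eq (is_deriveD d0 (is_deriveZ b dy))).
  by rewrite /GRing.scale/= mulr0 cos0; ring.
have cF : continuous F.
  move=> t; apply: differentiable_continuous; apply/derivable1_diffP.
  exact: (@ex_derive _ _ _ _ _ _ _ (dF t)).
rewrite (@ge0_continuous_FTC2y _ (fun t => expR (- (a * t)) * (1 + b * cos (t * y))) F 0 0).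
- rewrite /F /damp_cos_primitive !mulr0 !mul0r oppr0 expR0 sin0 cos0 mulr0 !mul1r !mulr1 !add0r.
  rewrite -EFinN; congr (_%:E); rewrite expr0n addr0.
  by move: a0 h => /gt_eqF/negbT a0 /gt_eqF/negbT h; field; apply/andP; split.
- by move=> t _; rewrite mulr_ge0 ?expR_ge0// onem_cos_ge0.
- apply: continuous_subspaceT => t; apply: cvgM.
    apply: continuous_comp; last exact: continuous_expR.
    by apply: cvgN; apply: cvgM; [exact: cvg_cst|exact: cvg_id].
  apply: cvgD; first exact: cvg_cst.
  apply: cvgM; first exact: cvg_cst.
  apply: continuous_comp; last exact: continuous_cos.
  by apply: cvgM; [exact: cvg_id|exact: cvg_cst].
- rewrite (_ : 0 = 0 + b * 0); last by rewrite mulr0 addr0.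
  apply: cvgD; first exact: cvg_damp_cos_primitive.
  by apply: cvgM; [exact: cvg_cst|exact: cvg_damp_cos_primitive].
- move=> t _; exact: (@ex_derive _ _ _ _ _ _ _ (dF t)).
- by apply: cvg_at_right_filter; exact: cF.
- by move=> t _; rewrite derive1E (@derive_val _ _ _ _ _ _ _ (dF t)).
Qed.

Lemma Rintegral_damp_cos a y (b : R) : 0 < a -> `|b| <= 1 ->
  \int[mu]_t (damp a t * (1 + b * cos (t * y))) =
  2 * (a^-1 + b * (a / (a ^+ 2 + y ^+ 2))).
Proof.
move=> a0 b1; rewrite /Rintegral ge0_symfun_integralT; last 3 first.
- by move=> t; rewrite mulr_ge0 ?expR_ge0// onem_cos_ge0.
- move=> t; apply: cvgM; first exact: continuous_damp.
  apply: cvgD; first exact: cvg_cst.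
  apply: cvgM; first exact: cvg_cst.
  apply: continuous_comp; last exact: continuous_cos.
  by apply: cvgM; [exact: cvg_id|exact: cvg_cst].
- by move=> t /=; rewrite /damp normrN mulNr cosN.
rewrite (_ : [set x | _] = `[0, +oo[%classic); last first.
  by apply/seteqP; split => x /=; rewrite in_itv/= andbT.
under eq_integral => t.
  rewrite inE /= in_itv /= andbT => t0; rewrite /damp ger0_norm//; over.
by rewrite integral0y_damp_cos.
Qed.

Lemma cint_damp a y : 0 < a ->
  cintegrable mu (fun t => (damp a t)%:C * expi (- (t * y))) /\
  cint mu (fun t => (damp a t)%:C * expi (- (t * y))) = (2 * poisson a y)%:C.
Proof.
move=> a0.
have cc u : continuous u -> continuous (fun t : R => u (- (t * y)) : R).
  move=> cu t; apply: continuous_comp; last exact: cu.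
  by apply: cvgN; apply: cvgM; [exact: cvg_id|exact: cvg_cst].
have iF : cintegrable mu (fun t => (damp a t)%:C * expi (- (t * y))).
  apply: (cintegrable_le _ (integrable_damp a0)).
    apply: cmeasurableM.
      have m := continuous_measurable_fun (@continuous_damp a).
      exact: cmeasurable_real.
    have mc := continuous_measurable_fun (cc _ (@continuous_cos R)).
    have ms := continuous_measurable_fun (cc _ (@continuous_sin R)).
    by split.
  move=> t; rewrite cabsM cabs_real ger0_norm ?expR_ge0//.
  by rewrite /= cos2Dsin2 sqrtr1 mulr1.
split=> //; apply: complex_ext => /=.
  have i1 := integrable_damp a0; have i2 := iF.1.
  have E : \int[mu]_t (damp a t * (1 + 1 * cos (t * y))) =
     \int[mu]_t damp a t + \int[mu]_t cRe ((damp a t)%:C * expi (- (t * y))).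
    rewrite -RintegralD//; apply: eq_Rintegral => t _ /=.
    by rewrite mul0r subr0 cosN mul1r mulrDr mulr1.
  have E0 : \int[mu]_t (damp a t * (1 + 0 * cos (t * y))) = \int[mu]_t damp a t.
    by apply: eq_Rintegral => t _; rewrite mul0r addr0 mulr1.
  move: E; rewrite -E0 !Rintegral_damp_cos ?normr0 ?normr1// mul0r addr0 mul1r mulrDr.
  by move=> /addrI <-.
(* The imaginary part is odd in [t], so its integral is its own opposite. *)
have := Rintegral_oppr iF.2.
rewrite (_ : \int[mu]_t cIm ((damp a (- t))%:C * expi (- (- t * y))) =
   - \int[mu]_t cIm ((damp a t)%:C * expi (- (t * y)))).
  by move=> /eqP; rewrite eq_sym -subr_eq0 opprK -mulr2n mulrn_eq0/= => /eqP.
rewrite -mulN1r -RintegralZl//; last exact: iF.2.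
apply: eq_Rintegral => t _ /=.
by rewrite /damp normrN !mul0r !addr0 mulNr opprK sinN mulrN mulN1r opprK.
Qed.

End one_dimensional_integrals.

(** * The weight, and integrals of derivatives *)

Section weight.
Variables (R : realType) (d : nat).
Local Notation V := 'rV[R]_d.
Local Notation mu := (lebesgue_rV R d).
Implicit Types (x y : V) (f g : V -> R[i]).

(** The product of the [1 / (1 + x_i ^ 2)]. Being integrable and at most 1 it lies in every [L^p],
    and it varies by a bounded factor under bounded translations. *)
Definition weight x : R := \prod_(i < d) poisson 1 (x 0 i).

Lemma poisson1E (t : R) : poisson 1 t = (1 + t ^+ 2)^-1.
Proof. by rewrite /poisson expr1n div1r. Qed.

Lemma poisson1_gt0 (t : R) : 0 < poisson 1 t.
Proof. by rewrite poisson1E invr_gt0 ltr_pwDl ?sqr_ge0. Qed.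

Lemma weight_gt0 x : 0 < weight x.
Proof. by apply: prodr_gt0 => i _; exact: poisson1_gt0. Qed.

Lemma weight_le1 x : weight x <= 1.
Proof.
apply: prodr_ile1 => i _; rewrite ltW ?poisson1_gt0//= poisson1E.
by rewrite invf_le1 ?lerDl ?sqr_ge0// ltr_pwDl ?sqr_ge0.
Qed.

Lemma integrable_weight : mu.-integrable setT (EFin \o weight).
Proof. by have [] := @Rintegral_rV_prod R d (fun=> poisson 1) (fun=> integrable_poisson ltr01). Qed.

(** Serves to dominate difference quotients uniformly in the step. The constant 3 comes from
    completing the square in [3 (1 + (t + s) ^ 2) - (1 + t ^ 2)]. *)
Lemma weight_shift x (i : 'I_d) (s : R) : `|s| <= 1 ->
  weight (x + s *: basis_vector R i) <= 3 * weight x.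
Proof.
move=> s1; rewrite /weight (bigD1 i)//= [in leRHS](bigD1 i)//= mulrA.
have -> : \prod_(j < d | j != i) poisson 1 ((x + s *: basis_vector R i) 0 j) =
          \prod_(j < d | j != i) poisson 1 (x 0 j).
  by apply: eq_bigr => j ji; rewrite !mxE (negPf ji) andbF mulr0 addr0.
rewrite ler_wpM2r//.
  by apply: prodr_ge0 => j _; exact/ltW/poisson1_gt0.
rewrite !mxE !eqxx mulr1 !poisson1E.
set t := x 0 i.
have h1 : 0 < 1 + t ^+ 2 by rewrite ltr_pwDl ?sqr_ge0.
have h2 : 0 < 1 + (t + s) ^+ 2 by rewrite ltr_pwDl ?sqr_ge0.
rewrite ler_pdivlMr// mulrC ler_pdivrMr// -subr_ge0.
have s2 : 0 <= 1 - s ^+ 2 by rewrite subr_ge0 -real_normK ?num_real// expr_le1.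
rewrite (_ : _ - _ = 2 * (t + 3 / 2 * s) ^+ 2 + 3 / 2 * (1 - s ^+ 2) + 1 / 2); last by field.
by rewrite !addr_ge0// ?divr_ge0// mulr_ge0// sqr_ge0.
Qed.

(* A bound for all the monomial multiples of [g k] that is uniform in [k]
   upgrades to an integrable majorant, since [1 / weight] is a polynomial. *)
Lemma weight_bound (I : Type) (g : I -> V -> R[i]) (a : I -> R) :
  (forall J, exists C : R, forall k x, cabs (poss J (g k) x) <= C * a k) ->
  exists C : R, forall k x, cabs (g k x) <= C * a k * weight x.
Proof.
move=> H.
have {H} : forall s J, exists C : R, forall k x,
    cabs (poss J (fun x => (\prod_(i <- s) (1 + x 0 i ^+ 2))%:C * g k x) x) <= C * a k.
  elim=> [|i s IH] J.
    have [C HC] := H J; exists C => k x; have := HC k x.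
    by rewrite !possE big_nil mul1r.
  (* The factor [1 + x_i ^ 2] splits the quantity into its multiples by [J] and by [i :: i :: J],
     both covered by the induction hypothesis since it quantifies over [J]. *)
  have [C1 H1] := IH J; have [C2 H2] := IH (i :: i :: J); exists (C1 + C2) => k x.
  have := lerD (H1 k x) (H2 k x); rewrite -mulrDl; apply: le_trans.
  apply: le_trans (cabsD _ _); rewrite le_eqVlt; apply/orP; left; apply/eqP.
  congr (cabs _); rewrite !possE !big_cons !rmorphM !rmorphD !rmorphM rmorph1.
  ring.
move=> /(_ (enum 'I_d) [::])[C HC]; exists C => k x.
have := HC k x; rewrite /= cabsM cabs_real.
have E : \prod_(i <- enum 'I_d) (1 + x 0 i ^+ 2) = (weight x)^-1.
  by rewrite /weight big_enum -prodfV; apply: eq_bigr => i _; rewrite poisson1E invrK.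
by rewrite E gtr0_norm ?invr_gt0 ?weight_gt0// mulrC ler_pdivrMr ?weight_gt0.
Qed.

Lemma rapid_weight f : rapid f -> exists C : R, 0 <= C /\ forall x, cabs (f x) <= C * weight x.
Proof.
move=> rf; have [J|C HC] := @weight_bound unit (fun=> f) (fun=> 1).
  by have [C HC] := rf J; exists C => _ x; rewrite mulr1.
exists `|C|; split => // x; apply: le_trans (HC tt x) _.
by rewrite mulr1 ler_wpM2r ?ler_norm// ltW// weight_gt0.
Qed.

Lemma regular_cmeasurable f : regular f -> cmeasurable f.
Proof. by move=> [c _]; split; apply: continuous_rV_measurable => x; have [] := c x. Qed.

Lemma integrable_weightZ (C : R) : mu.-integrable setT (fun x => (C * weight x)%:E).
Proof. exact: (integrableZl measurableT C integrable_weight). Qed.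

Lemma cintegrable_weight f (C : R) : cmeasurable f ->
  (forall x, cabs (f x) <= C * weight x) -> cintegrable mu f.
Proof. by move=> mf; apply: cintegrable_le => //; exact: integrable_weightZ. Qed.

Lemma rd_cintegrable f : rd f -> cintegrable mu f.
Proof.
move=> rf; have [C [_ HC]] := rapid_weight (rd_rapid rf).
exact: cintegrable_weight (regular_cmeasurable (rd_regular rf)) HC.
Qed.

(** The difference quotients have integral 0 by translation invariance and converge to the
    derivative. The mean value theorem and [weight_shift] dominate them by [3 C weight], so
    dominated convergence applies. *)
Lemma Rintegral_derive_eq0 (u v : V -> R) (C : R) (i : 'I_d) :
  (forall x, is_derive x (basis_vector R i) u (v x)) ->
  measurable_fun setT u -> measurable_fun setT v ->
  (forall x, `|u x| <= C * weight x) -> (forall x, `|v x| <= C * weight x) ->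
  \int[mu]_x v x = 0.
Proof.
move=> du mu' mv ub vb.
have iw := integrable_weightZ C.
have bounded_int (h : V -> R) : measurable_fun setT h -> (forall x, `|h x| <= C * weight x) ->
    mu.-integrable setT (EFin \o h).
  move=> mh hb; apply: (le_integrable measurableT _ _ iw); first exact/measurable_EFinP.
  by move=> x _; rewrite lee_fin (le_trans (hb x))// ler_norm.
have iu := bounded_int u mu' ub.
pose e (n : nat) : R := n.+1%:R^-1.
have e0 n : 0 < e n by rewrite invr_gt0.
pose q (n : nat) x : R := (u (x + e n *: basis_vector R i) - u x) * n.+1%:R.
have iq0 n : \int[mu]_x q n x = 0.
  have is' := integrable_shift (e n *: basis_vector R i) iu.
  have iB := integrableB measurableT is' iu.
  by rewrite /q RintegralZr// RintegralB// Rintegral_shift// subrr mul0r.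
have mq n : measurable_fun setT (q n).
  apply: measurable_funM => //; apply: measurable_funB => //.
  exact: (measurableT_comp mu' (measurable_rV_shift _)).
have qb n x : `|q n x| <= 3 * (C * weight x).
  rewrite /q; have [c /andP[c0 cn] ->] := line_mean_value x du (e0 n).
  rewrite mulrAC mulVf ?pnatr_eq0// mul1r (le_trans (vb _))//.
  rewrite [leRHS]mulrCA ler_wpM2l//.
    by have := le_trans (normr_ge0 _) (ub x); rewrite pmulr_lge0// weight_gt0.
  apply: weight_shift; rewrite gtr0_norm// ltW// (lt_le_trans cn)//.
  by rewrite /e invf_le1// ler1n.
have [_ _] : [/\ mu.-integrable setT (EFin \o v),
   (fun n => \int[mu]_x (`|(q n x)%:E - (v x)%:E|))%E @ \oo --> 0%E &
   (fun n => \int[mu]_x (q n x)%:E)%E @ \oo --> (\int[mu]_x (v x)%:E)%E].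
  apply: (@dominated_convergence _ _ _ mu setT measurableT (fun n x => (q n x)%:E)
     (EFin \o v) (fun x => 3%:E * (C * weight x)%:E)%E).
  - by move=> n; exact/measurable_EFinP.
  - exact/measurable_EFinP.
  - apply: aeW => x _; apply: cvg_EFin; first by apply: nearW.
    have [dx <-] := du x; rewrite /derive.
    have ce : e n @[n --> \oo] --> (0 : R)^'.
      move=> A hA; have := @cvg_harmonic R _ hA.
      by apply: (@filterS _ \oo) => n /=; apply; rewrite gt_eqF.
    apply: cvg_trans (cvg_comp _ _ ce dx); apply: near_eq_cvg; apply: nearW => n /=.
    by rewrite /q /e invrK [RHS]mulrC (addrC x).
  - exact: integrableZl.
  - by apply: aeW => x n _; rewrite lee_fin qb.
have -> : (fun n => \int[mu]_x (q n x)%:E)%E = fun=> 0%E.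
  apply/funext => n; rewrite -(@fineK _ (\int[mu]_x (q n x)%:E)%E); first by rewrite -/(Rintegral _ _ _) iq0.
  apply: integrable_fin_num => //.
  apply: (le_integrable measurableT _ _ (integrableZl measurableT 3 iw)); first exact/measurable_EFinP.
  by move=> x _; rewrite lee_fin (le_trans (qb n x))// ler_norm.
move=> /cvg_lim h; rewrite /Rintegral -h//.
by rewrite (cvg_lim _ (cvg_cst _)).
Qed.

End weight.

(** Restriction to the line through [x] in direction [v] reduces this to the one-variable chain
    rule. *)
Lemma is_derive_comp_line (R : realType) (V : normedModType R) (f : R -> R) (u : V -> R)
    (x v : V) (a b : R) :
  is_derive (u x) 1 f a -> is_derive x v u b -> is_derive x v (f \o u) (a * b).
Proof.
move=> df du.
have dl : is_derive (0 : R) 1 (fun s : R => u (x + s *: v)) b.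
  have := @is_derive_line _ _ u v x 0; rewrite scale0r addr0 => /(_ (@ex_derive _ _ _ _ _ _ _ du)).
  by rewrite (@derive_val _ _ _ _ _ _ _ du).
have [d1 d2] : is_derive (0 : R) 1 (f \o (fun s : R => u (x + s *: v))) (a * b).
  by apply: is_derive1_comp; rewrite scale0r addr0.
have E : (fun h : R => h^-1 *: (((f \o u) \o shift x) (h *: v) - (f \o u) x)) =
    (fun h : R => h^-1 *: (((f \o (fun s : R => u (x + s *: v))) \o shift 0) (h *: 1) -
       (f \o (fun s : R => u (x + s *: v))) 0)).
  apply/funext => h /=; rewrite addr0 (_ : h%:A = h); last exact: mulr1.
  by rewrite scale0r addr0 (addrC x).
by split; rewrite ?/derivable ?/derive E.
Qed.

(** * The Fourier transform of a derivative *)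

Section fourier_transform.
Variables (R : realType) (d : nat).
Local Notation V := 'rV[R]_d.
Local Notation mu := (lebesgue_rV R d).
Implicit Types (x y l : V) (f g h : V -> R[i]).

Definition wave l x : R[i] := expi (- dotp l x).

(* The unnormalized Fourier transform: [fourier] up to the factor (2 pi)^(-d/2). *)
Definition ft f l : R[i] := cintegral (fun x => f x * wave l x).

Lemma cabs_expi (t : R) : cabs (expi t) = 1.
Proof. by rewrite /= cos2Dsin2 sqrtr1. Qed.

Lemma expiD (s t : R) : expi (s + t) = expi s * expi t.
Proof. by apply: complex_ext => /=; rewrite ?cosD ?sinD//; ring. Qed.

Lemma dotpC x y : dotp x y = dotp y x.
Proof. by apply: eq_bigr => i _; rewrite mulrC. Qed.

Lemma dotpDr l x y : dotp l (x + y) = dotp l x + dotp l y.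
Proof. by rewrite /dotp -big_split; apply: eq_bigr => i _; rewrite mxE mulrDr. Qed.

Lemma dotpDl l k x : dotp (l + k) x = dotp l x + dotp k x.
Proof. by rewrite dotpC dotpDr !(dotpC x). Qed.

Lemma waveD l x y : wave l (x + y) = wave l x * wave l y.
Proof. by rewrite /wave dotpDr opprD expiD. Qed.

Lemma waveC l x : wave l x = wave x l.
Proof. by rewrite /wave dotpC. Qed.

Lemma cabs_wave l x : cabs (wave l x) = 1. Proof. exact: cabs_expi. Qed.

Lemma has_partial_wave l x i : has_partial (wave l) x i (- (l 0 i)%:C * 'i%C * wave l x).
Proof.
have dd : is_derive x (basis_vector R i) (fun y => - dotp l y) (- l 0 i).
  apply: is_deriveN.
  rewrite /dotp (_ : (fun y => _) = \sum_(j < d) (fun y : V => l 0 j * y 0 j)); last first.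
    by apply/funext => y; rewrite fct_sumE.
  rewrite (_ : l 0 i = \sum_(j < d) l 0 j * (j == i)%:R); last first.
    by rewrite (bigD1 i)//= eqxx mulr1 big1 ?addr0// => j /negPf ->; rewrite mulr0.
  apply: is_derive_sum => j.
  have [dj _] := has_partial_coord x i j.
  have := is_deriveZ (l 0 j) dj.
  rewrite (_ : cRe (j == i)%:R = (j == i)%:R :> R)//; by case: (j == i).
split.
  apply: (is_derive_eq (@is_derive_comp_line _ _ cos (fun y => - dotp l y) x _ _ _
    (is_derive_cos (- dotp l x)) dd)) => /=; ring.
apply: (is_derive_eq (@is_derive_comp_line _ _ sin (fun y => - dotp l y) x _ _ _
  (is_derive_sin (- dotp l x)) dd)) => /=; ring.
Qed.

Lemma continuous_dotp l : continuous (dotp l).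
Proof.
move=> x; rewrite /dotp; elim: (index_enum _) => [|i s IH].
  rewrite (_ : (fun y => _) = fun=> 0); first exact: cst_continuous.
  by apply/funext => y; rewrite big_nil.
rewrite (_ : (fun y => _) = (fun y : V => l 0 i * y 0 i) \+ (fun y : V => \sum_(j <- s) l 0 j * y 0 j)).
  apply: continuousD; last exact: IH.
  by apply: continuousM; [exact: cst_continuous|exact: coord_continuous].
by apply/funext => y; rewrite big_cons.
Qed.

Lemma ccontinuous_wave l x : ccontinuous (wave l) x.
Proof.
split; apply: continuous_comp.
- by apply: continuousN; exact: continuous_dotp.
- exact: continuous_cos.
- by apply: continuousN; exact: continuous_dotp.
- exact: continuous_sin.
Qed.

Lemma cmeasurable_wave l : cmeasurable (wave l).
Proof. by split; apply: continuous_rV_measurable => x; have [] := ccontinuous_wave l x. Qed.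

Lemma cintegrable_wave f l : cintegrable mu f -> cintegrable mu (fun x => f x * wave l x).
Proof.
move=> fi; apply: (cintegrable_le _ (cintegrable_cabs fi)).
  by apply: cmeasurableM; [exact: cintegrable_measurable fi|exact: cmeasurable_wave].
by move=> x; rewrite cabsM cabs_wave mulr1.
Qed.

Lemma ftD f g : cintegrable mu f -> cintegrable mu g ->
  ft (fun x => f x + g x) = fun l => ft f l + ft g l.
Proof.
move=> fi gi; apply/funext => l; rewrite -[RHS]cintD; try exact: cintegrable_wave.
by apply: eq_cint => x; rewrite mulrDl.
Qed.

Lemma ftZ z f : cintegrable mu f -> ft (fun x => z * f x) = fun l => z * ft f l.
Proof.
move=> fi; apply/funext => l; rewrite -[RHS]cintZ; last exact: cintegrable_wave.
by apply: eq_cint => x; rewrite mulrA.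
Qed.

Lemma cintegral_partial0 h (v : V -> R[i]) i (C : R) :
  (forall x, has_partial h x i (v x)) -> cmeasurable h -> cmeasurable v ->
  (forall x, cabs (h x) <= C * weight x) -> (forall x, cabs (v x) <= C * weight x) ->
  cintegral v = 0.
Proof.
move=> dh [h1 h2] [v1 v2] hb vb; apply: complex_ext => /=.
  apply: (@Rintegral_derive_eq0 _ _ (cRe \o h) (cRe \o v) C i) => // x.
  - exact: (dh x).1.
  - by rewrite (le_trans (cabs_Re _)).
  - by rewrite (le_trans (cabs_Re _)).
apply: (@Rintegral_derive_eq0 _ _ (cIm \o h) (cIm \o v) C i) => // x.
- exact: (dh x).2.
- by rewrite (le_trans (cabs_Im _)).
- by rewrite (le_trans (cabs_Im _)).
Qed.

(** Integration by parts: the integral of the derivative of [f * wave l] vanishes by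
    [cintegral_partial0]. *)
Lemma ft_partial f i l : rd f -> ft (partial i f) l = (l 0 i)%:C * 'i%C * ft f l.
Proof.
move=> rf; have rpf := rd_partial i rf.
have [C1 [C10 H1]] := rapid_weight (rd_rapid rf).
have [C2 [C20 H2]] := rapid_weight (rd_rapid rpf).
have mf := regular_cmeasurable (rd_regular rf).
have mpf := regular_cmeasurable (rd_regular rpf).
have mw := cmeasurable_wave l.
pose z : R[i] := - (l 0 i)%:C * 'i%C; have zE : z = - (l 0 i)%:C * 'i%C by [].
clearbody z.
have i1 := cintegrable_wave l (rd_cintegrable rf).
have i2 := cintegrable_wave l (rd_cintegrable rpf).
have [C30 H3] : 0 <= C2 + C1 * cabs z /\ 0 <= C1 * cabs z.
  by rewrite addr_ge0// mulr_ge0// cabs_ge0.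
have w0 x : 0 <= weight x by exact/ltW/weight_gt0.
have := @cintegral_partial0 (fun x => f x * wave l x)
  (fun x => partial i f x * wave l x + z * (f x * wave l x)) i (C1 + (C2 + C1 * cabs z)).
move=> H; suff : cint mu (fun x => partial i f x * wave l x + z * (f x * wave l x)) = 0.
  rewrite cintD//; last exact: cintegrableZ.
  rewrite cintZ// => /eqP; rewrite addr_eq0 => /eqP E; rewrite /ft.
  by apply: (etrans E); rewrite zE !mulNr opprK.
apply: H.
- move=> x; apply: (has_partial_eq (has_partialM (regular_has_partial x i (rd_regular rf)) (has_partial_wave l x i))).
  by rewrite zE; ring.
- exact: cmeasurableM.
- apply: cmeasurableD; first exact: cmeasurableM.
  by apply: cmeasurableM; [exact: cmeasurable_cst|exact: cmeasurableM].
- move=> x; rewrite cabsM cabs_wave mulr1 (le_trans (H1 x))// ler_wpM2r//.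
  by rewrite lerDl.
- move=> x; rewrite (le_trans (cabsD _ _))// !cabsM !cabs_wave !mulr1.
  apply: (@le_trans _ _ (C2 * weight x + cabs z * (C1 * weight x))).
    by rewrite lerD// ler_wpM2l// cabs_ge0.
  rewrite mulrCA mulrA -mulrDl mulrC [leRHS]mulrC ler_wpM2l// [leRHS]addrA.
  by rewrite [C1 * _]mulrC -addrA lerDr.
Qed.

End fourier_transform.

(** * The multiplication formula and continuity of the transform *)

Section fourier_exchange.
Variables (R : realType) (d : nat).
Local Notation V := 'rV[R]_d.
Local Notation mu := (lebesgue_rV R d).
Implicit Types (x y l k : V) (f g h : V -> R[i]).

Lemma cmeasurable_wave2 : cmeasurable (fun z : V * V => wave z.1 z.2).
Proof.
have md : measurable_fun setT (fun z : V * V => dotp z.1 z.2).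
  rewrite /dotp; elim: (index_enum _) => [|i s IH].
    by under eq_fun do rewrite big_nil; exact: measurable_cst.
  under eq_fun do rewrite big_cons; apply: measurable_funD => //.
  apply: measurable_funM.
    exact: (measurableT_comp (measurable_rV_coord i) measurable_fst).
  exact: (measurableT_comp (measurable_rV_coord i) measurable_snd).
have mn : measurable_fun setT (fun z : V * V => - dotp z.1 z.2) by exact: measurable_funN.
split.
  exact: (measurableT_comp (continuous_measurable_fun (@continuous_cos R)) mn).
exact: (measurableT_comp (continuous_measurable_fun (@continuous_sin R)) mn).
Qed.

(** Fubini's theorem for [g l * f x * wave l x]: the kernel is symmetric in its two arguments and
    has modulus 1. All duality between functions and transforms goes through this formula. *)
Lemma ft_exchange f g : cintegrable mu f -> cintegrable mu g ->
  cintegral (fun l => ft f l * g l) = cintegral (fun x => f x * ft g x).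
Proof.
move=> fi gi.
pose m := @sf_lebesgue_rV R d.
pose F (z : V * V) := g z.1 * f z.2 * wave z.1 z.2.
have iF : cintegrable (m \x m)%E F.
  have ii := @cintegrable_prodM _ _ _ _ _ m m g f gi fi.
  apply: (cintegrable_le _ (cintegrable_cabs ii)).
    apply: cmeasurableM; first exact: cintegrable_measurable ii.
    exact: cmeasurable_wave2.
  by move=> z; rewrite /F cabsM cabs_wave mulr1.
have E1 l : (fun x => F (l, x)) = fun x => g l * (f x * wave l x).
  by apply/funext => x; rewrite /F /= mulrA.
have E2 x : (fun l => F (l, x)) = fun l => f x * (g l * wave x l).
  by apply/funext => l; rewrite /F /= (mulrC (g l)) mulrA waveC.
have := @cint_fubini _ _ _ _ _ m m F iF.
have -> : (fun l => cint m (fun x => F (l, x))) = fun l => ft f l * g l.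
  by apply/funext => l; rewrite E1 cintZ ?(mulrC (g l))//; exact: cintegrable_wave.
have -> : (fun x => cint m (fun l => F (l, x))) = fun x => f x * ft g x.
  by apply/funext => l; rewrite E2 cintZ //; exact: cintegrable_wave.
apply=> x; first by rewrite E1; apply/cintegrableZ/cintegrable_wave.
by rewrite E2; apply/cintegrableZ/cintegrable_wave.
Qed.

Lemma cos_lipschitz (s t : R) : `|cos s - cos t| <= `|s - t|.
Proof.
wlog st : s t / t < s.
  move=> H; have [/H//|/H|->] := ltgtP t s; last by rewrite !subrr.
  by rewrite distrC (distrC t).
have [|c _ ->] := @MVT R cos (fun r : R => - sin r) t s st (fun r _ => is_derive_cos r).
  by apply: continuous_subspaceT => r; exact: continuous_cos.
by rewrite normrM ler_piMl// normrN ler_norml sin_geN1 sin_le1.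
Qed.

Lemma sin_lipschitz (s t : R) : `|sin s - sin t| <= `|s - t|.
Proof.
wlog st : s t / t < s.
  move=> H; have [/H//|/H|->] := ltgtP t s; last by rewrite !subrr.
  by rewrite distrC (distrC t).
have [|c _ ->] := @MVT R sin cos t s st (fun r _ => is_derive_sin r).
  by apply: continuous_subspaceT => r; exact: continuous_sin.
by rewrite normrM ler_piMl// ler_norml cos_geN1 cos_le1.
Qed.

Lemma dotp_le l x : `|dotp l x| <= `|l| * \sum_(i < d) `|x 0 i|.
Proof.
rewrite /dotp (le_trans (ler_norm_sum _ _ _))// mulr_sumr ler_sum// => i _.
by rewrite normrM ler_wpM2r// rV_coord_norm_le.
Qed.

Lemma wave_lipschitz l k x :
  cabs (wave l x - wave k x) <= `|l - k| * (2 * \sum_(i < d) `|x 0 i|).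
Proof.
apply: (@le_trans _ _ (2 * `|dotp (l - k) x|)).
  rewrite (le_trans (cabs_ReIm _))// mulr_natl mulr2n.
  have E : `|- dotp l x - - dotp k x| = `|dotp (l - k) x|.
    rewrite -opprB opprK normrN addrC dotpDl; congr (`|_ + _|).
    rewrite /dotp -sumrN; apply: eq_bigr => i _; by rewrite mxE mulNr.
  by rewrite -E /=; apply: lerD; [exact: cos_lipschitz|exact: sin_lipschitz].
by rewrite mulrCA ler_pM2l// dotp_le.
Qed.

Lemma lipschitz_ccontinuous g (M : R) :
  (forall l k, cabs (g l - g k) <= M * `|l - k|) -> forall l, ccontinuous g l.
Proof.
move=> H l.
have key (u : V -> R) : (forall l k, `|u l - u k| <= M * `|l - k|) -> {for l, continuous u}.
  move=> Hu; apply/(@cvgrPdist_le _ _ _ (nbhs l) (nbhs_filter l)) => e e0.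
  have M1 : 0 < `|M| + 1 by rewrite ltr_wpDl.
  apply/(@nbhs_ballP _ V); exists (e / (`|M| + 1)) => /=; first by rewrite divr_gt0.
  move=> k; rewrite -ball_normE /= ltr_pdivlMr// => lk.
  rewrite (le_trans (Hu _ _))// (le_trans _ (ltW lk))// mulrC ler_wpM2l//.
  by rewrite (le_trans (ler_norm _))// lerDl.
have sub z w : cRe (z - w) = cRe z - cRe w :> R /\ cIm (z - w) = cIm z - cIm w :> R.
  by case: z w => ? ? [].
split; apply: key => l' k' /=.
  by rewrite -(sub _ _).1 (le_trans (cabs_Re _)).
by rewrite -(sub _ _).2 (le_trans (cabs_Im _)).
Qed.

(** The transform is Lipschitz, with a constant given by the first moments of [f]. Continuity is
    what [test_in_detect] asks for to turn vanishing against test functions into pointwise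
    vanishing. *)
Lemma ccontinuous_ft f : rd f -> forall l, ccontinuous (ft f) l.
Proof.
move=> rf.
pose S x : R := \sum_(i < d) cabs (pos i f x).
have iS : mu.-integrable setT (EFin \o S).
  rewrite /S /comp; under eq_fun do rewrite -sumEFin.
  apply: integrable_sum => // i *; apply: (cintegrable_cabs (f := pos i f)).
  exact/rd_cintegrable/rd_pos.
have fi := rd_cintegrable rf.
(* One factor 2 comes from [wave_lipschitz], the other from [cabs_cint_le]. *)
apply: (@lipschitz_ccontinuous _ (4 * \int[mu]_x S x)) => l k.
have -> : ft f l - ft f k = cint mu (fun x => f x * wave l x + -1 * (f x * wave k x)).
  rewrite cintD ?cintZ ?mulN1r//; try exact: cintegrable_wave.
  exact/cintegrableZ/cintegrable_wave.
have iE : cintegrable mu (fun x => f x * wave l x + -1 * (f x * wave k x)).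
  by apply: cintegrableD; [|apply: cintegrableZ]; exact: cintegrable_wave.
have iw : mu.-integrable setT (EFin \o (fun x => (2 * `|l - k|) * S x)).
  exact: (integrableZl measurableT (2 * `|l - k|) iS).
apply: le_trans (cabs_cint_le iE iw _) _.
  move=> x; rewrite mulN1r -mulrBr cabsM.
  apply: le_trans (ler_wpM2l (cabs_ge0 _) (wave_lipschitz _ _ _)) _.
  rewrite le_eqVlt; apply/orP; left; apply/eqP.
  have -> : S x = (\sum_(i < d) `|x 0 i|) * cabs (f x); last by ring.
  by rewrite mulr_suml; apply: eq_bigr => i _; rewrite /pos cabsM cabs_real.
rewrite RintegralZl// le_eqVlt; apply/orP; left; apply/eqP.
by rewrite mulrA mulrCA; ring.
Qed.

End fourier_exchange.

(** * Bounding a function by the integral of its transform *)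

Section sup_bound.
Variables (R : realType) (d : nat).
Local Notation V := 'rV[R]_d.
Local Notation mu := (lebesgue_rV R d).
Implicit Types (x y l : V) (f g h : V -> R[i]).

Lemma ft_shift f x l : cintegrable mu f ->
  ft (fun y => f (y + x)) l = ft f l * wave (- x) l.
Proof.
move=> fi; have -> : ft f l = wave l x * ft (fun y => f (y + x)) l.
  rewrite [LHS]/ft -(cintegral_shift x (cintegrable_wave l fi)).
  rewrite -[RHS]cintZ; last exact/cintegrable_wave/cintegrable_shift.
  by apply: eq_cint => y; rewrite waveD; ring.
rewrite mulrAC (waveC (- x)) -waveD subrr /wave /dotp big1 ?oppr0.
  by rewrite /expi cos0 sin0 mul1r.
by move=> i _; rewrite mxE mulr0.
Qed.

Lemma Rintegral_sum (s : seq 'I_d) (K : 'I_d -> V -> R) :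
  (forall i, mu.-integrable setT (EFin \o K i)) ->
  mu.-integrable setT (fun x => (\sum_(i <- s) K i x)%:E) /\
  \int[mu]_x (\sum_(i <- s) K i x) = \sum_(i <- s) \int[mu]_x K i x.
Proof.
move=> iK; elim: s => [|i s [IH1 IH2]].
  split; first by under eq_fun do rewrite big_nil; exact: integrable0.
  under eq_Rintegral do rewrite big_nil.
  by rewrite big_nil /Rintegral integral0.
have E : (fun x => \sum_(j <- i :: s) K j x) = fun x => K i x + \sum_(j <- s) K j x.
  by apply/funext => x; rewrite big_cons.
split.
  rewrite (_ : (fun x => _) = (EFin \o K i) \+ (fun x => (\sum_(j <- s) K j x)%:E))%E.
    exact: integrableD.
  by apply/funext => x /=; rewrite big_cons.
by rewrite E RintegralD// IH2 big_cons.
Qed.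

Lemma cabs_ft_le f (C : R) l : cmeasurable f -> (forall x, cabs (f x) <= C * weight x) ->
  cabs (ft f l) <= 2 * (C * \int[mu]_x weight x).
Proof.
move=> mf fC; rewrite -RintegralZl//; last exact: integrable_weight.
apply: cabs_cint_le.
- exact/cintegrable_wave/(cintegrable_weight mf fC).
- exact: integrable_weightZ.
- by move=> x; rewrite cabsM cabs_wave mulr1.
Qed.

Lemma cabs_poss_ft f J l : rd f -> cabs (poss J (ft f) l) = cabs (ft (partials J f) l).
Proof.
move=> rf; elim: J => [//|j J IH].
rewrite [partials _ _]/= ft_partial; last exact: rd_partials.
rewrite [poss _ _]/= /pos !cabsM -/(poss J (ft f)) IH.
by rewrite [cabs 'i%C]/= expr0n expr1n add0r sqrtr1 mulr1.
Qed.

Lemma rapid_ft f : rd f -> rapid (ft f).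
Proof.
move=> rf J; have rp := rd_partials J rf.
have [C [_ HC]] := rapid_weight (rd_rapid rp).
exists (2 * (C * \int[mu]_x weight x)) => l; rewrite cabs_poss_ft//.
exact: cabs_ft_le (regular_cmeasurable (rd_regular rp)) HC.
Qed.

Lemma ccontinuous_cmeasurable g : (forall x, ccontinuous g x) -> cmeasurable g.
Proof. by move=> c; split; apply: continuous_rV_measurable => x; have [] := c x. Qed.

Lemma cintegrable_ft f : rd f -> cintegrable mu (ft f).
Proof.
move=> rf; have [C [_ HC]] := rapid_weight (rapid_ft rf).
exact: cintegrable_weight (ccontinuous_cmeasurable (ccontinuous_ft rf)) HC.
Qed.

(** Each coordinate has its own width because [poisson_kernel_concentration] changes the width in
    one coordinate only. *)
Definition poisson_kernel (e : 'I_d -> R) x : R := \prod_(i < d) poisson (e i) (x 0 i).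

Lemma poisson_kernel_ge0 e x : (forall i, 0 < e i) -> 0 <= poisson_kernel e x.
Proof. by move=> e0; apply: prodr_ge0 => i _; exact: poisson_ge0. Qed.

Lemma integrable_poisson_kernel e : (forall i, 0 < e i) ->
  mu.-integrable setT (EFin \o poisson_kernel e).
Proof.
by move=> e0; have [] := @Rintegral_rV_prod R d (fun i => poisson (e i))
  (fun i => integrable_poisson (e0 i)).
Qed.

Lemma Rintegral_poisson_kernel e : (forall i, 0 < e i) ->
  \int[mu]_x poisson_kernel e x = pi ^+ d.
Proof.
move=> e0; have [_ ->] := @Rintegral_rV_prod R d (fun i => poisson (e i))
  (fun i => integrable_poisson (e0 i)).
under eq_bigr do rewrite Rintegral_poisson//.
by rewrite big_const iter_mulr_1 card_ord.
Qed.

Definition damping (a : R) l : R := \prod_(i < d) damp a (l 0 i).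

Lemma damp_gt0 (a t : R) : 0 < damp a t. Proof. exact: expR_gt0. Qed.

Lemma damping_ge0 a l : 0 <= damping a l.
Proof. by apply: prodr_ge0 => i _; exact/ltW/damp_gt0. Qed.

Lemma damping_le1 a l : 0 < a -> damping a l <= 1.
Proof.
move=> a0; apply: prodr_ile1 => i _; rewrite ltW ?damp_gt0//=.
by rewrite -expR0 ler_expR oppr_le0 mulr_ge0// ltW.
Qed.

Lemma cintegrable_damping a : 0 < a -> cintegrable mu (fun l => (damping a l)%:C).
Proof.
move=> a0; have [i1 _] := @Rintegral_rV_prod R d (fun=> damp a) (fun=> integrable_damp a0).
by split; [exact: i1|exact: integrable0].
Qed.

(* The Fourier transform of [exp(-a (|l_1| + ... + |l_d|))] is a multiple of the
   Poisson kernel. *)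
Lemma ft_damping a x : 0 < a ->
  ft (fun l => (damping a l)%:C) x = (2 ^+ d * poisson_kernel (fun=> a) x)%:C.
Proof.
move=> a0.
have expi_sum (s : seq 'I_d) (u : 'I_d -> R) : expi (\sum_(i <- s) u i) = \prod_(i <- s) expi (u i).
  elim: s => [|i s IH]; last by rewrite !big_cons expiD IH.
  by rewrite !big_nil /expi cos0 sin0.
have [_] := @cint_rV_prod R d (fun i t => (damp a t)%:C * expi (- (t * x 0 i)))
   (fun i => (cint_damp (x 0 i) a0).1).
rewrite (_ : (fun l : V => _) = fun l => (damping a l)%:C * wave x l); last first.
  apply/funext => l; rewrite big_split /damping rmorph_prod; congr (_ * _).
  rewrite /wave /dotp -sumrN expi_sum; apply: eq_bigr => i _.
  by rewrite mulrC.
rewrite /ft => ->; under eq_bigr do rewrite (cint_damp _ a0).2.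
by rewrite -rmorph_prod big_split /= big_const iter_mulr_1 card_ord.
Qed.

(** Near 0 the increment is at most [e] by continuity. Elsewhere some [|x_i| >= r], the sum is at
    least [q = r ^ 2 / (1 + r ^ 2)], and [C = 2 B / q] covers the trivial bound [2 B]. The quotients
    [t ^ 2 / (1 + t ^ 2)] are the ones that the Poisson kernel can absorb. *)
Lemma increment_bound g (B e : R) : ccontinuous g 0 -> (forall x, cabs (g x) <= B) -> 0 < e ->
  exists2 C : R, 0 <= C & forall x,
    cabs (g x - g 0) <= e + C * \sum_(i < d) (x 0 i) ^+ 2 / (1 + (x 0 i) ^+ 2).
Proof.
move=> [c1 c2] gB e0.
have e20 : 0 < e / 2 by rewrite divr_gt0.
have /(@nbhs_ballP _ V)[r1/= r10 H1] : \forall y \near (0 : V), `|cRe (g 0) - cRe (g y)| < e / 2.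
  by have /cvgrPdist_lt/(_ _ e20) := c1.
have /(@nbhs_ballP _ V)[r2/= r20 H2] : \forall y \near (0 : V), `|cIm (g 0) - cIm (g y)| < e / 2.
  by have /cvgrPdist_lt/(_ _ e20) := c2.
pose r := Num.min r1 r2; have r0 : 0 < r by rewrite lt_min r10.
pose q := r ^+ 2 / (1 + r ^+ 2).
have q0 : 0 < q by rewrite divr_gt0 ?exprn_gt0// ltr_pwDl ?sqr_ge0.
have B0 : 0 <= B by rewrite (le_trans (cabs_ge0 _) (gB 0)).
have t0 (t : R) : 0 <= t ^+ 2 / (1 + t ^+ 2) by rewrite divr_ge0 ?addr_ge0 ?sqr_ge0.
have s0 x : 0 <= \sum_(i < d) (x 0 i) ^+ 2 / (1 + (x 0 i) ^+ 2) by exact: sumr_ge0.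
have C0 : 0 <= 2 * B / q by apply: divr_ge0; [rewrite mulr_ge0|exact: ltW].
exists (2 * B / q) => // x.
have [/existsP[i xi]|/existsPn H] := boolP [exists i, r <= `|x 0 i|].
  apply: (@le_trans _ _ (2 * B / q * q)).
    rewrite divfK ?gt_eqF// (le_trans (cabsD _ _))// cabsN mulr_natl mulr2n lerD//.
  apply: ler_wpDl; first exact: ltW.
  rewrite ler_wpM2l// (bigD1 i)//= ler_wpDr//; first exact: sumr_ge0.
  have p1 (s : R) : 0 < 1 + s ^+ 2 by rewrite ltr_pwDl ?sqr_ge0.
  rewrite /q ler_pdivrMr// mulrAC ler_pdivlMr// -subr_ge0.
  rewrite (_ : _ - _ = x 0 i ^+ 2 - r ^+ 2); last by ring.
  by rewrite subr_ge0 -[leRHS]real_normK ?num_real// ler_pXn2r ?nnegrE// ltW.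
have xr : `|x| < r by apply: rV_norm_lt => // i; rewrite ltNge H.
apply: (@le_trans _ _ e); last by rewrite ler_wpDr// mulr_ge0.
have xb r' : r <= r' -> ball (0 : V) r' x.
  by move=> rr; rewrite -ball_normE /= sub0r normrN (lt_le_trans xr).
have h1 := H1 x (xb r1 _); have h2 := H2 x (xb r2 _).
rewrite (le_trans (cabs_ReIm _))// [leRHS]splitr ltW// ltrD//.
  rewrite distrC in h1; move: h1; rewrite /r ge_min lexx => /(_ isT).
  by case: (g x) (g 0) => ? ? [].
rewrite distrC in h2; move: h2; rewrite /r ge_min lexx orbT => /(_ isT).
by case: (g x) (g 0) => ? ? [].
Qed.

(** Because [t ^ 2 / (a ^ 2 + t ^ 2) <= 1], the quotient trades the width [a] in coordinate i for
    the width 1 at the price of a factor [a]. The integral of the right-hand side is thus of order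
    [a], which expresses concentration at 0. *)
Lemma poisson_kernel_concentration (a : R) x i : 0 < a ->
  poisson_kernel (fun=> a) x * ((x 0 i) ^+ 2 / (1 + (x 0 i) ^+ 2)) <=
  a * poisson_kernel (fun k => if k == i then 1 else a) x.
Proof.
move=> a0; rewrite /poisson_kernel (bigD1 i)//= [in leRHS](bigD1 i)//= eqxx.
have -> : \prod_(k < d | k != i) poisson (if k == i then 1 else a) (x 0 k) =
          \prod_(k < d | k != i) poisson a (x 0 k).
  by apply: eq_bigr => k /negPf ->.
rewrite mulrAC [leRHS]mulrA ler_wpM2r//.
  by apply: prodr_ge0 => k _; exact: poisson_ge0.
rewrite poisson1E /poisson; set t := x 0 i.
have h1 : 0 < 1 + t ^+ 2 by rewrite ltr_pwDl ?sqr_ge0.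
have h2 := poisson_den_gt0 t a0.
rewrite mulrA ler_pM2r ?invr_gt0// mulrAC ler_pdivrMr//.
by rewrite ler_wpM2l ?(ltW a0)// lerDr sqr_ge0.
Qed.

(** By [ft_exchange] with [damping a], the integral of [ft g * damping a] equals that of [g] against
    [2 ^ d] times the Poisson kernel of width [a]. The former is bounded since the damping is at
    most 1; the latter is [(2 pi) ^ d * g 0] up to an error below [eps] for suitable [a]. *)
Lemma ft_bound0 g (B : R) : ccontinuous g 0 -> (forall x, cabs (g x) <= B) ->
  cintegrable mu g -> cintegrable mu (ft g) ->
  (2 * pi) ^+ d * cabs (g 0) <= 2 * \int[mu]_l cabs (ft g l).
Proof.
move=> cg gB ig ifg; apply/ler_addgt0Pr => eps eps0.
have pd : 0 < (pi : R) ^+ d by rewrite exprn_gt0// pi_gt0.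
have cd : 0 < (2 : R) ^+ d by rewrite exprn_gt0.
(* The error is at most twice [2 ^ d * (eta pi ^ d + eta pi ^ d)], which is [eps]. *)
pose eta := eps / (4 * (2 ^+ d * pi ^+ d)).
have eta0 : 0 < eta by rewrite divr_gt0// !mulr_gt0.
have [C C0 HC] := increment_bound cg gB eta0.
(* Chosen so that [C a d <= eta]; the summand 1 keeps the denominator positive when [C d = 0]. *)
pose a := eta / (C * d%:R + 1).
have den : 0 < C * d%:R + 1 by rewrite ltr_wpDl// mulr_ge0.
have a0 : 0 < a by rewrite divr_gt0.
have Ca : C * (a * d%:R) <= eta.
  have -> : C * (a * d%:R) = eta * (C * d%:R) / (C * d%:R + 1) by rewrite /a; ring.
  by rewrite ler_pdivrMr// ler_wpM2l ?(ltW eta0)// lerDl.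
pose K := poisson_kernel (fun=> a).
pose K' i := poisson_kernel (fun k => if k == i then 1 else a).
have iK : mu.-integrable setT (EFin \o K) by exact: integrable_poisson_kernel.
have e0' i k : 0 < (if k == i then 1 else a) by case: ifP.
have iK' i : mu.-integrable setT (EFin \o K' i) by exact: integrable_poisson_kernel.
have K0 x : 0 <= K x by exact: poisson_kernel_ge0.
pose S x := \sum_(i < d) K' i x.
have [iS SE] := Rintegral_sum (index_enum 'I_d) iK'.
have {}SE : \int[mu]_x S x = d%:R * pi ^+ d.
  rewrite /S SE; under eq_bigr do rewrite Rintegral_poisson_kernel//.
  by rewrite sumr_const card_ord mulr_natl.
pose maj x : R := 2 ^+ d * (eta * K x + C * (a * S x)).
have i1 := integrableZl measurableT eta iK.
have i2 := integrableZl measurableT a iS.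
have i3 := integrableZl measurableT C i2.
have i4 := integrableD measurableT i1 i3.
have imaj : mu.-integrable setT (EFin \o maj) := integrableZl measurableT (2 ^+ d) i4.
have majE : \int[mu]_x maj x = 2 ^+ d * (eta * pi ^+ d + C * (a * (d%:R * pi ^+ d))).
  rewrite /maj (RintegralZl _ measurableT i4) (RintegralD _ i1 i3)//.
  rewrite (RintegralZl _ measurableT iK) (RintegralZl _ measurableT i2).
  by rewrite (RintegralZl _ measurableT iS) -/S SE Rintegral_poisson_kernel.
have diffb x : cabs ((g x - g 0) * (2 ^+ d * K x)%:C) <= maj x.
  rewrite cabsM cabs_real ger0_norm; last by rewrite mulr_ge0// ltW.
  rewrite mulrCA ler_pM2l//.
  apply: (le_trans (ler_wpM2r (K0 x) (HC x))).
  rewrite mulrDl lerD// -mulrA ler_wpM2l// mulr_suml /S mulr_sumr ler_sum// => i _.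
  by rewrite mulrC; exact: poisson_kernel_concentration.
have iKc : cintegrable mu (fun x => (2 ^+ d * K x)%:C).
  by split; [exact: (integrableZl measurableT (2 ^+ d) iK)|exact: integrable0].
have idiff : cintegrable mu (fun x => (g x - g 0) * (2 ^+ d * K x)%:C).
  apply: (cintegrable_le _ imaj diffb); apply: cmeasurableM.
    by apply: cmeasurableD; [exact: cintegrable_measurable ig|exact: cmeasurable_cst].
  exact: cintegrable_measurable iKc.
have ex := ft_exchange ig (cintegrable_damping a0).
have E : cintegral (fun x => g x * ft (fun l => (damping a l)%:C) x) =
  g 0 * ((2 * pi) ^+ d)%:C + cint mu (fun x => (g x - g 0) * (2 ^+ d * K x)%:C).
  have -> : ((2 * pi) ^+ d)%:C = cint mu (fun x => (2 ^+ d * K x)%:C).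
    by rewrite cint_real (RintegralZl _ measurableT iK) Rintegral_poisson_kernel// exprMn.
  rewrite -cintZ// -cintD//; last exact: cintegrableZ.
  by apply: eq_cint => x; rewrite ft_damping// -mulrDl addrC subrK.
rewrite E in ex.
have q0 : 0 <= (2 * pi : R) ^+ d by rewrite exprn_ge0// mulr_ge0// pi_ge0.
have -> : (2 * pi) ^+ d * cabs (g 0) = cabs (g 0 * ((2 * pi) ^+ d)%:C).
  by rewrite cabsM cabs_real (ger0_norm q0) mulrC.
have -> : g 0 * ((2 * pi) ^+ d)%:C = cintegral (fun l => ft g l * (damping a l)%:C) -
   cint mu (fun x => (g x - g 0) * (2 ^+ d * K x)%:C) by rewrite ex addrK.
rewrite (le_trans (cabsD _ _))// cabsN lerD//.
  have hb l : cabs (ft g l * (damping a l)%:C) <= cabs (ft g l).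
    rewrite cabsM cabs_real ger0_norm ?damping_ge0// ler_piMr ?cabs_ge0//.
    exact: damping_le1.
  have ic := cintegrable_cabs ifg.
  apply: (cabs_cint_le _ ic hb).
  apply: (cintegrable_le _ ic hb); apply: cmeasurableM.
    exact: cintegrable_measurable ifg.
  exact: cintegrable_measurable (cintegrable_damping a0).
apply: (le_trans (cabs_cint_le idiff imaj diffb)).
rewrite majE.
have -> : eps = 2 * (2 ^+ d * (eta * pi ^+ d + eta * pi ^+ d)).
  by rewrite /eta; field; rewrite !gt_eqF.
rewrite ler_pM2l// ler_pM2l// lerD2l.
rewrite (_ : C * _ = C * (a * d%:R) * pi ^+ d); last by ring.
by rewrite ler_pM2r.
Qed.

(** Translating by [x] multiplies the transform by a factor of modulus 1, so the bound at 0 gives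
    the bound at [x]. *)
Lemma ft_bound f x : rd f ->
  (2 * pi) ^+ d * cabs (f x) <= 2 * \int[mu]_l cabs (ft f l).
Proof.
move=> rf; have fi := rd_cintegrable rf.
have [C [C0 HC]] := rapid_weight (rd_rapid rf).
pose g y := f (y + x).
have Eg : ft g = fun l => ft f l * wave (- x) l.
  by apply/funext => l; exact: ft_shift.
have E : (fun l => cabs (ft g l)) = (fun l => cabs (ft f l)).
  by apply/funext => l; rewrite Eg cabsM cabs_wave mulr1.
have := @ft_bound0 g C; rewrite /g add0r -/g E; apply.
- have cs : {for (0 : V), continuous (fun y : V => y + x)}.
    by apply: (@continuousD _ _ _ id (fun=> x)); [exact: cvg_id|exact: cst_continuous].
  have [c1 c2] := (rd_regular rf).1 (0 + x).
  by split; [exact: (continuous_comp cs c1)|exact: (continuous_comp cs c2)].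
- by move=> y; rewrite (le_trans (HC _))// ler_piMr//; exact: weight_le1.
- exact: cintegrable_shift.
- by rewrite Eg; exact/cintegrable_wave/cintegrable_ft.
Qed.

End sup_bound.

(** * Test functions and their supports *)

Section test_functions.
Variables (R : realType) (d : nat).
Local Notation V := 'rV[R]_d.
Local Notation mu := (lebesgue_rV R d).
Implicit Types (x y l : V) (f g phi : V -> R[i]).

Lemma closed_fun_supp f : closed (fun_supp f). Proof. exact: closed_closure. Qed.

Lemma fun_supp_neq0 f x : f x != 0 -> fun_supp f x.
Proof. by move=> fx; exact: subset_closure. Qed.

Lemma fun_supp_near0 f x : ~ fun_supp f x -> {near x, f =1 fun=> 0}.
Proof.
move=> nx; have : nbhs x (~` fun_supp f).
  by apply: open_nbhs_nbhs; split => //; exact: (closed_openC (@closed_fun_supp f)).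
apply: filterS => y ny; apply/eqP; apply/negPn/negP => fy.
by apply: ny; exact: fun_supp_neq0.
Qed.

Lemma fun_supp_sub f g : (forall x, ~ fun_supp f x -> g x = 0) -> fun_supp g `<=` fun_supp f.
Proof.
move=> H; have E : [set x | g x != 0] `<=` fun_supp f.
  by move=> x /= /eqP gx; apply: contrapT => /H.
have cE : fun_supp f = closure (fun_supp f) by exact: ((closure_id _).1 (@closed_fun_supp f)).
by rewrite cE; exact: (closure_subset E).
Qed.

Lemma fun_supp_partial i f : fun_supp (partial i f) `<=` fun_supp f.
Proof.
apply: fun_supp_sub => x /fun_supp_near0 f0; apply: has_partialE.
apply: (near_eq_has_partial _ (has_partial_cst x i 0)).
by apply: filterS f0 => y ->.
Qed.

Lemma fun_supp_partials s f : fun_supp (partials s f) `<=` fun_supp f.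
Proof.
elim: s => [|i s IH]; first by [].
by apply: subset_trans IH; exact: fun_supp_partial.
Qed.

Lemma test_function_sub phi g : test_function phi -> smooth g ->
  (forall x, ~ fun_supp phi x -> g x = 0) -> test_function g /\ fun_supp g `<=` fun_supp phi.
Proof.
move=> [_ cp] sg H; have sub := fun_supp_sub H; split => //; split => //.
exact: subclosed_compact (@closed_fun_supp g) cp sub.
Qed.

Lemma compact_support_bounded g : (forall x, ccontinuous g x) -> compact (fun_supp g) ->
  exists C : R, forall x, cabs (g x) <= C.
Proof.
move=> cg ck.
have key (u : V -> R) : continuous u -> (forall x, ~ fun_supp g x -> u x = 0) ->
    exists C : R, forall x, `|u x| <= C.
  move=> cu u0; have [[x0 gx0]|/nonemptyPn g0] := pselect (fun_supp g !=set0).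
    have cn : {within fun_supp g, continuous (fun x => `|u x|)}.
      apply: continuous_subspaceT => x; apply: continuous_comp; first exact: cu.
      exact: norm_continuous.
    have [c _ Hc] := @EVT_max_rV R d (fun x => `|u x|) (fun_supp g) (ex_intro _ x0 gx0) ck cn.
    exists `|u c| => x; have [gx|ngx] := pselect (fun_supp g x).
      by apply: Hc; rewrite inE.
    by rewrite u0// normr0.
  by exists 0 => x; rewrite u0 ?normr0// g0.
have g0 x : ~ fun_supp g x -> g x = 0 by move=> /fun_supp_near0/nbhs_singleton.
have [|x /g0 /= -> //|C1 H1] := key (cRe \o g); first by move=> x; exact: (cg x).1.
have [|x /g0 /= -> //|C2 H2] := key (cIm \o g); first by move=> x; exact: (cg x).2.
by exists (C1 + C2) => x; rewrite (le_trans (cabs_ReIm _))// lerD//; [exact: H1|exact: H2].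
Qed.

Lemma compact_support_rapid g : (forall x, ccontinuous g x) -> compact (fun_supp g) -> rapid g.
Proof.
move=> cg ck J; apply: compact_support_bounded.
  by elim: J => [//|j J IH] x; apply: ccontinuousM => //; exact: ccontinuous_coord.
apply: (subclosed_compact (@closed_fun_supp _) ck); apply: fun_supp_sub => x.
by move=> /fun_supp_near0/nbhs_singleton gx; rewrite possE gx mulr0.
Qed.

Lemma test_function_rd phi : test_function phi -> rd phi.
Proof.
move=> [sp cp]; split => // s; apply: compact_support_rapid.
  by have [] := (smoothP phi).1 sp s.
exact: subclosed_compact (@closed_fun_supp _) cp (@fun_supp_partials s phi).
Qed.

Definition test_in (U : set V) phi := test_function phi /\ fun_supp phi `<=` U.

Lemma test_in_sub U phi g : test_in U phi -> smooth g ->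
  (forall x, ~ fun_supp phi x -> g x = 0) -> test_in U g.
Proof.
by move=> [tp pU] sg /(test_function_sub tp sg)[tg gp]; split => //; exact: subset_trans pU.
Qed.

Lemma fun_supp0 phi x : ~ fun_supp phi x -> phi x = 0.
Proof. by move=> /fun_supp_near0/nbhs_singleton. Qed.

Lemma test_in_rd U phi : test_in U phi -> rd phi.
Proof. by move=> [/test_function_rd]. Qed.

Lemma test_in_partial U phi i : test_in U phi -> test_in U (partial i phi).
Proof.
move=> tp; apply: (test_in_sub tp); first exact/rd_smooth/rd_partial/test_in_rd/tp.
move=> x nx; apply: contrapT => /eqP px; apply: nx.
exact/(@fun_supp_partial i)/fun_supp_neq0.
Qed.

Lemma test_in_pos U phi j : test_in U phi -> test_in U (pos j phi).
Proof.
move=> tp; apply: (test_in_sub tp); first exact/rd_smooth/rd_pos/test_in_rd/tp.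
by move=> x /fun_supp0 px; rewrite /pos px mulr0.
Qed.

Lemma test_inZ U phi z : test_in U phi -> test_in U (fun x => z * phi x).
Proof.
move=> tp; apply: (test_in_sub tp); first exact/rd_smooth/rdZ/test_in_rd/tp.
by move=> x /fun_supp0 px; rewrite px mulr0.
Qed.

Lemma fun_suppD f g : fun_supp (fun x => f x + g x) `<=` fun_supp f `|` fun_supp g.
Proof.
rewrite /fun_supp -closureU; apply: closure_subset => x /=.
have [->|fx] := eqVneq (f x) 0; last by left.
by rewrite add0r; right.
Qed.

Lemma test_inD U phi psi : test_in U phi -> test_in U psi ->
  test_in U (fun x => phi x + psi x).
Proof.
move=> tp tq; have [[_ cp] pU] := tp; have [[_ cq] qU] := tq.
have sub := @fun_suppD phi psi.
split; last by apply: (subset_trans sub) => x [/pU|/qU].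
split; first by apply/rd_smooth/rdD; [exact: test_in_rd tp|exact: test_in_rd tq].
exact: subclosed_compact (@closed_fun_supp _) (compactU cp cq) sub.
Qed.

End test_functions.

(** * Functions that are flat at a boundary point *)

Section flat_functions.
Variable R : realType.
Implicit Types (Q : {poly R}) (t : R).

(** Polynomials in [1 / t] times the classical function [exp (- 1 / t)]: a family closed under
    derivation. *)
Definition flat Q t : R := if 0 < t then Q.[t^-1] * expR (- t^-1) else 0.

(** For positive n, [expR s = expR (s / n) ^ n >= (s / n) ^ n]. *)
Lemma expr_expR_le n (s : R) : 0 <= s -> s ^+ n <= n%:R ^+ n * expR s.
Proof.
case: n => [|n] s0; first by rewrite !expr0 mul1r -expR0 ler_expR.
have n0 : (n.+1%:R : R) != 0 by rewrite pnatr_eq0.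
have -> : expR s = expR (s / n.+1%:R) ^+ n.+1.
  by rewrite -expRM_natl mulrC divfK.
rewrite -exprMn ler_pXn2r// ?nnegrE ?mulr_ge0 ?expR_ge0//.
rewrite -ler_pdivrMl ?ltr0n// mulrC (le_trans _ (expR_ge1Dx _))//.
by rewrite lerDr.
Qed.

Lemma flat_bounded Q : exists2 C : R, 0 <= C & forall t, 0 < t -> `|flat Q t| <= C.
Proof.
elim/poly_ind: Q => [|Q c [C C0 HC]].
  by exists 0 => // t t0; rewrite /flat t0 horner0 mul0r normr0.
suff [D D0 HD] : exists2 D : R, 0 <= D & forall t, 0 < t -> `|flat (Q * 'X) t| <= D.
  exists (D + `|c|) => [|t t0]; first by rewrite addr_ge0.
  have := HD t t0; rewrite /flat t0 hornerD hornerC mulrDl => h.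
  rewrite (le_trans (ler_normD _ _))// lerD// normrM ler_piMr// ger0_norm ?expR_ge0//.
  by rewrite -expR0 ler_expR oppr_le0 invr_ge0 ltW.
exists (\sum_(i < size (Q * 'X)) `|(Q * 'X)`_i| * i%:R ^+ i).
  by apply: sumr_ge0 => i _; rewrite mulr_ge0// exprn_ge0.
move=> t t0; rewrite /flat t0 horner_coef mulr_suml (le_trans (ler_norm_sum _ _ _))//.
apply: ler_sum => i _; rewrite -mulrA normrM ler_wpM2l//.
rewrite normrM !ger0_norm ?expR_ge0 ?exprn_ge0 ?invr_ge0 ?(ltW t0)//.
by rewrite expRN ler_pdivrMr ?expR_gt0// expr_expR_le// invr_ge0 ltW.
Qed.

(** The polynomial [X ^ 2 (Q - Q')] is the product rule after the substitution [1 / t]. At 0 the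
    right difference quotient is [h] times [flat (X ^ 2 Q) h], which is bounded, and the left one is
    0. *)
Lemma is_derive_flat Q t : is_derive t 1 (flat Q) (flat ('X^2 * (Q - Q^`())) t).
Proof.
have [t0|t0|<-] := ltgtP 0 t.
- have dV : is_derive t 1 (fun s : R => s^-1) (- t ^- 2).
    have tn : t != 0 by rewrite gt_eqF.
    have di := is_derive_id t (1 : R).
    split; first exact: derivableV.
    by rewrite (@deriveV _ _ id)// derive_id /GRing.scale/= mulr1.
  have d1 := @is_derive1_comp _ (horner Q) (fun s => s^-1) t _ _ (is_derive_poly Q t^-1) dV.
  have d2 := @is_derive1_comp _ expR (fun s => - s^-1) t _ _ (is_derive_expR (- t^-1)) (is_deriveN dV).
  have d3 := is_deriveM d1 d2.
  apply: (@near_eq_is_derive _ _ _ ((horner Q \o (fun s => s^-1)) * (expR \o (fun s => - s^-1)))).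
  + have := lt_nbhsr t0; apply: filterS => s s0.
    by rewrite /flat s0.
  + apply: (is_derive_eq d3).
    rewrite /flat t0 /GRing.scale/= !hornerE /=.
    by rewrite -exprVn; ring.
- apply: (@near_eq_is_derive _ _ _ (fun=> 0)).
  + have := lt_nbhsl t0; apply: filterS => s s0.
    by rewrite /flat ltNge (ltW s0).
  + by rewrite /flat ltNge (ltW t0)/=; exact: is_derive_cst.
- rewrite {2}/flat ltxx.
  have [C C0 HC] := flat_bounded ('X^2 * Q).
  have key : (fun h : R => h^-1 *: ((flat Q \o shift 0) (h *: 1) - flat Q 0)) @ 0^' --> (0 : R).
    apply/cvgr0Pnorm_le => e e0.
    have C1 : 0 < C + 1 by rewrite ltr_wpDl.
    rewrite near_withinE; near=> h => h0 /=.
    rewrite addr0 [h%:A]mulr1 {2}/flat ltxx subr0.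
    have [hp|] := ltP 0 h; last first.
      by move=> hn; rewrite /flat ltNge hn/= scaler0 normr0 ltW.
    have := HC h hp; rewrite /flat hp !hornerE /= => H.
    rewrite (_ : h^-1 *: _ = h * (h^-1 ^+ 2 * Q.[h^-1] * expR (- h^-1))); last first.
      by rewrite /GRing.scale/=; field.
    rewrite normrM; apply: (@le_trans _ _ (e / (C + 1) * C)).
      apply: ler_pM => //.
      near: h; apply: (@nbhs0_le _ R); exact: divr_gt0.
    rewrite mulrAC ler_pdivrMr// ler_wpM2l ?(ltW e0)// lerDl //.
  split; first by apply/cvg_ex; exists 0.
  exact/cvg_lim.
Unshelve. all: by end_near. Qed.

Lemma flat1_gt0 t : 0 < t -> 0 < flat 1 t.
Proof. by move=> t0; rewrite /flat t0 hornerC mul1r expR_gt0. Qed.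

Lemma flat1_ge0 t : 0 <= flat 1 t.
Proof. by rewrite /flat; case: ifP => // _; rewrite hornerC mul1r expR_ge0. Qed.

Lemma flat_le0 Q t : t <= 0 -> flat Q t = 0.
Proof. by rewrite leNgt /flat => /negbTE ->. Qed.

(* All derivatives of [t |-> flat 1 (t - a) * flat 1 (b - t)] are combinations
   of functions of this shape. *)
Definition flat2 (a b : R) (q : {poly R} * {poly R}) t : R :=
  flat q.1 (t - a) * flat q.2 (b - t).

Lemma is_derive_flat2 a b q t : is_derive t 1 (flat2 a b q)
  (flat2 a b ('X^2 * (q.1 - q.1^`()), q.2) t +
   flat2 a b (q.1, - 'X^2 * (q.2 - q.2^`())) t).
Proof.
have da : is_derive t 1 (fun s : R => s - a) 1.
  by apply: is_derive_eq; rewrite subr0.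
have db : is_derive t 1 (fun s : R => b - s) (-1).
  by apply: (is_derive_eq (is_deriveB (is_derive_cst b t 1) (is_derive_id t 1))); rewrite sub0r.
have d1 := @is_derive1_comp _ (flat q.1) (fun s => s - a) t _ _ (is_derive_flat q.1 (t - a)) da.
have d2 := @is_derive1_comp _ (flat q.2) (fun s => b - s) t _ _ (is_derive_flat q.2 (b - t)) db.
rewrite (_ : flat2 a b q = (flat q.1 \o (fun s => s - a)) * (flat q.2 \o (fun s => b - s)))//.
apply: (is_derive_eq (is_deriveM d1 d2)); rewrite /flat2 /GRing.scale/=.
rewrite (_ : flat (- 'X^2 * _) (b - t) = - flat ('X^2 * (q.2 - q.2^`())) (b - t)).
  by ring.
by rewrite /flat; case: ifP => _; rewrite ?oppr0// mulNr hornerN mulNr.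
Qed.

Lemma continuous_flat2 a b q : continuous (flat2 a b q).
Proof.
move=> t; apply: differentiable_continuous; apply/derivable1_diffP.
exact: (@ex_derive _ _ _ _ _ _ _ (is_derive_flat2 a b q t)).
Qed.

End flat_functions.

(** * Bump functions on boxes *)

Section bump.
Variables (R : realType) (d : nat) (a b : 'I_d -> R).
Local Notation V := 'rV[R]_d.
Implicit Types (x : V) (f : V -> R[i]) (q : 'I_d -> {poly R} * {poly R}).

Definition bump q x : R := \prod_(i < d) flat2 (a i) (b i) (q i) (x 0 i).

(** A partial derivative of a bump is a sum of two bumps, signs and coefficients being absorbed by
    the polynomials; sums of bumps therefore form a stable class for [smooth_coind]. *)
Inductive bump_span : (V -> R[i]) -> Prop :=
| bump_span_bump q : bump_span (fun x => (bump q x)%:C)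
| bump_spanD f g : bump_span f -> bump_span g -> bump_span (fun x => f x + g x).

Definition set_at q i (r : {poly R} * {poly R}) : 'I_d -> {poly R} * {poly R} :=
  fun k => if k == i then r else q k.

Lemma bump_set_at q i r x : bump (set_at q i r) x =
  flat2 (a i) (b i) r (x 0 i) * \prod_(k < d | k != i) flat2 (a k) (b k) (q k) (x 0 k).
Proof.
rewrite /bump (bigD1 i)//= /set_at eqxx; congr (_ * _).
by apply: eq_bigr => k /negPf ->.
Qed.

Lemma is_derive_bump q i x : is_derive x (basis_vector R i) (bump q)
  (bump (set_at q i ('X^2 * ((q i).1 - (q i).1^`()), (q i).2)) x +
   bump (set_at q i ((q i).1, - 'X^2 * ((q i).2 - (q i).2^`()))) x).
Proof.
pose G (y : V) := \prod_(k < d | k != i) flat2 (a k) (b k) (q k) (y 0 k).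
have dG : is_derive x (basis_vector R i) G 0.
  have E : (fun h : R => h^-1 *: ((G \o shift x) (h *: basis_vector R i) - G x)) = fun=> 0.
    apply/funext => h /=; rewrite (_ : G _ = G x) ?subrr ?scaler0//.
    by apply: eq_bigr => k ki; rewrite !mxE (negPf ki) andbF mulr0 add0r.
  split; first by rewrite /derivable E; exact: is_cvg_cst.
  by rewrite /derive E; apply/cvg_lim => //; exact: cvg_cst.
have [dc _] := has_partial_coord x i i.
have dF := @is_derive_comp_line _ _ (flat2 (a i) (b i) (q i)) (fun y : V => y 0 i) x _ _ _
   (is_derive_flat2 (a i) (b i) (q i) (x 0 i)) dc.
rewrite (_ : bump q = (flat2 (a i) (b i) (q i) \o (fun y : V => y 0 i)) * G); last first.
  by apply/funext => y; rewrite /bump (bigD1 i).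
apply: (is_derive_eq (is_deriveM dF dG)).
rewrite !bump_set_at -/(G x) /GRing.scale/= eqxx /=; ring.
Qed.

Lemma continuous_bump q : continuous (bump q).
Proof.
move=> x; rewrite /bump; elim: (index_enum _) => [|i s IH].
  rewrite (_ : (fun y => _) = fun=> 1); first exact: cst_continuous.
  by apply/funext => y; rewrite big_nil.
rewrite (_ : (fun y => _) = (fun y : V => flat2 (a i) (b i) (q i) (y 0 i)) \*
   (fun y : V => \prod_(j <- s) flat2 (a j) (b j) (q j) (y 0 j))); last first.
  by apply/funext => y; rewrite big_cons.
apply: continuousM; last exact: IH.
by apply: continuous_comp; [exact: coord_continuous|exact: continuous_flat2].
Qed.

Lemma has_partial_bump q i x : has_partial (fun y => (bump q y)%:C) x i
  ((bump (set_at q i ('X^2 * ((q i).1 - (q i).1^`()), (q i).2)) x)%:C +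
   (bump (set_at q i ((q i).1, - 'X^2 * ((q i).2 - (q i).2^`()))) x)%:C).
Proof.
rewrite -rmorphD; split; first exact: is_derive_bump.
exact: is_derive_cst.
Qed.

Lemma bump_span_regular f : bump_span f -> regular f.
Proof.
elim => [q|g h _ rg _ rh]; last exact: regularD.
split; first by move=> x; apply: ccontinuous_real; exact: continuous_bump.
by move=> x i; apply: has_partial_derivable; exact: has_partial_bump.
Qed.

Lemma bump_span_partial f i : bump_span f -> bump_span (partial i f).
Proof.
elim => [q|g h sg pg sh ph]; last first.
  by rewrite partialD; [exact: bump_spanD|exact: bump_span_regular|exact: bump_span_regular].
rewrite (_ : partial i _ = fun x =>
  (bump (set_at q i ('X^2 * ((q i).1 - (q i).1^`()), (q i).2)) x)%:C +
   (bump (set_at q i ((q i).1, - 'X^2 * ((q i).2 - (q i).2^`()))) x)%:C).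
  by apply: bump_spanD; exact: bump_span_bump.
by apply/funext => x; apply: has_partialE; exact: has_partial_bump.
Qed.

Lemma smooth_bump q : smooth (fun x => (bump q x)%:C).
Proof.
apply: (smooth_coind bump_span_regular bump_span_partial).
exact: bump_span_bump.
Qed.

Definition bump1 := bump (fun=> (1, 1)).

Lemma bump1_ge0 x : 0 <= bump1 x.
Proof. by apply: prodr_ge0 => i _; rewrite mulr_ge0// flat1_ge0. Qed.

Lemma bump1_gt0 x : (forall i, a i < x 0 i < b i) -> 0 < bump1 x.
Proof.
move=> H; apply: prodr_gt0 => i _; have /andP[? ?] := H i.
by rewrite mulr_gt0// flat1_gt0// subr_gt0.
Qed.

Lemma bump1_neq0 x i : bump1 x != 0 -> a i < x 0 i < b i.
Proof.
move=> h; apply/negPn; apply: contra h; rewrite negb_and -!leNgt => /orP h.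
rewrite /bump1 /bump (bigD1 i)//= /flat2.
case: h => h.
  by rewrite (@flat_le0 _ _ (x 0 i - a i)) ?subr_le0// !mul0r.
by rewrite (@flat_le0 _ _ (b i - x 0 i)) ?subr_le0// mulr0 mul0r.
Qed.

End bump.

(** * Test functions detect continuous functions *)

Section detection.
Variables (R : realType) (d : nat).
Local Notation V := 'rV[R]_d.
Local Notation mu := (lebesgue_rV R d).
Implicit Types (x y l : V) (f g phi : V -> R[i]).

Lemma closed_box_compact (c : V) (r : R) : compact [set x : V | forall i, `|x 0 i - c 0 i| <= r].
Proof.
have := @rV_compact R d (fun i => `[c 0 i - r, c 0 i + r]%classic) (fun i => @segment_compact _ _ _).
rewrite (_ : [set x : V | _] = [set v : 'rV[R]_d | forall i, `[c 0 i - r, c 0 i + r]%classic (v ord0 i)])//.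
apply/seteqP; split => x /= H i; have := H i; rewrite in_itv/= ler_distl//.
Qed.

Lemma exists_bump (U : set V) x : open U -> U x ->
  exists b : V -> R, [/\ test_in U (fun y => (b y)%:C), forall y, 0 <= b y &
    exists2 r : R, 0 < r & forall y, (forall i, `|y 0 i - x 0 i| < r) -> 0 < b y].
Proof.
move=> oU Ux.
have /(@nbhs_ballP _ V)[e/= e0 He] : nbhs x U by exact: open_nbhs_nbhs.
(* Half the radius, because the support fills up to the closed cube of radius [r], which has to stay
   in the open ball of radius [e]. *)
pose r := e / 2; have r0 : 0 < r by rewrite divr_gt0.
pose b := bump1 (fun i => x 0 i - r) (fun i => x 0 i + r).
exists b.
have cB : closed [set y : V | forall i, `|y 0 i - x 0 i| <= r].
  have h := @closed_box_compact x r.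
  by apply: (@compact_closed _ _ _ h); exact: (@norm_hausdorff R V).
have sB : fun_supp (fun y => (b y)%:C) `<=` [set y : V | forall i, `|y 0 i - x 0 i| <= r].
  have sub : [set y | (b y)%:C != 0] `<=` [set y : V | forall i, `|y 0 i - x 0 i| <= r].
    move=> y /= by0 i; have : b y != 0 by apply: contra by0 => /eqP ->.
    by move=> /(bump1_neq0 i)/andP[/ltW h1 /ltW h2]; rewrite ler_distl h1.
  have cE := (closure_id _).1 cB; by rewrite cE; exact: (closure_subset sub).
split.
- split; first split.
  + exact: smooth_bump.
  + exact: (subclosed_compact (@closed_fun_supp _ _ _) (@closed_box_compact x r) sB).
  + move=> y /sB yB; apply: He; rewrite -ball_normE /=.
    apply: rV_norm_lt => // i; rewrite !mxE distrC.
    by rewrite (le_lt_trans (yB i))// /r ltr_pdivrMr// ltr_pMr// ltr1n.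
- by move=> y; exact: bump1_ge0.
- exists r => // y yr; apply: bump1_gt0 => i.
  by have := yr i; rewrite ltr_distl => /andP[-> ->].
Qed.

(** The fundamental lemma of the calculus of variations. If [G x] is nonzero, a bump near [x] makes
    the integral of a continuous nonnegative function vanish although it is positive on a box around
    [x]. *)
Lemma test_in_detect (U : set V) (G : V -> R[i]) : open U -> (forall x, ccontinuous G x) ->
  (forall phi, test_in U phi -> cintegral (fun x => G x * phi x) = 0) ->
  forall x, U x -> G x = 0.
Proof.
move=> oU cG H x Ux; apply: contrapT => /eqP Gx.
(* The real part of [conj (G x) * G y]: a real function that is positive at [x] and whose integral
   against a real bump follows from that of [G]. *)
pose u y : R := cRe (G x) * cRe (G y) + cIm (G x) * cIm (G y).
have cu : continuous u.
  move=> y; have [c1 c2] := cG y.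
  apply: (@continuousD _ _ _ (fun y => cRe (G x) * cRe (G y)) (fun y => cIm (G x) * cIm (G y))).
    by apply: continuousM => //; exact: cst_continuous.
  by apply: continuousM => //; exact: cst_continuous.
have ux : 0 < u x.
  rewrite /u -!expr2 lt_def addr_ge0 ?sqr_ge0// andbT paddr_eq0 ?sqr_ge0//.
  by rewrite !sqrf_eq0; move: Gx; rewrite eq_complex.
pose W := U `&` [set y | 0 < u y].
have oW : open W.
  apply: openI => //; have /continuousP := cu.
  by move=> /(_ _ (@open_gt R 0)).
have [b [tb b0 [r r0 br]]] := @exists_bump W x oW (conj Ux ux).
have tbU : test_in U (fun y => (b y)%:C).
  by have [t1 t2] := tb; split => // y /t2[].
have rb : rd (fun y => (b y)%:C) := test_in_rd tb.
have cGb : forall y, ccontinuous (fun y => G y * (b y)%:C) y.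
  by move=> y; apply: ccontinuousM => //; exact: (rd_regular rb).1.
have cpt : compact (fun_supp (fun y => G y * (b y)%:C)).
  apply: (subclosed_compact (@closed_fun_supp _ _ _) tb.1.2).
  by apply: fun_supp_sub => y /fun_supp0 ->; rewrite mulr0.
have [C [C0 HC]] := rapid_weight (compact_support_rapid cGb cpt).
have [i1 i2] := cintegrable_weight (ccontinuous_cmeasurable cGb) HC.
have := H _ tbU => /[dup] /(congr1 (@complex.Re R))/= E1 /(congr1 (@complex.Im R))/= E2.
have reb y : cRe (G y * (b y)%:C) = cRe (G y) * b y /\ cIm (G y * (b y)%:C) = cIm (G y) * b y.
  by case: (G y) => ? ? /=; split; ring.
have iu : mu.-integrable setT (fun y => (u y * b y)%:E).
  rewrite (_ : (fun y => _) = (fun y => (cRe (G x))%:E * (cRe (G y * (b y)%:C))%:E) \+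
     (fun y => (cIm (G x))%:E * (cIm (G y * (b y)%:C))%:E))%E.
    by apply: integrableD => //; exact: integrableZl.
  apply/funext => y; rewrite (reb y).1 (reb y).2 /= -!EFinM -EFinD /u.
  by congr (_%:E); ring.
have E : \int[mu]_y (u y * b y) = 0.
  have -> : \int[mu]_y (u y * b y) =
      \int[mu]_y (cRe (G x) * cRe (G y * (b y)%:C) + cIm (G x) * cIm (G y * (b y)%:C)).
    by apply: eq_Rintegral => y _; rewrite (reb y).1 (reb y).2 /u; ring.
  rewrite (RintegralD measurableT (integrableZl measurableT (cRe (G x)) i1)
    (integrableZl measurableT (cIm (G x)) i2)).
  rewrite (RintegralZl _ measurableT i1) (RintegralZl _ measurableT i2).
  by rewrite E1 E2 !mulr0 addr0.
have ub0 y : 0 <= u y * b y.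
  have [->|by0] := eqVneq (b y) 0; first by rewrite mulr0.
  have Wy : W y by apply: tb.2; apply: fun_supp_neq0; rewrite eq_complex /= eqxx andbT.
  by rewrite mulr_ge0// ltW//; exact: Wy.2.
have E' : (\int[mu]_y `|(u y * b y)%:E| = 0)%E.
  under eq_integral do rewrite gee0_abs ?lee_fin ?ub0//.
  by rewrite -[LHS]fineK ?integrable_fin_num// -/(Rintegral _ _ _) E.
have mub : measurable_fun setT (fun y => (u y * b y)%:E) by exact: measurable_int iu.
have /(ae_eq_integral_abs mu measurableT mub)[N [mN N0 subN]] := E'.
(* A box around [x] on which [u * b] is positive: it must lie in the null set [N], yet its measure
   is [(2 r) ^ d]. *)
pose B := [set y : V | forall i, `]x 0 i - r, x 0 i + r[%classic (y 0 i)].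
have BN : B `<=` N.
  move=> y By; apply: subN => /= /(_ I) => /eqP; rewrite eqe.
  have by0 : 0 < b y.
    by apply: br => i; have := By i; rewrite /= in_itv/= ltr_distl.
  have Wy : W y by apply: tb.2; apply: fun_supp_neq0; rewrite eq_complex /= eqxx andbT gt_eqF.
  by rewrite gt_eqF// mulr_gt0//; exact: Wy.2.
have mI i : measurable (`]x 0 i - r, x 0 i + r[%classic : set R) by exact: measurable_itv.
have mB : measurable B := measurable_rV_box mI.
have : (mu B <= mu N)%E by apply: le_measure; rewrite ?inE.
rewrite N0 (lebesgue_rV_box mI) leNgt => /negP; apply.
under eq_bigr => i _.
  rewrite lebesgue_measure_itv /= lte_fin ltrD2l gtrN// -EFinB.
  rewrite (_ : _ - _ = 2 * r); last by ring.
  over.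
by rewrite prodEFin lte_fin prodr_gt0// => i _; rewrite mulr_gt0.
Qed.

End detection.

(** * The symbol P(i l): multiplication and division of test functions *)

Section symbol.
Variables (R : realType) (d : nat) (P : mpolynomial R[i] d).
Local Notation V := 'rV[R]_d.
Local Notation mu := (lebesgue_rV R d).
Implicit Types (x y l : V) (f g h phi : V -> R[i]).

Lemma eval_iE l : eval_i P l =
  \sum_(m <- mpoly.msupp P) mpoly.mcoeff m P *
    \prod_(i < d) ('i%C * (l 0 i)%:C) ^+ mpoly.fun_of_multinom m i.
Proof. exact: mpoly.mevalE. Qed.

Lemma regular_cst z : regular (fun _ : V => z).
Proof.
split; first by move=> x; exact: ccontinuous_cst.
by move=> x i; apply/has_partial_derivable/has_partial_cst.
Qed.

Lemma regularM f g : regular f -> regular g -> regular (fun x => f x * g x).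
Proof.
move=> [f1 f2] [g1 g2]; split; first by move=> x; exact: ccontinuousM.
by move=> x i; apply/has_partial_derivable/has_partialM; exact/has_partialP.
Qed.

Lemma regularX f n : regular f -> regular (fun x => f x ^+ n).
Proof.
move=> rf; elim: n => [|n IH].
  by under eq_fun do rewrite expr0; exact: regular_cst.
under eq_fun do rewrite exprS; exact: regularM rf IH.
Qed.

Lemma regular_prod (T : Type) (s : seq T) (F : T -> V -> R[i]) :
  (forall i, regular (F i)) -> regular (fun x => \prod_(i <- s) F i x).
Proof.
move=> rF; elim: s => [|i s IH].
  by under eq_fun do rewrite big_nil; exact: regular_cst.
under eq_fun do rewrite big_cons; exact: regularM (rF i) IH.
Qed.

Lemma regular_sum (T : Type) (s : seq T) (F : T -> V -> R[i]) :
  (forall i, regular (F i)) -> regular (fun x => \sum_(i <- s) F i x).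
Proof.
move=> rF; elim: s => [|i s IH].
  by under eq_fun do rewrite big_nil; exact: regular_cst.
under eq_fun do rewrite big_cons; exact: regularD (rF i) IH.
Qed.

Lemma regular_eval_i : regular (eval_i P).
Proof.
rewrite (_ : eval_i P = fun l => \sum_(m <- mpoly.msupp P) mpoly.mcoeff m P *
    \prod_(i < d) ('i%C * (l 0 i)%:C) ^+ mpoly.fun_of_multinom m i); last first.
  by apply/funext => l; exact: eval_iE.
have rX (i : 'I_d) : regular (fun l : V => 'i%C * (l 0 i)%:C).
  apply: regularM; first exact: regular_cst.
  rewrite (_ : (fun l : V => _) = pos i (fun=> 1)); first exact/regular_pos/regular_cst.
  by apply/funext => l; rewrite /pos mulr1.
apply: regular_sum => m; apply: regularM; first exact: regular_cst.
by apply: regular_prod => i; exact: regularX (rX i).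
Qed.

Lemma ft_partials s f l : rd f ->
  ft (partials s f) l = \prod_(i <- s) ('i%C * (l 0 i)%:C) * ft f l.
Proof.
move=> rf; elim: s => [|i s IH]; first by rewrite big_nil mul1r.
rewrite [partials _ _]/= ft_partial; last exact: rd_partials.
by rewrite IH big_cons; ring.
Qed.

Lemma ft_mpartial (m : multiindex d) f l : rd f -> ft (mpartial m f) l =
  \prod_(i < d) ('i%C * (l 0 i)%:C) ^+ mpoly.fun_of_multinom m i * ft f l.
Proof.
move=> rf; rewrite mpartialE ft_partials//; congr (_ * _).
rewrite -[in RHS]big_enum /=; elim: (enum _) => [|i s IH]; first by rewrite !big_nil.
rewrite /= big_cat /= IH big_cons; congr (_ * _).
by rewrite big_nseq; elim: (mpoly.fun_of_multinom m i) => // n; rewrite iterS exprS => ->.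
Qed.

Lemma ft_diffop f l : rd f -> ft (diffop P f) l = eval_i P l * ft f l.
Proof.
move=> rf; rewrite eval_iE mulr_suml /diffop.
elim: (mpoly.msupp P) => [|m s IH].
  rewrite big_nil (_ : (fun x => _) = fun x => 0 * f x); last first.
    by apply/funext => x; rewrite big_nil mul0r.
  by rewrite ftZ ?mul0r//; exact: rd_cintegrable.
rewrite big_cons -IH.
rewrite (_ : (fun x => _) = fun x => mpoly.mcoeff m P * mpartial m f x +
   (\sum_(m <- s) mpoly.mcoeff m P * mpartial m f x)); last first.
  by apply/funext => x; rewrite big_cons.
have rm := rd_cintegrable (rd_mpartial m rf).
rewrite ftD; last 2 first.
- exact: cintegrableZ.
- by apply: rd_cintegrable; apply: rd_sum => k; exact: rd_mpartial.
by rewrite ftZ// ft_mpartial// mulrA.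
Qed.

Lemma ft_iter_diffop n f l : rd f ->
  ft (iter n (diffop P) f) l = eval_i P l ^+ n * ft f l.
Proof.
move=> rf; elim: n => [|n IH]; first by rewrite expr0 mul1r.
by rewrite iterS ft_diffop ?IH ?exprS ?mulrA//; exact: rd_iter_diffop.
Qed.

Definition superlevel (r : R) : set V := [set l | r < cabs (eval_i P l)].

Lemma open_superlevel r : open (superlevel r).
Proof.
have [c _] := regular_eval_i.
have cn : continuous (fun l => cabs (eval_i P l)).
  rewrite (_ : (fun l => _) = Num.sqrt \o ((fun l => cRe (eval_i P l) * cRe (eval_i P l)) \+
     (fun l => cIm (eval_i P l) * cIm (eval_i P l)))); last first.
    by apply/funext => l /=; case: (eval_i P l) => ? ? /=; rewrite !expr2.
  move=> l; have [c1 c2] := c l; apply: continuous_comp; last exact: sqrt_continuous.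
  by apply: continuousD; exact: continuousM.
have /continuousP := cn; move=> /(_ _ (@open_gt R r)).
by [].
Qed.

Lemma test_in_eval_i U phi : test_in U phi -> test_in U (fun x => eval_i P x * phi x).
Proof.
move=> tp; rewrite (_ : (fun x => _) = fun x => \sum_(m <- mpoly.msupp P)
   (mpoly.mcoeff m P * (\prod_(i < d) ('i%C * (x 0 i)%:C) ^+ mpoly.fun_of_multinom m i * phi x))); last first.
  by apply/funext => x; rewrite eval_iE mulr_suml; apply: eq_bigr => m _; rewrite mulrA.
elim: (mpoly.msupp P) => [|m s IH].
  rewrite (_ : (fun x => _) = fun x => 0 * phi x); first exact: test_inZ.
  by apply/funext => x; rewrite big_nil mul0r.
under eq_fun do rewrite big_cons; apply: test_inD IH; apply: test_inZ.
elim: (index_enum _) => [|i t IHt].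
  by under eq_fun do rewrite big_nil mul1r.
under eq_fun do rewrite big_cons -mulrA.
elim: (mpoly.fun_of_multinom m i) => [|n IHn].
  by under eq_fun do rewrite expr0 mul1r.
under eq_fun do rewrite exprS -!mulrA.
apply: test_inZ.
rewrite (_ : (fun x => _) = pos i (fun x : V => ('i%C * (x 0 i)%:C) ^+ n *
  ((\prod_(j <- t) ('i%C * (x 0 j)%:C) ^+ mpoly.fun_of_multinom m j) * phi x)))//.
exact: test_in_pos.
Qed.

(** The commutator of [partial i] with multiplication by the symbol, that is, [phi] times the
    derivative of the symbol ([eval_i_commE]). As a combination of test functions it inherits
    smoothness and support from the closure rules. *)
Definition eval_i_comm i phi x :=
  partial i (fun y => eval_i P y * phi y) x + -1 * (eval_i P x * partial i phi x).

Lemma test_in_comm U i phi : test_in U phi -> test_in U (eval_i_comm i phi).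
Proof.
move=> tp; apply: test_inD; first exact/test_in_partial/test_in_eval_i.
exact/test_inZ/test_in_eval_i/test_in_partial.
Qed.

Lemma eval_i_commE i phi x : regular phi ->
  eval_i_comm i phi x = partial i (eval_i P) x * phi x.
Proof.
move=> rphi; rewrite /eval_i_comm.
have := has_partialM (regular_has_partial x i regular_eval_i) (regular_has_partial x i rphi).
by move=> /has_partialE ->; ring.
Qed.

(** On the support of [phi] the symbol is nonzero and this is the quotient rule. Off the support
    [phi] vanishes near [x], hence so does the quotient, whatever value the inverse of the symbol
    takes there. *)
Lemma has_partial_div U phi k x i : (forall y, U y -> eval_i P y != 0) -> test_in U phi ->
  has_partial (fun y => phi y / eval_i P y ^+ k) x i
   ((eval_i P x * partial i phi x + - k%:R * eval_i_comm i phi x) / eval_i P x ^+ k.+1).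
Proof.
move=> U0 tp; have rp := rd_regular (test_in_rd tp).
have [sx|nx] := pselect (fun_supp phi x).
  have P0 := U0 x (tp.2 x sx).
  have hP := regular_has_partial x i regular_eval_i.
  have hk : has_partial (fun y => eval_i P y ^+ k) x i
      (k%:R * eval_i P x ^+ k.-1 * partial i (eval_i P) x).
    elim: k => [|k IH].
      by rewrite !mul0r; exact: has_partial_cst.
    under eq_fun do rewrite exprS.
    apply: (has_partial_eq (has_partialM hP IH)).
    case: k {IH} => [|k]; first by rewrite !mulr0n !mul0r !mulr0 addr0 /= !expr0 !mul1r mulr1.
    rewrite /= -[k.+2%:R]natr1 [eval_i P x ^+ k.+1]exprS; ring.
  apply: (has_partial_eq (has_partialM (regular_has_partial x i rp)
     (has_partialV (expf_neq0 k P0) hk))).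
  rewrite eval_i_commE//.
  case: k {hk} => [|k]; first by rewrite mulr0n oppr0 !mul0r oppr0 !mul0r !mulr0 expr0 expr1; field.
  rewrite /= !exprS; have Pk0 := expf_neq0 k P0.
  by field; rewrite P0 Pk0.
have p0 := fun_supp_near0 nx.
have c0 : eval_i_comm i phi x = 0 by rewrite eval_i_commE// (fun_supp0 nx) mulr0.
have d0 : partial i phi x = 0.
  by apply: fun_supp0 => h; apply: nx; exact: fun_supp_partial h.
rewrite c0 d0 !mulr0 addr0 mul0r.
apply: (near_eq_has_partial _ (has_partial_cst x i 0)).
by apply: filterS p0 => y ->; rewrite mul0r.
Qed.

(** The quotients of test functions by powers of the symbol form a stable class: [has_partial_div]
    puts the derivative over the common denominator of exponent [k + 1]. *)
Lemma test_in_div U phi k : (forall y, U y -> eval_i P y != 0) -> test_in U phi ->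
  test_in U (fun y => phi y / eval_i P y ^+ k).
Proof.
move=> U0 tp; apply: (test_in_sub tp); last by move=> x /fun_supp0 ->; rewrite mul0r.
apply: (@smooth_coind _ _ (fun h => exists phi k, test_in U phi /\
  h = fun y => phi y / eval_i P y ^+ k)); last by exists phi, k.
- move=> _ [q [n [tq ->]]]; split; last first.
    by move=> x i; apply/has_partial_derivable/(has_partial_div n x i U0 tq).
  move=> x; have [sx|nx] := pselect (fun_supp q x).
    have P0 := U0 x (tq.2 x sx).
    apply: ccontinuousM; first exact: (rd_regular (test_in_rd tq)).1.
    apply: ccontinuousV; first exact: expf_neq0.
    exact: (regularX n regular_eval_i).1.
  apply: (near_eq_ccontinuous _ (ccontinuous_cst x 0)).
  by apply: filterS (fun_supp_near0 nx) => y ->; rewrite mul0r.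
- move=> _ i [q [n [tq ->]]].
  exists (fun x => eval_i P x * partial i q x + - n%:R * eval_i_comm i q x), n.+1; split.
    apply: test_inD; first exact/test_in_eval_i/test_in_partial.
    exact/test_inZ/test_in_comm.
  by apply/funext => x; exact: has_partialE (has_partial_div n x i U0 tq).
Qed.

(** The exponent [n + 1] is split as [2 + (n - 1)], so that the second term is n times the entry of
    index [n.-1] of a sequence of the same kind, as [weight_growth] expects. Where the symbol
    vanishes, [x] is off the support and both sides are 0. *)
Lemma partial_div U phi n i x : (forall y, U y -> eval_i P y != 0) -> test_in U phi ->
  partial i (fun y => phi y / eval_i P y ^+ n) x =
  partial i phi x / eval_i P x ^+ n +
    - n%:R * (eval_i_comm i phi x / eval_i P x ^+ 2 / eval_i P x ^+ n.-1).
Proof.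
move=> U0 tp; rewrite (has_partialE (has_partial_div n x i U0 tp)).
have [P0|P0] := eqVneq (eval_i P x) 0.
  have nx : ~ fun_supp phi x by move=> /tp.2/U0; rewrite P0 eqxx.
  rewrite (eval_i_commE _ _ (rd_regular (test_in_rd tp))) (fun_supp0 nx).
  have -> : partial i phi x = 0.
    by apply: fun_supp0 => h; apply: nx; exact: fun_supp_partial h.
  by rewrite !(mulr0, mul0r, addr0).
case: n => [|n]; first by rewrite mulr0n oppr0 !mul0r expr0 expr1; field.
have Pk0 := expf_neq0 n P0; rewrite /= !exprS expr0.
by field; rewrite P0 Pk0.
Qed.

End symbol.

(** * Growth of sequences under multiplication by coordinates *)

Section growth.
Variables (R : realType) (d : nat).
Local Notation V := 'rV[R]_d.
Implicit Types (x : V) (F G H : nat -> V -> R[i]).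

Lemma poss_rcons J j (f : V -> R[i]) : poss (rcons J j) f = poss J (pos j f).
Proof. by rewrite /poss foldr_rcons. Qed.

(* Multiplying a sequence of the class by a coordinate costs one factor [n], so
   the growth rate of all monomial multiples is that of the sequence itself. *)
Lemma poss_growth (S : (nat -> V -> R[i]) -> Prop) (r : R) : 0 < r ->
  (forall F, S F -> exists C : R, forall n x, cabs (F n x) <= C * r ^+ n) ->
  (forall F j, S F -> exists G H (z : nat -> R[i]), [/\ S G, S H,
     forall n, cabs (z n) <= n%:R &
     forall n, pos j (F n) = fun x => G n x + z n * H n.-1 x]) ->
  forall J F, S F -> exists C : R, 0 <= C /\
    forall n x, cabs (poss J (F n) x) <= C * n.+1%:R ^+ size J * r ^+ n.
Proof.
move=> r0 base step; elim/last_ind => [|J j IH] F SF.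
  have [C HC] := base F SF; exists `|C|; split => // n x.
  by rewrite expr0 mulr1 (le_trans (HC n x))// ler_wpM2r ?ler_norm// exprn_ge0// ltW.
have [G [H [z [SG SH zn E]]]] := step F j SF.
have [C1 [C10 H1]] := IH G SG; have [C2 [C20 H2]] := IH H SH.
exists (C1 + C2 / r); split; first by rewrite addr_ge0// divr_ge0// ltW.
move=> n x; rewrite poss_rcons E possE mulrDr (mulrCA _ (z n)) -!possE.
rewrite (le_trans (cabsD _ _))// cabsM size_rcons -mulrA mulrDl lerD//.
  rewrite (le_trans (H1 n x))// -mulrA ler_wpM2l// ler_wpM2r ?exprn_ge0 ?(ltW r0)//.
  by rewrite exprS ler_peMl ?exprn_ge0// ler1n.
(* At index 0 the bound on [z] forces [z 0 = 0], so the default [n.-1 = 0] does no harm. At [n + 1]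
   the shift of [H] costs the factor [1 / r] in the constant. *)
case: n {E} => [|n].
  have -> : cabs (z 0%N) = 0 by apply/eqP; rewrite eq_le cabs_ge0 andbT; exact: zn.
  by rewrite mul0r expr0 expr1n !mulr1 divr_ge0// ltW.
apply: (@le_trans _ _ (n.+1%:R * (C2 * n.+1%:R ^+ size J * r ^+ n))).
  by rewrite ler_pM ?cabs_ge0//; exact: H2.
rewrite (_ : C2 / r * _ = n.+2%:R * (C2 * n.+2%:R ^+ size J * r ^+ n)); last first.
  by rewrite !exprS; field; rewrite gt_eqF.
rewrite ler_pM ?mulr_ge0 ?exprn_ge0 ?(ltW r0)// ?ler_nat//.
rewrite ler_wpM2r ?exprn_ge0 ?(ltW r0)// ler_wpM2l// lerXn2r ?nnegrE// ler_nat//.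
Qed.

(** Induction on [k]: each factor [n + 1] is paid by passing to the midpoint [t = (1 + e) r] of the
    current ratio and [s]. Bernoulli's inequality gives [(1 + 1 / e) (1 + e) ^ n >= (1 + 1 / e) (1 +
    n e) >= n + 1]. *)
Lemma geometric_absorb (r s : R) k : 0 < r -> r < s ->
  exists2 C : R, 0 <= C & forall n, n.+1%:R ^+ k * r ^+ n <= C * s ^+ n.
Proof.
move=> r0; elim: k r r0 => [|k IH] r r0 rs.
  exists 1 => // n; rewrite expr0 !mul1r lerXn2r ?nnegrE ?ltW//.
  exact: lt_trans rs.
pose t := (r + s) / 2.
have rt : r < t by rewrite /t; lra.
have ts : t < s by rewrite /t; lra.
have t0 : 0 < t by exact: lt_trans rt.
have [C C0 HC] := IH t t0 ts.
pose e := t / r - 1.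
have e0 : 0 < e by rewrite subr_gt0 ltr_pdivlMr// mul1r.
have key n : n.+1%:R * r ^+ n <= (1 + e^-1) * t ^+ n.
  have tE : t = (1 + e) * r by rewrite /e addrC subrK divfK// gt_eqF.
  rewrite tE exprMn mulrA ler_wpM2r ?exprn_ge0 ?(ltW r0)//.
  have bern m : 1 + m%:R * e <= (1 + e) ^+ m.
    elim: m => [|m IHm]; first by rewrite mul0r addr0 expr0.
    rewrite exprS; apply: le_trans (ler_wpM2l _ IHm); last by rewrite addr_ge0// ltW.
    rewrite -natr1 -subr_ge0 (_ : _ - _ = m%:R * e ^+ 2); last by ring.
    by rewrite mulr_ge0// sqr_ge0.
  apply: le_trans (ler_wpM2l _ (bern n)); last by rewrite addr_ge0// invr_ge0 ltW.
  have -> : (1 + e^-1) * (1 + n%:R * e) = n.+1%:R + (e^-1 + n%:R * e).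
    by rewrite -natr1; field; rewrite gt_eqF.
  by rewrite lerDl addr_ge0 ?invr_ge0 ?mulr_ge0 ?(ltW e0).
exists ((1 + e^-1) * C); first by rewrite mulr_ge0// addr_ge0// invr_ge0 ltW.
move=> n; rewrite exprSr -mulrA.
apply: (@le_trans _ _ (n.+1%:R ^+ k * ((1 + e^-1) * t ^+ n))).
  by rewrite ler_wpM2l// exprn_ge0.
by rewrite mulrCA -[leRHS]mulrA ler_wpM2l// addr_ge0// invr_ge0 ltW.
Qed.

(** Used twice: for the iterates [D^n h], and for the transforms of [phi / P^n]. The polynomial
    factor of [poss_growth] is absorbed in passing from [r] to [s], after which [weight_bound]
    supplies the weight. *)
Lemma weight_growth (S : (nat -> V -> R[i]) -> Prop) (r s : R) : 0 < r -> r < s ->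
  (forall F, S F -> exists C : R, forall n x, cabs (F n x) <= C * r ^+ n) ->
  (forall F j, S F -> exists G H (z : nat -> R[i]), [/\ S G, S H,
     forall n, cabs (z n) <= n%:R &
     forall n, pos j (F n) = fun x => G n x + z n * H n.-1 x]) ->
  forall F, S F -> exists C : R, 0 <= C /\
    forall n x, cabs (F n x) <= C * s ^+ n * weight x.
Proof.
move=> r0 rs base step F SF.
have [J|C HC] := @weight_bound _ _ _ F (fun n => s ^+ n).
  have [C [C0 HC]] := poss_growth r0 base step J SF.
  have [D D0 HD] := geometric_absorb (size J) r0 rs.
  exists (C * D) => n x; apply: (le_trans (HC n x)).
  by rewrite -!mulrA ler_wpM2l.
exists `|C|; split => // n x; apply: (le_trans (HC n x)).
have s0 : 0 < s by exact: lt_trans rs.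
by rewrite -!mulrA ler_wpM2r ?ler_norm// mulr_ge0 ?exprn_ge0 ?ltW// weight_gt0.
Qed.

End growth.

(** * Weighted growth of the iterates and of the dual sequence *)

Section spectral_growth.
Variables (R : realType) (d : nat) (P : mpolynomial R[i] d).
Local Notation V := 'rV[R]_d.
Local Notation mu := (lebesgue_rV R d).
Local Notation D := (diffop P).
Implicit Types (x l : V) (f g h phi : V -> R[i]) (U : set V).

Definition spectral_null U h := rd h /\ forall l, U l -> ft h l = 0.

Lemma pos_ft j phi : rd phi -> pos j (ft phi) = ft (fun x => - 'i%C * partial j phi x).
Proof.
move=> rphi; rewrite ftZ; last exact/rd_cintegrable/rd_partial.
apply/funext => l; rewrite ft_partial// /pos.
have i2 : 'i%C * 'i%C = -1 :> R[i] by rewrite -expr2 sqr_i.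
by rewrite !mulrA mulNr -mulrA (mulrC 'i%C) mulNr -!mulrA [in RHS](mulrA 'i%C) i2; ring.
Qed.

(** Paired with [phi], the transform of [x_j h] becomes [h] paired with [x_j ft phi], which is the
    transform of [- i partial j phi]. A second exchange returns to [ft h] on [U], and the derivative
    has fallen on the test function, whose support stays in [U]. *)
Lemma spectral_null_pos U j h : open U -> spectral_null U h -> spectral_null U (pos j h).
Proof.
move=> oU [rh h0]; have rph := rd_pos j rh; split => //.
apply: (test_in_detect oU (ccontinuous_ft rph)) => phi tp.
have rphi := test_in_rd tp.
rewrite ft_exchange; [|exact: rd_cintegrable|exact: rd_cintegrable].
have rp : rd (fun x => - 'i%C * partial j phi x) by exact/rdZ/rd_partial.
transitivity (cintegral (fun x => h x * ft (fun x => - 'i%C * partial j phi x) x)).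
  by apply: eq_cint => x; rewrite -pos_ft// /pos; ring.
rewrite -ft_exchange; [|exact: rd_cintegrable|exact: rd_cintegrable].
transitivity (cintegral (fun _ : V => 0 : R[i])); last first.
  by apply: complex_ext => /=; rewrite /Rintegral integral0.
apply: eq_cint => l; have [Ul|Ul] := pselect (U l); first by rewrite h0 ?mul0r.
have [_ tU] := test_in_partial j tp.
by rewrite (@fun_supp0 _ _ (partial j phi)) ?mulr0// => /tU.
Qed.

Lemma spectral_nullD U g h : spectral_null U g -> spectral_null U h ->
  spectral_null U (fun x => g x + h x).
Proof.
move=> [rg g0] [rh h0]; split; first exact: rdD.
by move=> l Ul; rewrite ftD ?g0 ?h0 ?addr0//; exact: rd_cintegrable.
Qed.

Lemma spectral_nullZ U z h : spectral_null U h -> spectral_null U (fun x => z * h x).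
Proof.
move=> [rh h0]; split; first exact: rdZ.
by move=> l Ul; rewrite ftZ ?h0 ?mulr0//; exact: rd_cintegrable.
Qed.

Lemma spectral_null_diffop U h : spectral_null U h -> spectral_null U (D h).
Proof.
move=> [rh h0]; split; first exact: rd_diffop.
by move=> l Ul; rewrite ft_diffop// h0// mulr0.
Qed.

Lemma spectral_null_comm U j h : open U -> spectral_null U h ->
  spectral_null U (pos_comm j D h).
Proof.
move=> oU hU; apply: spectral_nullD.
  exact/spectral_null_diffop/spectral_null_pos.
by apply: spectral_nullZ; apply: spectral_null_pos => //; exact: spectral_null_diffop.
Qed.

Lemma iter_diffop_growth (r s : R) h : 0 < r -> r < s ->
  spectral_null (superlevel P r) h -> exists C : R, 0 <= C /\
    forall n x, cabs (iter n D h x) <= C * s ^+ n * weight x.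
Proof.
move=> r0 rs hU; have oU := @open_superlevel _ _ P r.
pose S (F : nat -> V -> R[i]) := exists2 g, spectral_null (superlevel P r) g &
  F = fun n => iter n D g.
apply: (@weight_growth _ _ S r s r0 rs _ _ (fun n => iter n D h)); last by exists h.
- move=> _ [g [rg g0] ->].
  pose c := (2 * pi : R) ^+ d.
  have c0 : 0 < c by rewrite exprn_gt0// mulr_gt0// pi_gt0.
  exists (2 * \int[mu]_l cabs (ft g l) / c) => n x.
  have rn := rd_iter_diffop P n rg.
  have := ft_bound x rn; rewrite -/c mulrC -ler_pdivlMr// => H.
  apply: (le_trans H); rewrite [leRHS]mulrAC ler_pM2r ?invr_gt0// -mulrA ler_pM2l//.
  have ig := cintegrable_cabs (cintegrable_ft rg).
  rewrite -(RintegralZr _ measurableT ig).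
  apply: le_Rintegral => //.
  + exact: (cintegrable_cabs (cintegrable_ft rn)).
  + exact: (integrableZr measurableT (r ^+ n) (cintegrable_cabs (cintegrable_ft rg))).
  + move=> l _; rewrite ft_iter_diffop// cabsM cabsX mulrC.
    (* Where the symbol exceeds [r] in modulus, [ft g] vanishes; elsewhere its n-th power is at most
       [r ^ n]. *)
    have [Pl|Pl] := ltP r (cabs (eval_i P l)).
      by rewrite g0// cabs0 !mul0r.
    by rewrite ler_wpM2l ?cabs_ge0// lerXn2r ?nnegrE ?cabs_ge0// ltW.
- move=> _ j [g gU ->].
  exists (fun n => iter n D (pos j g)), (fun n => iter n D (pos_comm j D g)), (fun n => - n%:R).
  split.
  + by exists (pos j g) => //; exact: spectral_null_pos.
  + by exists (pos_comm j D g) => //; exact: spectral_null_comm.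
  + by move=> n; rewrite cabsN -[n%:R](rmorph_nat (real_complex R)) cabs_real ger0_norm.
  + by move=> n; rewrite pos_iter_diffop//; exact: gU.1.
Qed.

(** An instance of [weight_growth] with ratios [s^-1 < r^-1]: on the support of the numerator the
    symbol exceeds [s], which gives the base estimate [s^-n]. *)
Lemma ft_div_growth (r s : R) phi : 0 < r -> r < s ->
  test_in (superlevel P s) phi -> exists C : R, 0 <= C /\
    forall n x, cabs (ft (fun y => phi y / eval_i P y ^+ n) x) <= C * (r^-1) ^+ n * weight x.
Proof.
move=> r0 rs tphi; have s0 : 0 < s by exact: lt_trans rs.
have U0 y : superlevel P s y -> eval_i P y != 0.
  by rewrite /superlevel /= => h; rewrite -cabs_gt0; exact: lt_trans h.
pose S (F : nat -> V -> R[i]) := exists2 g, test_in (superlevel P s) g &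
  F = fun n => ft (fun y => g y / eval_i P y ^+ n).
have si0 : 0 < s^-1 by rewrite invr_gt0.
have sr : s^-1 < r^-1 by rewrite ltf_pV2.
apply: (@weight_growth _ _ S _ _ si0 sr _ _ (fun n => ft (fun y => phi y / eval_i P y ^+ n)));
  last by exists phi.
- move=> _ [g tg ->].
  exists (2 * \int[mu]_y cabs (g y)) => n x.
  have rg := test_in_rd tg.
  have rn := test_in_rd (test_in_div n U0 tg).
  have ig := cintegrable_cabs (rd_cintegrable rg).
  rewrite -mulrA -RintegralZr//.
  apply: cabs_cint_le.
  + exact/cintegrable_wave/rd_cintegrable.
  + exact: (integrableZr measurableT _ ig).
  + move=> y; rewrite cabsM cabs_wave mulr1 cabsM cabsV cabsX.
    have [->|gy] := eqVneq (g y) 0; first by rewrite cabs0 !mul0r.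
    rewrite ler_wpM2l ?cabs_ge0// exprVn lef_pV2 ?posrE ?exprn_gt0//.
      have h : s < cabs (eval_i P y) by apply: tg.2; exact: fun_supp_neq0.
      by rewrite lerXn2r ?nnegrE ?cabs_ge0// ltW.
    have h : s < cabs (eval_i P y) by apply: tg.2; exact: fun_supp_neq0.
    exact: lt_trans h.
- move=> _ j [g tg ->].
  (* [x_j] acts on a transform as [- i partial j] on the argument. By [partial_div] this produces
     the numerator [g1] at index n and the term [i n] times the quotient of [g2] at index [n.-1]. *)
  pose g1 y := - 'i%C * partial j g y.
  pose g2 y := eval_i_comm P j g y / eval_i P y ^+ 2.
  have t1 : test_in (superlevel P s) g1 by exact/test_inZ/test_in_partial.
  have t2 : test_in (superlevel P s) g2 by exact/(test_in_div 2 U0)/test_in_comm.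
  exists (fun n => ft (fun y => g1 y / eval_i P y ^+ n)),
    (fun n => ft (fun y => g2 y / eval_i P y ^+ n)), (fun n => 'i%C * n%:R); split.
  + by exists g1.
  + by exists g2.
  + move=> n; rewrite cabsM -[n%:R](rmorph_nat (real_complex R)) cabs_real ger0_norm//.
    by rewrite [cabs 'i%C]/= expr0n expr1n add0r sqrtr1 mul1r.
  + move=> n; have tn := test_in_div n U0 tg.
    rewrite pos_ft; last exact: test_in_rd tn.
    have i1 := rd_cintegrable (test_in_rd (test_in_div n U0 t1)).
    have i2 := rd_cintegrable (test_in_rd (test_in_div n.-1 U0 t2)).
    apply/funext => x; rewrite -[_ * ft _ x]/((fun l => 'i%C * n%:R * ft _ l) x) -ftZ//.
    rewrite -[LHS]/(ft _ x) -[RHS]/((fun l => ft _ l + ft _ l) x) -ftD//; last exact: cintegrableZ.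
    apply: eq_cint => y; congr (_ * _).
    rewrite (partial_div n j y U0 tg) /g1 /g2; ring.
Qed.

End spectral_growth.

Lemma le_poweR (R : realType) (a b : \bar R) (r : R) : 0 <= r -> (0 <= a)%E ->
  (a <= b)%E -> (a `^ r <= b `^ r)%E.
Proof.
move=> r0 a0 ab; apply: gt0_ler_poweR => //; rewrite in_itv /= leey andbT//.
exact: le_trans ab.
Qed.

(** * Comparison of L^p norms with the weight *)

Section weighted_norms.
Variables (R : realType) (d : nat).
Local Notation V := 'rV[R]_d.
Local Notation mu := (lebesgue_rV R d).
Implicit Types (x l : V) (f g h : V -> R[i]) (p : \bar R).

Definition mass : R := \int[mu]_x weight x.

Lemma mass_ge0 : 0 <= mass.
Proof. by apply: Rintegral_ge0 => x _; exact/ltW/weight_gt0. Qed.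

(** For [p = +oo], [Lnorm] is the essential supremum only when the whole space has positive
    measure. *)
Lemma lebesgue_rV_gt0 : (0 < mu setT)%E.
Proof.
pose A (i : 'I_d) : set R := `[0, 1]%classic.
have mA i : measurable (A i) by exact: measurable_itv.
apply: (@lt_le_trans _ _ (mu [set x : V | forall i, A i (x 0 i)])).
  rewrite (lebesgue_rV_box mA) big1 ?lte01// => i _.
  by rewrite lebesgue_measure_itv /= lte01 sube0.
by apply: le_measure; rewrite ?inE//; exact: measurable_rV_box.
Qed.

(** For finite p, [weight ^ p <= weight] because the weight is at most 1 and [p >= 1], so the norm
    is at most [M mass ^ (1 / p)]. Replacing [mass] by [1 + mass] gives a bound valid for all p,
    including the supremum norm. *)
Lemma cLnorm_le p g (M : R) : (1 <= p)%E -> 0 <= M -> cmeasurable g ->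
  (forall x, cabs (g x) <= M * weight x) -> (cLnorm p g <= (M * (1 + mass))%:E)%E.
Proof.
move=> p1 M0 mg gM; have m0 := mass_ge0; rewrite /cLnorm.
have mM : M <= M * (1 + mass) by rewrite ler_peMr// lerDl.
have mc := cmeasurable_cabs mg.
case: p p1 => [r r1|_|//]; last first.
  rewrite unlock lebesgue_rV_gt0; apply/ess_supP; apply: aeW => x /=.
  rewrite lee_fin ger0_norm ?cabs_ge0// (le_trans (gM x))// (le_trans _ mM)//.
  by rewrite ler_piMr// weight_le1.
rewrite lee_fin in r1; have r0 : 0 < r by exact: lt_le_trans r1.
rewrite unlock.
have h x : ((`|(cabs (g x))%:E| `^ r) <= (M `^ r)%:E * (weight x)%:E)%E.
  rewrite /= -EFinM lee_fin ger0_norm ?cabs_ge0//.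
  apply: (@le_trans _ _ ((M * weight x) `^ r)).
    by rewrite ge0_ler_powR ?nnegrE ?cabs_ge0 ?mulr_ge0// ?ltW// weight_gt0.
  rewrite (@powRM _ M (weight x) r M0 (ltW (weight_gt0 x))) ler_wpM2l ?powR_ge0//.
  rewrite -[leRHS]powRr1 ?(ltW (weight_gt0 x))// ger_powR// weight_gt0 weight_le1//.
have hi : (\int[mu]_x (`|(cabs (g x))%:E| `^ r) <= (M `^ r * mass)%:E)%E.
  apply: (@le_trans _ _ (\int[mu]_x ((M `^ r)%:E * (weight x)%:E))%E).
    apply: ge0_le_integral => //.
    - by move=> x _; exact: poweR_ge0.
    - apply: (measurableT_comp (measurable_poweR r)).
      by apply: measurableT_comp => //; exact/measurable_EFinP.
    - exact: measurable_int (integrableZl measurableT (M `^ r) (@integrable_weight R d)).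
  rewrite integralZl//; last exact: integrable_weight.
  by rewrite EFinM /mass /Rintegral fineK// integrable_fin_num// integrable_weight.
have s0 : 0 <= r^-1 by rewrite invr_ge0 ltW.
have I0 : (0 <= \int[mu]_x (`|(cabs (g x))%:E| `^ r))%E.
  by apply: integral_ge0 => x _; exact: poweR_ge0.
apply: (@le_trans _ _ (((M `^ r * mass)%:E) `^ r^-1)%E).
  exact: le_poweR.
rewrite poweR_EFin lee_fin powRM ?powR_ge0// -powRrM divff ?gt_eqF// powRr1//.
rewrite ler_wpM2l//.
apply: (@le_trans _ _ ((1 + mass) `^ r^-1)).
  by rewrite ge0_ler_powR ?nnegrE ?addr_ge0// lerDr.
rewrite -[leRHS]powRr1 ?addr_ge0// ler_powR ?lerDl// invf_le1//.
Qed.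

(** Plays the role of Holder's inequality, by the pointwise bound [a w <= t w + t ^ (1 - p) a ^ p]
    for finite p: the first term suffices if [a <= t], and otherwise [a = a ^ (1 - p) a ^ p <= t ^
    (1 - p) a ^ p]. Integration yields [t mass + t]. For [p = +oo], [a <= t] almost everywhere. *)
Lemma weighted_le_cLnorm p g (t : R) : (1 <= p)%E -> 0 < t -> cintegrable mu g ->
  (cLnorm p g <= t%:E)%E -> \int[mu]_x (cabs (g x) * weight x) <= t * (1 + mass).
Proof.
move=> p1 t0 ig; have mg := cintegrable_measurable ig.
have m0 := mass_ge0; rewrite /cLnorm.
have mc := cmeasurable_cabs mg.
have iw : mu.-integrable setT (EFin \o @weight R d) := @integrable_weight R d.
have mw : measurable_fun setT (@weight R d) by move/measurable_int/measurable_EFinP : iw.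
have igw : mu.-integrable setT (fun x => (cabs (g x) * weight x)%:E).
  apply: (le_integrable measurableT _ _ (cintegrable_cabs ig)).
    by apply/measurable_EFinP; exact: measurable_funM.
  move=> x _; rewrite lee_fin !ger0_norm ?mulr_ge0 ?cabs_ge0 ?(ltW (weight_gt0 x))//.
  by rewrite ler_piMr ?cabs_ge0// weight_le1.
have gw0 x : 0 <= cabs (g x) * weight x by rewrite mulr_ge0 ?cabs_ge0 ?(ltW (weight_gt0 x)).
suff H : (cLnorm p g <= t%:E)%E ->
    (\int[mu]_x (cabs (g x) * weight x)%:E <= (t * (1 + mass))%:E)%E.
  move=> /H; rewrite -[X in (X <= _)%E -> _]fineK ?lee_fin//.
  exact: integrable_fin_num.
have wE : (\int[mu]_x (t%:E * (weight x)%:E) = (t * mass)%:E)%E.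
  by rewrite integralZl// EFinM /mass /Rintegral fineK// integrable_fin_num.
have itw := integrableZl measurableT t iw.
case: p p1 => [r r1|_|//]; last first.
  rewrite /cLnorm unlock lebesgue_rV_gt0 => /ess_supP gt.
  apply: (@le_trans _ _ (t * mass)%:E); last by rewrite lee_fin ler_wpM2l ?(ltW t0)// lerDr.
  rewrite -wE; apply: ae_ge0_le_integral => //.
  - by move=> x _; rewrite lee_fin.
  - exact: measurable_int igw.
  - by move=> x _; rewrite mule_ge0 ?lee_fin// ltW// weight_gt0.
  - exact: measurable_int itw.
  - apply: filterS gt => x /= gt _; rewrite -EFinM lee_fin ler_wpM2r ?(ltW (weight_gt0 x))//.
    by move: gt; rewrite lee_fin ger0_norm ?cabs_ge0.
rewrite lee_fin in r1; have r0 : 0 < r by exact: lt_le_trans r1.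
move=> Nt.
have I0 : (0 <= \int[mu]_x (`|(cabs (g x))%:E| `^ r))%E.
  by apply: integral_ge0 => x _; exact: poweR_ge0.
have It : (\int[mu]_x (`|(cabs (g x))%:E| `^ r) <= (t `^ r)%:E)%E.
  rewrite -poweR_Lnorm ?gt_eqF// -poweR_EFin.
  by apply: le_poweR => //; [exact: ltW|exact: Lnorm_ge0].
have mp : measurable_fun setT (fun x => (`|(cabs (g x))%:E| `^ r)%E).
  apply: (measurableT_comp (measurable_poweR r)).
  by apply: measurableT_comp => //; exact/measurable_EFinP.
have pt x : ((cabs (g x) * weight x)%:E <=
    t%:E * (weight x)%:E + (t `^ (1 - r))%:E * (`|(cabs (g x))%:E| `^ r))%E.
  rewrite /= -!EFinM -EFinD lee_fin ger0_norm ?cabs_ge0//.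
  set a := cabs (g x); have a0 : 0 <= a by exact: cabs_ge0.
  have w0 := ltW (weight_gt0 x).
  have [at_|ta] := leP a t.
    apply: (@le_trans _ _ (t * weight x)); first by rewrite ler_wpM2r.
    by rewrite lerDl mulr_ge0 ?powR_ge0.
  have a1 : 0 < a by exact: lt_trans ta.
  apply: (@le_trans _ _ a); first by rewrite ler_piMr// weight_le1.
  apply: (@le_trans _ _ (t `^ (1 - r) * a `^ r)); last by rewrite lerDr mulr_ge0// ltW.
  rewrite -[leLHS](_ : a `^ (1 - r) * a `^ r = a); last first.
    by rewrite -powRD ?subrK ?powRr1// gt_eqF// implybT.
  rewrite ler_wpM2r ?powR_ge0// -[1 - r]opprB !powRN lef_pV2 ?posrE ?powR_gt0//.
  by rewrite ge0_ler_powR ?nnegrE ?subr_ge0 ?(ltW t0) ?(ltW ta).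
apply: (@le_trans _ _ (\int[mu]_x (t%:E * (weight x)%:E +
    (t `^ (1 - r))%:E * (`|(cabs (g x))%:E| `^ r)))%E).
  apply: ge0_le_integral => //.
  - by move=> x _; rewrite lee_fin.
  - exact: measurable_int igw.
  - apply: emeasurable_funD; first exact: measurable_int itw.
    exact: measurable_funeM.
rewrite ge0_integralD//; last 4 first.
- by move=> x _; rewrite mule_ge0 ?lee_fin ?(ltW t0) ?(ltW (weight_gt0 x)).
- exact: measurable_int itw.
- by move=> x _; rewrite mule_ge0 ?poweR_ge0// lee_fin powR_ge0.
- exact: measurable_funeM.
rewrite wE ge0_integralZl//; last 2 first.
- by move=> x _; exact: poweR_ge0.
- by rewrite lee_fin powR_ge0.
apply: (@le_trans _ _ ((t * mass)%:E + (t `^ (1 - r))%:E * (t `^ r)%:E)%E).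
  by rewrite leeD2l// lee_wpmul2l// lee_fin powR_ge0.
rewrite -EFinM -powRD ?subrK ?powRr1 ?(ltW t0)//; last by rewrite gt_eqF// implybT.
by rewrite -EFinD lee_fin mulrDr mulr1 addrC.
Qed.

End weighted_norms.

(** * Upper and lower bounds for the n-th roots of the norms *)

Section spectral_radius.
Variables (R : realType) (d : nat) (P : mpolynomial R[i] d).
Local Notation V := 'rV[R]_d.
Local Notation mu := (lebesgue_rV R d).
Local Notation D := (diffop P).
Implicit Types (x l : V) (f g h phi : V -> R[i]) (p : \bar R).

Lemma powR_expr_root (t : R) (n : nat) : 0 <= t -> (0 < n)%N -> (t ^+ n) `^ (n%:R^-1) = t.
Proof.
by move=> t0 n0; rewrite -powR_mulrn// -powRrM divff ?powRr1// pnatr_eq0 -lt0n.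
Qed.

Lemma root_le (N : \bar R) (t : R) (n : nat) : (0 <= N)%E -> 0 <= t -> (0 < n)%N ->
  (N <= (t ^+ n)%:E)%E -> (N `^ (n%:R^-1) <= t%:E)%E.
Proof.
move=> N0 t0 n0 H; rewrite -[t in X in (_ <= X)%E](powR_expr_root t0 n0) -poweR_EFin.
by apply: le_poweR; rewrite ?lee_fin ?exprn_ge0 ?invr_ge0.
Qed.

Lemma root_ge (N : \bar R) (t : R) (n : nat) : (0 <= N)%E -> 0 <= t -> (0 < n)%N ->
  ((t ^+ n)%:E <= N)%E -> (t%:E <= N `^ (n%:R^-1))%E.
Proof.
move=> N0 t0 n0 H; rewrite -[t in X in (X <= _)%E](powR_expr_root t0 n0) -poweR_EFin.
by apply: le_poweR; rewrite ?lee_fin ?exprn_ge0 ?invr_ge0.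
Qed.

Lemma near_geometric_le (C s t : R) : 0 < s -> s < t ->
  \forall n \near \oo, C * s ^+ n <= t ^+ n.
Proof.
move=> s0 st; have t0 : 0 < t by exact: lt_trans st.
have q1 : `|s / t| < 1 by rewrite gtr0_norm ?divr_gt0// ltr_pdivrMr// mul1r.
have : C * (s / t) ^+ n @[n --> \oo] --> C * 0.
  by apply: cvgM; [exact: cvg_cst|exact: cvg_expr].
rewrite mulr0 => /cvgr_lt/(_ _ ltr01); apply: filterS => n.
by rewrite expr_div_n mulrA ltr_pdivrMr ?exprn_gt0// mul1r => /ltW.
Qed.

Lemma near_geometric_lt (C s t : R) : 0 < s -> s < t ->
  \forall n \near \oo, C * s ^+ n < t ^+ n.
Proof.
move=> s0 st; have t0 : 0 < t by exact: lt_trans st.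
have := near_geometric_le (`|C| + 1) s0 st; apply: filterS => n; apply: lt_le_trans.
by rewrite ltr_pM2r ?exprn_gt0// (le_lt_trans (ler_norm _))// ltrDl.
Qed.

Lemma cLnorm_iter_upper p f (r t : R) : (1 <= p)%E -> 0 < r -> r < t ->
  spectral_null (superlevel P r) f ->
  \forall n \near \oo, (cLnorm p (iter n D f) `^ n%:R^-1 <= t%:E)%E.
Proof.
move=> p1 r0 rt sf.
(* The gap is spent in two halves: from [r] to [s] for the polynomial factors in n, from [s] to [t]
   for the constant under the n-th root. *)
pose s := (r + t) / 2.
have rs : r < s by rewrite /s; lra.
have st : s < t by rewrite /s; lra.
have s0 : 0 < s by exact: lt_trans rs.
have t0 : 0 < t by exact: lt_trans st.
have [C [C0 HC]] := iter_diffop_growth r0 rs sf.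
near=> n.
have n0 : (0 < n)%N by near: n; exists 1%N.
apply: root_le; [exact: Lnorm_ge0|exact: ltW|exact: n0|].
have rn := rd_iter_diffop P n sf.1.
apply: le_trans (cLnorm_le p1 _ (regular_cmeasurable (rd_regular rn)) (HC n)) _.
  by rewrite mulr_ge0// exprn_ge0// ltW.
rewrite lee_fin mulrAC.
by near: n; exact: near_geometric_le.
Unshelve. all: by end_near. Qed.

(** By contradiction: if the norm of [D^n f] were below [t ^ n], then [weighted_le_cLnorm] and the
    decay [s ^ (- n)] of the dual sequence would bound the fixed positive number [c] by
    [A (t / s) ^ n], which tends to 0. *)
Lemma cLnorm_iter_lower p f phi (t r : R) : (1 <= p)%E -> 0 < t -> t < r -> rd f ->
  test_in (superlevel P r) phi -> cintegral (fun l => ft f l * phi l) != 0 ->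
  \forall n \near \oo, (t%:E <= cLnorm p (iter n D f) `^ n%:R^-1)%E.
Proof.
move=> p1 t0 tr rf tphi cphi.
pose s := (t + r) / 2.
have ts : t < s by rewrite /s; lra.
have sr : s < r by rewrite /s; lra.
have s0 : 0 < s by exact: lt_trans ts.
have r0 : 0 < r by exact: lt_trans sr.
have [C [C0 HC]] := ft_div_growth s0 sr tphi.
have U0 y : superlevel P r y -> eval_i P y != 0.
  by rewrite /superlevel /= => h; rewrite -cabs_gt0; exact: lt_trans h.
pose c := cabs (cintegral (fun l => ft f l * phi l)).
have c0 : 0 < c by rewrite cabs_gt0.
have key n : c <= 2 * (C * (s^-1) ^+ n) * \int[mu]_x (cabs (iter n D f x) * weight x).
  have rn := rd_iter_diffop P n rf.
  have tn := test_in_div n U0 tphi.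
  have -> : c = cabs (cintegral (fun x => iter n D f x * ft (fun y => phi y / eval_i P y ^+ n) x)).
    rewrite -ft_exchange; [|exact: rd_cintegrable|exact/rd_cintegrable/test_in_rd/tn].
    congr (cabs _); apply: eq_cint => l; rewrite ft_iter_diffop//.
    have [Ul|Ul] := pselect (superlevel P r l).
      by have Pn := expf_neq0 n (U0 l Ul); field.
    have -> : phi l = 0 by apply: fun_supp0 => /tphi.2.
    by rewrite mul0r !mulr0.
  have ig := rd_cintegrable rn.
  have igw : mu.-integrable setT (fun x => (cabs (iter n D f x) * weight x)%:E).
    apply: (le_integrable measurableT _ _ (cintegrable_cabs ig)).
      apply/measurable_EFinP; apply: measurable_funM.
        exact: cmeasurable_cabs (cintegrable_measurable ig).
      by have /measurable_int/measurable_EFinP := @integrable_weight R d.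
    move=> x _; rewrite lee_fin !ger0_norm ?mulr_ge0 ?cabs_ge0 ?(ltW (weight_gt0 x))//.
    by rewrite ler_piMr ?cabs_ge0// weight_le1.
  rewrite -mulrA -(RintegralZl _ measurableT igw).
  have hb x : cabs (iter n D f x * ft (fun y => phi y / eval_i P y ^+ n) x) <=
      C * s^-1 ^+ n * (cabs (iter n D f x) * weight x).
    by rewrite cabsM mulrCA ler_wpM2l ?cabs_ge0.
  have iW := integrableZl measurableT (C * s^-1 ^+ n) igw.
  apply: (cabs_cint_le _ iW hb); apply: (cintegrable_le _ iW hb).
  apply: cmeasurableM; first exact: cintegrable_measurable ig.
  exact: ccontinuous_cmeasurable (ccontinuous_ft (test_in_rd tn)).
pose A := 2 * C * (1 + @mass R d).
near=> n.
have n0 : (0 < n)%N by near: n; exists 1%N.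
apply: root_ge; [exact: Lnorm_ge0|exact: ltW|exact: n0|].
have rn := rd_iter_diffop P n rf.
rewrite leNgt; apply/negP => /ltW lt.
have tn0 : 0 < t ^+ n by rewrite exprn_gt0.
have := weighted_le_cLnorm p1 tn0 (rd_cintegrable rn) lt => H.
have : c <= A * (t ^+ n / s ^+ n).
  apply: (le_trans (key n)).
  apply: (le_trans (ler_wpM2l _ H)).
    by rewrite !mulr_ge0// exprn_ge0// invr_ge0 ltW.
  by rewrite /A exprVn le_eqVlt; apply/orP; left; apply/eqP; ring.
rewrite mulrA ler_pdivlMr ?exprn_gt0// leNgt => /negP; apply.
rewrite -ltr_pdivrMl// mulrA.
by near: n; exact: near_geometric_lt.
Unshelve. all: by end_near. Qed.

End spectral_radius.

(** * The radius of the support of the Fourier transform *)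

Section spectral_limit.
Variables (R : realType) (d : nat) (P : mpolynomial R[i] d) (f : 'rV[R]_d -> R[i]).
Local Notation V := 'rV[R]_d.
Local Notation T := (distribution_of (fourier f)).
Implicit Types (l : V) (phi : V -> R[i]).
Hypothesis rf : rd f.

(** The two pairings differ by the nonzero normalizing factor [(2 pi) ^ (- d / 2)], so questions of
    support can be settled with [ft]. *)
Lemma distribution_of_fourier_eq0 U phi : test_in U phi ->
  (T phi == 0) = (cintegral (fun l => ft f l * phi l) == 0).
Proof.
move=> tphi; have rphi := test_in_rd tphi.
have c0 : ((2 * pi : R) `^ (- (d%:R / 2)))%:C != 0.
  by rewrite -cabs_gt0 cabs_real normr_gt0 gt_eqF// powR_gt0// mulr_gt0// pi_gt0.
have ip : cintegrable (lebesgue_rV R d) (fun l => ft f l * phi l).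
  have ib := integrableZl measurableT (2 * \int[lebesgue_rV R d]_x cabs (f x))
    (cintegrable_cabs (rd_cintegrable rphi)).
  have fb l : cabs (ft f l * phi l) <= 2 * \int[lebesgue_rV R d]_x cabs (f x) * cabs (phi l).
    rewrite cabsM ler_wpM2r ?cabs_ge0//.
    apply: cabs_cint_le => //; first exact/cintegrable_wave/rd_cintegrable.
      exact: cintegrable_cabs (rd_cintegrable rf).
    by move=> x; rewrite cabsM cabs_wave mulr1.
  apply: (cintegrable_le _ ib fb); apply: cmeasurableM.
    exact: ccontinuous_cmeasurable (ccontinuous_ft rf).
  exact: regular_cmeasurable (rd_regular rphi).
have -> : T phi = ((2 * pi : R) `^ (- (d%:R / 2)))%:C * cintegral (fun l => ft f l * phi l).
  rewrite /distribution_of -[in RHS]/(cint _ _) -cintZ//.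
  by apply: eq_cint => l; rewrite /fourier -mulrA.
by rewrite mulf_eq0 (negbTE c0).
Qed.

Lemma ft_eq0_off U : open U -> vanishes_on U T -> forall l, U l -> ft f l = 0.
Proof.
move=> oU vU; apply: (test_in_detect oU (ccontinuous_ft rf)) => phi tphi.
by apply/eqP; rewrite -(distribution_of_fourier_eq0 tphi); apply/eqP; apply: vU; case: tphi.
Qed.

Lemma ft_eq0_gt_radius l : (supp_radius P T < (cabs (eval_i P l))%:E)%E -> ft f l = 0.
Proof.
rewrite /supp_radius; case: asboolP => [T0 _|_ lt].
  by apply: (@ft_eq0_off setT); [exact: openT| move=> phi tphi _; exact: T0|].
have [[U [oU vU] Ul]|nU] := pselect ((\bigcup_(U in [set U | open U /\ vanishes_on U T]) U) l).
  exact: ft_eq0_off Ul.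
suff : ((cabs (eval_i P l))%:E <= ereal_sup [set (cabs (eval_i P l))%:E | l in supp T])%E.
  by rewrite leNgt lt.
by apply: ereal_sup_ubound; exists l.
Qed.

(** The supremum over an empty support would be [-oo]. But an empty support means that open sets on
    which the distribution vanishes cover the space, so [ft f = 0] and the branch defined as 0
    applies. *)
Lemma supp_radius_ge0 : (0 <= supp_radius P T)%E.
Proof.
rewrite /supp_radius; case: asboolP => // T0.
have [[l sl]|n0] := pselect (exists l, supp T l).
  apply: (@le_trans _ _ (cabs (eval_i P l))%:E); first by rewrite lee_fin cabs_ge0.
  by apply: ereal_sup_ubound; exists l.
exfalso; apply: T0 => phi tphi.
have f0 l : ft f l = 0.
  apply: contrapT => fl; apply: n0; exists l => -[U [oU vU] Ul].
  by apply: fl; exact: ft_eq0_off Ul.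
apply/eqP; rewrite (@distribution_of_fourier_eq0 setT)//; apply/eqP.
under [X in cintegral X]eq_fun do rewrite f0 mul0r.
by apply: complex_ext => /=; rewrite /Rintegral integral0.
Qed.

(** Otherwise the distribution would vanish on the open set [superlevel P r], which contains a point
    of the support by the definition of the supremum. *)
Lemma supp_radius_detect (r : R) : 0 <= r -> (r%:E < supp_radius P T)%E ->
  exists2 phi, test_in (superlevel P r) phi & cintegral (fun l => ft f l * phi l) != 0.
Proof.
move=> r0; rewrite /supp_radius; case: asboolP => [_|T0].
  by rewrite lte_fin ltNge r0.
move=> /ereal_sup_gt[_ [l sl <-]]; rewrite lte_fin => rl.
apply: contrapT => H; apply: sl; exists (superlevel P r) => //; split.
  exact: open_superlevel.
move=> phi tphi sphi; have tp : test_in (superlevel P r) phi by split.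
apply/eqP; rewrite (distribution_of_fourier_eq0 tp); apply/negPn/negP => np.
by apply: H; exists phi.
Qed.

End spectral_limit.

(** * Convergence in the extended reals, and conclusion *)

Section ereal_limit.
Variable R : realType.
Implicit Types (u : (\bar R)^nat) (L : \bar R).

(** Only positive thresholds are tested, since the growth estimates concern positive ratios:
    nonpositive lower thresholds follow from [0 <= u n], and for [L = +oo] the upper condition is
    void. *)
Lemma cvge_squeeze u L : (forall n, (0 <= u n)%E) -> (0 <= L)%E ->
  (forall t : R, 0 < t -> (L < t%:E)%E -> \forall n \near \oo, (u n <= t%:E)%E) ->
  (forall t : R, 0 < t -> (t%:E < L)%E -> \forall n \near \oo, (t%:E <= u n)%E) ->
  u n @[n --> \oo] --> L.
Proof.
move=> u0; case: L => [L||//] L0 up lo; last first.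
  apply/cvgeyPge => A.
  have [A0|A0] := ltP 0 A; first by apply: lo => //; exact: ltry.
  by near=> n; apply: le_trans (u0 n); rewrite lee_fin.
rewrite lee_fin in L0.
have near_up (e : R) : 0 < e -> \forall n \near \oo, (u n <= (L + e)%:E)%E.
  by move=> e0; apply: up; rewrite ?lte_fin ?ltrDl// ltr_wpDl.
have near_lo (e : R) : 0 < e -> \forall n \near \oo, ((L - e)%:E <= u n)%E.
  move=> e0; have [Le|Le] := ltP 0 (L - e); first by apply: lo; rewrite ?lte_fin ?gtrBl.
  by near=> n; apply: le_trans (u0 n); rewrite lee_fin.
have ufin : \forall n \near \oo, u n \is a fin_num.
  apply: filterS (near_up _ ltr01) => n un; rewrite ge0_fin_numE//.
  exact: le_lt_trans un (ltry _).
apply/fine_cvgP; split=> //; apply/cvgrPdist_le => e e0.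
near=> n.
have fn : u n \is a fin_num by near: n.
have le1 : fine (u n) <= L + e.
  by rewrite -lee_fin fineK//; near: n; exact: near_up.
have le2 : L - e <= fine (u n).
  by rewrite -lee_fin fineK//; near: n; exact: near_lo.
by rewrite /= ler_norml; apply/andP; split; lra.
Unshelve. all: by end_near. Qed.

End ereal_limit.

Theorem theorem2p5 (R : realType) (d : nat) (P : mpolynomial R[i] d)
  (p : \bar R) (f : 'rV[R]_d -> R[i]) (hp : (1 <= p)%E) (hf : schwartz f) :
  (cLnorm p (iter n (diffop P) f) `^ n%:R^-1)%E @[n --> \oo]
    --> supp_radius P (distribution_of (fourier f)).
Proof.
have rf := schwartz_rd hf.
have L0 := supp_radius_ge0 P rf.
apply: cvge_squeeze => //.
- by move=> n; exact: poweR_ge0.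
- move=> t t0 Lt.
  (* A real number [t] above the radius makes it finite, so that a midpoint can be taken. *)
  have Lf : supp_radius P (distribution_of (fourier f)) \is a fin_num.
    by rewrite ge0_fin_numE// (lt_trans Lt)// ltry.
  pose L := fine (supp_radius P (distribution_of (fourier f))).
  have LE : supp_radius P (distribution_of (fourier f)) = L%:E by rewrite fineK.
  rewrite LE lte_fin in Lt; rewrite LE lee_fin in L0.
  (* The midpoint is positive even when the radius is 0, and beyond it [ft f] vanishes because the
     symbol exceeds the radius there. *)
  apply: (@cLnorm_iter_upper _ _ P p f ((L + t) / 2)) => //; [lra|lra|split=> // l Pl].
  by apply: (ft_eq0_gt_radius (P := P)) => //; rewrite LE lte_fin; apply: lt_trans Pl; lra.
- move=> t t0 tL.
  (* Room strictly between [t] and the radius: the midpoint if the radius is finite, [t + 1] if it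
     is infinite. *)
  have [r tr rL] : exists2 r : R, t < r & (r%:E < supp_radius P (distribution_of (fourier f)))%E.
    case: supp_radius tL => [L|_|//].
      by rewrite lte_fin => tL; exists ((t + L) / 2); rewrite ?lte_fin; lra.
    by exists (t + 1); rewrite ?ltrDl ?ltry.
  have [phi tphi cphi] := supp_radius_detect rf (ltW (lt_trans t0 tr)) rL.
  exact: cLnorm_iter_lower tr rf tphi cphi.
Qed.
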